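(* Let $L$ be a (Hausdorff) locally compact group, let $G$ be a discrete group in the class $\mathcal G$, and let $\varphi:L\to G$ be an abstract (not necessarily continuous) homomorphism. Then either $\varphi$ is continuous, or there is a finite nontrivial subgroup $F\subseteq G$ such that $\varphi(L)$ is contained in the normalizer of $F$ in $G$.
   Context: $\mathcal G$ is the class of all groups $G$ such that (1) every torsion subgroup of $G$ is finite, and (2) every abelian subgroup of $G$ is a (possibly infinite) direct sum of cyclic groups. *)

(* Defs.v *)
From HB Require Import structures.
From mathcomp Require Import all_boot all_order all_algebra.
From mathcomp Require Import all_classical all_reals all_analysis.
Set Implicit Arguments. Unset Strict Implicit. Unset Printing Implicit Defensive.
Local Open Scope classical_set_scope.

Record is_group (T : Type) (mul : T -> T -> T) (one : T) (inv : T -> T) : Prop := {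
  grp_assoc : forall x y z, mul x (mul y z) = mul (mul x y) z;
  grp_mul1 : forall x, mul one x = x;
  grp_mulV : forall x, mul (inv x) x = one }.

Section GroupNotions.
Variables (T : Type) (mul : T -> T -> T) (one : T) (inv : T -> T).

Definition is_subgroup (H : set T) : Prop :=
  H one /\ (forall x y, H x -> H y -> H (mul x y)) /\ (forall x, H x -> H (inv x)).

Definition gpow (x : T) (n : nat) : T := iter n (mul x) one.
Definition gzpow (x : T) (k : int) : T :=
  match k with Posz n => gpow x n | Negz n => inv (gpow x n.+1) end.

Definition cyc (x : T) : set T := [set gzpow x k | k in [set: int]].

Definition has_finite_order (x : T) : Prop := exists2 n : nat, (0 < n)%N & gpow x n = one.

Definition is_torsion_subgroup (H : set T) : Prop :=
  is_subgroup H /\ forall x, H x -> has_finite_order x.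

Definition is_abelian_subgroup (H : set T) : Prop :=
  is_subgroup H /\ forall x y, H x -> H y -> mul x y = mul y x.

Definition gprod (I : Type) (s : seq I) (y : I -> T) : T :=
  foldr (fun i acc => mul (y i) acc) one s.

Definition is_direct_sum_of_cyclic (H : set T) : Prop :=
  exists (I : eqType) (x : I -> T),
    (forall i, H (x i)) /\
    (forall h, H h -> exists (s : seq I) (y : I -> T),
        uniq s /\ (forall i, i \in s -> cyc (x i) (y i)) /\ h = gprod s y) /\
    (forall (s : seq I) (y : I -> T), uniq s ->
        (forall i, i \in s -> cyc (x i) (y i)) -> gprod s y = one ->
        forall i, i \in s -> y i = one).

Definition in_class_G : Prop :=
  (forall H, is_torsion_subgroup H -> finite_set H) /\
  (forall H, is_abelian_subgroup H -> is_direct_sum_of_cyclic H).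

Definition normalizes (g : T) (F : set T) : Prop :=
  [set mul (mul g f) (inv g) | f in F] = F.

End GroupNotions.

(* Main.v *)
Require Import Defs.
From HB Require Import structures.
From mathcomp Require Import all_boot all_order all_algebra.
From mathcomp Require Import all_classical all_reals all_analysis.
From mathcomp Require Import ring lra zify.
From mathcomp Require Import Rstruct.
Set Implicit Arguments. Unset Strict Implicit. Unset Printing Implicit Defensive.
Import Order.TTheory GRing.Theory Num.Theory.
Import numFieldNormedType.Exports.
Local Open Scope classical_set_scope.

(* The homomorphism f has finite image on some neighbourhood of the identity. Then the
   intersection F of the images of all neighbourhoods of the identity is attained by one of
   them, hence is a finite subgroup, and it is normalized by f(L); if F is trivial, f is locally
   constant.

   On a compact subgroup K the image is finite: a closure of a cyclic group is compact abelian,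
   its image is a direct sum of cyclic groups, and a nonzero integral character of it is excluded
   by a divisibility argument along powers x^(1 + b + b^2 + ...). A one-parameter semigroup is
   killed by f, its image being divisible. So it suffices that L has a neighbourhood of the
   identity of the form (one-parameter semigroups)...(one-parameter semigroups) K with K a
   compact subgroup. This is a local Gleason-Yamabe theorem. Small subgroups are trapped in
   neighbourhoods by Gleason's argument: smoothed functions built from a Haar functional have
   second differences that are small at the time scale on which a set escapes, so that limits
   at that scale are compact groups, to which a gap lemma of Peter-Weyl type (an equivariant
   compact symmetric operator has finite-dimensional eigenspaces) applies. This yields a
   compact subgroup K which is isolated in, and normalized by, a compact neighbourhood U.
   Modulo K the powers of an element escape U at a rate that behaves like a norm, ultralimits of
   accelerated powers are one-parameter semigroups, and finitely many of them approximate every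
   slow element up to an error much slower than itself; iterating exhausts a
   neighbourhood. *)

(** * Locally compact groups *)

(** As [f] need not be continuous, it says nothing about limits; it can be controlled only through
    exact identities in [L]: divisibility along one-parameter semigroups, congruences along powers
    that converge in a compact group. Hence the neighbourhood has to be covered exactly, not
    approximately, by finitely many semigroups and one compact group. [K] is normalized by [U] only,
    so there need not be a quotient group of [L] to work in: estimates are stated for neighbourhoods
    of [K], which takes the place of the trivial subgroup in the theory of groups without small
    subgroups. [L] need not be first countable, hence limits along ultrafilters, sometimes on the
    neighbourhoods of the identity themselves. The exhaustion becomes exact because the error after
    [r] rounds is slow at scale [2^r N]: the correcting times are at most [1/N], [1/(2N)], [1/(4N)],
    ..., with bounded sum, and the accumulated times have a limit. *)

Record lcGroup := LcGroup {
  lcg_space :> topologicalType;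
  gmul : lcg_space -> lcg_space -> lcg_space;
  gid : lcg_space;
  ginv : lcg_space -> lcg_space;
  lcg_is_group : is_group gmul gid ginv;
  gmul_continuous : continuous (fun p : lcg_space * lcg_space => gmul p.1 p.2);
  ginv_continuous : continuous ginv;
  lcg_hausdorff : hausdorff_space lcg_space;
  lcg_locally_compact : locally_compact [set: lcg_space] }.

Arguments gid {l}.
Arguments gmul {l}.
Arguments ginv {l}.
Notation "x ∙ y" := (gmul x y) (at level 40, left associativity).
Notation "x ⁻¹" := (ginv x) (at level 3, left associativity, format "x ⁻¹").
Notation "x ^^ n" := (iter n (gmul x) gid) (at level 30, no associativity).

Section GroupAlgebra.
Variable L : lcGroup.
Implicit Types x y z : L.

Lemma gmulA x y z : x ∙ (y ∙ z) = x ∙ y ∙ z.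
Proof. exact: grp_assoc (lcg_is_group L) _ _ _. Qed.

Lemma gmul1g x : gid ∙ x = x.
Proof. exact: grp_mul1 (lcg_is_group L) _. Qed.

Lemma gmulVg x : x⁻¹ ∙ x = gid.
Proof. exact: grp_mulV (lcg_is_group L) _. Qed.

Lemma gmulgV x : x ∙ x⁻¹ = gid.
Proof.
by rewrite -[LHS]gmul1g -{1}(gmulVg x⁻¹) -gmulA (gmulA x⁻¹) gmulVg gmul1g gmulVg.
Qed.

Lemma gmulg1 x : x ∙ gid = x.
Proof. by rewrite -(gmulVg x) gmulA gmulgV gmul1g. Qed.

Lemma gmulgK x y : x ∙ y ∙ y⁻¹ = x.
Proof. by rewrite -gmulA gmulgV gmulg1. Qed.

Lemma gmulgVK x y : x ∙ y⁻¹ ∙ y = x.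
Proof. by rewrite -gmulA gmulVg gmulg1. Qed.

Lemma gmulIg x y z : x ∙ z = y ∙ z -> x = y.
Proof. by move=> /(congr1 (fun w => w ∙ z⁻¹)); rewrite !gmulgK. Qed.

Lemma ginvK x : x⁻¹⁻¹ = x.
Proof. by apply: (@gmulIg _ _ x⁻¹); rewrite gmulVg gmulgV. Qed.

Lemma ginvM x y : (x ∙ y)⁻¹ = y⁻¹ ∙ x⁻¹.
Proof. by apply: (@gmulIg _ _ (x ∙ y)); rewrite gmulVg gmulA gmulgVK gmulVg. Qed.

Lemma ginv1 : gid⁻¹ = gid :> L.
Proof. by rewrite -[LHS]gmul1g gmulgV. Qed.

Lemma iter_gmul x n y : iter n (gmul x) y = x ^^ n ∙ y.
Proof. by elim: n => [|n IH] /=; rewrite ?gmul1g // IH gmulA. Qed.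

Lemma pwD x m n : x ^^ (m + n) = x ^^ m ∙ x ^^ n.
Proof. by rewrite iterD iter_gmul. Qed.

Lemma pw1 x : x ^^ 1 = x.
Proof. by rewrite /= gmulg1. Qed.

Lemma pwSr x n : x ^^ n.+1 = x ^^ n ∙ x.
Proof. by rewrite -addn1 pwD pw1. Qed.

Lemma pwM x m n : x ^^ (m * n) = (x ^^ m) ^^ n.
Proof. by elim: n => [|n IH]; rewrite ?muln0// mulnS pwD IH. Qed.

Lemma pw_gid n : gid ^^ n = gid :> L.
Proof. by elim: n => //= n ->; rewrite gmul1g. Qed.

Lemma pwV x n : (x⁻¹) ^^ n = (x ^^ n)⁻¹.
Proof. by elim: n => [|n IH]; rewrite ?ginv1// pwSr IH -ginvM -/(iter n.+1 (gmul x) gid). Qed.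

Lemma pw_conj x y n : (y⁻¹ ∙ x ∙ y) ^^ n = y⁻¹ ∙ x ^^ n ∙ y.
Proof.
elim: n => [|n IH]; first by rewrite /= gmulg1 gmulVg.
by rewrite !pwSr IH !gmulA gmulgK.
Qed.

End GroupAlgebra.

(* free reduction of group words, in left-associated normal form *)
Ltac gsimp := rewrite ?(ginvM, ginvK, ginv1, gmulA, gmulgK, gmulgVK, gmulgV,
  gmulVg, gmul1g, gmulg1).

(** * Subgroups and products of sets *)

Definition subgrp (L : lcGroup) (H : set L) : Prop := is_subgroup gmul gid ginv H.

Section Subgroups.
Variable L : lcGroup.
Implicit Types (x y z : L) (H K : set L).

Lemma subgrp1 H : subgrp H -> H gid. Proof. by case. Qed.
Lemma subgrpM H x y : subgrp H -> H x -> H y -> H (x ∙ y).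
Proof. by move=> [_ [h _]]; exact: h. Qed.
Lemma subgrpV H x : subgrp H -> H x -> H x⁻¹.
Proof. by move=> [_ [_ h]]; exact: h. Qed.
Lemma subgrpX H x n : subgrp H -> H x -> H (x ^^ n).
Proof. by move=> sH Hx; elim: n => [|n IH] /=; [exact: subgrp1|exact: subgrpM]. Qed.

Lemma subgrp_gid : subgrp [set gid : L].
Proof.
split=> //; split=> [x y /= -> ->|x /= ->]; first by rewrite gmul1g.
by rewrite ginv1.
Qed.

Definition powers x : set L := [set y | exists n, y = x ^^ n \/ y = (x ^^ n)⁻¹].

Lemma powers_subgrp x : subgrp (powers x).
Proof.
have sub m n : powers x (x ^^ m ∙ (x ^^ n)⁻¹).
  have [le|/ltnW le] := leqP n m.
    by exists (m - n)%N; left; rewrite -{1}(subnK le) pwD gmulgK.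
  by exists (n - m)%N; right; rewrite -{1}(subnK le) pwD; gsimp.
have bus m n : powers x ((x ^^ n)⁻¹ ∙ x ^^ m).
  have [le|/ltnW le] := leqP n m.
    by exists (m - n)%N; left; rewrite -{1}(subnKC le) pwD; gsimp.
  by exists (n - m)%N; right; rewrite -{1}(subnKC le) pwD; gsimp.
split; first by exists 0%N; left.
split=> [y z|y].
  move=> [m [->|->]] [n [->|->]] //; first by exists (m + n)%N; left; rewrite pwD.
  by exists (n + m)%N; right; rewrite pwD ginvM.
by move=> [m [->|->]]; exists m; [right|left; rewrite ginvK].
Qed.

Lemma powers_self x n : powers x (x ^^ n). Proof. by exists n; left. Qed.

Fixpoint spow (Q : set L) (n : nat) : set L :=
  if n is m.+1 then [set x | exists q y, [/\ Q q, spow Q m y & x = q ∙ y]]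
  else [set gid].

Lemma spowS Q n q y : Q q -> spow Q n y -> spow Q n.+1 (q ∙ y).
Proof. by move=> Qq Qy; exists q, y. Qed.

Lemma spow1 Q q : Q q -> spow Q 1 q.
Proof. by move=> Qq; exists q, gid; split=> //; rewrite gmulg1. Qed.

Lemma spowD Q m n x y : spow Q m x -> spow Q n y -> spow Q (m + n) (x ∙ y).
Proof.
elim: m x => [|m IH] x /=; first by move=> -> ; rewrite gmul1g.
move=> [q [z [Qq Qz ->]]] Qy; rewrite -gmulA; exists q, (z ∙ y); split=> //.
exact: IH.
Qed.

Lemma spow_le Q m n : Q gid -> (m <= n)%N -> spow Q m `<=` spow Q n.
Proof.
move=> Q1 le x Qx; rewrite -(subnK le) -[x]gmul1g; apply: spowD => //.
by elim: (n - m)%N => //= k IH; exists gid, gid; rewrite gmul1g.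
Qed.

Lemma spowV Q n x : (forall q, Q q -> Q q⁻¹) -> spow Q n x -> spow Q n x⁻¹.
Proof.
move=> sQ; elim: n x => [|n IH] x /=; first by move=> ->; rewrite ginv1.
move=> [q [y [Qq Qy ->]]]; rewrite ginvM.
change (spow Q n.+1 (y⁻¹ ∙ q⁻¹)); rewrite -addn1; apply: spowD; first exact: IH.
by apply: spow1; exact: sQ.
Qed.

Lemma spowS_sub (Q Q' : set L) n : Q `<=` Q' -> spow Q n `<=` spow Q' n.
Proof.
by move=> QQ; elim: n => //= n IH x [q [y [Qq Qy ->]]]; exists q, y; split; [exact: QQ|exact: IH|].
Qed.

Lemma spow_pw Q n x : Q x -> spow Q n (x ^^ n).
Proof. by move=> Qx; elim: n => //= n IH; exists x, (x ^^ n). Qed.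

Lemma spow_bigcup_subgrp Q : Q gid -> (forall q, Q q -> Q q⁻¹) ->
  subgrp [set x | exists n, spow Q n x].
Proof.
move=> Q1 QV; split; first by exists 0%N.
split=> [x y [m Qx] [n Qy]|x [n Qx]]; first by exists (m + n)%N; exact: spowD.
by exists n; exact: spowV.
Qed.

Lemma spow4 (U : set L) x1 x2 x3 x4 : U x1 -> U x2 -> U x3 -> U x4 ->
  spow U 4 (x1 ∙ x2 ∙ x3 ∙ x4).
Proof.
move=> U1 U2 U3 U4; rewrite -!gmulA; do 3! [apply: spowS => //].
exact: spow1.
Qed.

End Subgroups.

Section Continuity.
Variables (L : lcGroup).

Lemma cvg_gmul (I : Type) (F : set_system I) {FF : Filter F} (x y : I -> L) a b :
  x @ F --> a -> y @ F --> b -> (x i ∙ y i) @[i --> F] --> a ∙ b.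
Proof.
move=> xa yb; apply: (@cvg_comp _ _ _ (fun i => (x i, y i)) (fun p : L * L => p.1 ∙ p.2)).
  exact: (cvg_pair xa yb).
exact: (@gmul_continuous L (a, b)).
Qed.

Lemma cvg_ginv (I : Type) (F : set_system I) {FF : Filter F} (x : I -> L) a :
  x @ F --> a -> (x i)⁻¹ @[i --> F] --> a⁻¹.
Proof.
by move=> xa; apply: (cvg_comp _ _ xa); exact: (@ginv_continuous L a).
Qed.

Lemma continuous_gmul (X : topologicalType) (f g : X -> L) :
  continuous f -> continuous g -> continuous (fun x => f x ∙ g x).
Proof. by move=> cf cg x; apply: cvg_gmul; [exact: cf|exact: cg]. Qed.

Lemma continuous_ginv (X : topologicalType) (f : X -> L) :
  continuous f -> continuous (fun x => (f x)⁻¹).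
Proof. by move=> cf x; apply: cvg_ginv; exact: cf. Qed.

Lemma continuous_pw (X : topologicalType) (f : X -> L) n :
  continuous f -> continuous (fun x => f x ^^ n).
Proof.
move=> cf; elim: n => [|n IH] /=; first by move=> x; exact: cvg_cst.
exact: (continuous_gmul cf IH).
Qed.

Lemma cvg_pw (I : Type) (F : set_system I) {FF : Filter F} (x : I -> L) a n :
  x @ F --> a -> (x i ^^ n) @[i --> F] --> a ^^ n.
Proof.
move=> xa; elim: n => [|n IH] /=; first exact: cvg_cst.
exact: (cvg_gmul xa IH).
Qed.

End Continuity.

Lemma continuous_id_fun (X : topologicalType) : continuous (fun x : X => x).
Proof. by move=> x. Qed.
Lemma continuous_cst_fun (X Y : topologicalType) (c : Y) : continuous (fun _ : X => c).
Proof. by move=> x; exact: cvg_cst. Qed.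
Lemma continuous_fst_fun (X Y : topologicalType) : continuous (fun p : X * Y => p.1).
Proof. by move=> x; exact: cvg_fst. Qed.
Lemma continuous_snd_fun (X Y : topologicalType) : continuous (fun p : X * Y => p.2).
Proof. by move=> x; exact: cvg_snd. Qed.

Ltac gcont := repeat (first
  [ exact: continuous_cst_fun | exact: continuous_id_fun
  | exact: continuous_fst_fun | exact: continuous_snd_fun
  | apply: continuous_gmul | apply: continuous_ginv | apply: continuous_pw ]).

Section Topology.
Variable L : lcGroup.
Implicit Types (x y z : L) (A B C K U V W O : set L).

Lemma nbhs_preimage (X Y : topologicalType) (f : X -> Y) a (O : set Y) :
  continuous f -> nbhs (f a) O -> nbhs a [set x | O (f x)].
Proof. by move=> cf nO; exact: cf. Qed.

Lemma nbhs_translate x V : nbhs gid V -> nbhs x [set y | V (y ∙ x⁻¹)].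
Proof.
move=> nV; apply: (@nbhs_preimage _ _ (fun y => y ∙ x⁻¹)); first gcont.
by rewrite /= gmulgV.
Qed.

Lemma nbhs_translate_left x V : nbhs gid V -> nbhs x [set y | V (x⁻¹ ∙ y)].
Proof.
move=> nV; apply: (@nbhs_preimage _ _ (fun y => x⁻¹ ∙ y)); first gcont.
by rewrite /= gmulVg.
Qed.

Lemma nbhs_ginv V : nbhs gid V -> nbhs gid [set x : L | V x⁻¹].
Proof.
by move=> nV; apply: (@nbhs_preimage _ _ ginv); [gcont|rewrite ginv1].
Qed.

Lemma compact_closedL C : compact C -> closed C.
Proof. by move=> cC; apply: compact_closed => //; exact: lcg_hausdorff. Qed.

(** The tube lemma. Neighbourhoods of the identity that are uniform over a compact set come from it
    by a suitable choice of [g]. *)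
Lemma tube (X T : topologicalType) (g : L * X -> T) (C : set X) (O : set T) :
  continuous g -> compact C -> (forall k, C k -> nbhs (g (gid, k)) O) ->
  exists2 W, nbhs (gid : L) W & forall w k, W w -> C k -> O (g (w, k)).
Proof.
move=> cg /compact_near_coveringP cC gO.
exists [set w | C `<=` [set k | O (g (w, k))]]; last by move=> w k /= CO /CO.
apply: (cC L (nbhs (gid : L)) (fun w k => O (g (w, k)))) => k Ck.
have := @nbhs_preimage _ _ g (gid, k) O cg (gO k Ck).
move=> [[A B] [nA nB] AB]; exists (B, A); first by split.
by move=> [k' w] [Bk Aw]; exact: (AB (w, k')).
Qed.

End Topology.

(** * Limits along ultrafilters *)

Lemma directed_ultra (I : Type) (le : I -> I -> Prop) (i0 : I) :
  (forall i, le i i) -> (forall i j k, le i j -> le j k -> le i k) ->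
  (forall i j, exists k, le i k /\ le j k) ->
  exists F : set_system I, UltraFilter F /\ forall i, F [set j | le i j].
Proof.
move=> refl trans dir.
have PF : ProperFilter (filter_from [set: I] (fun i => [set j | le i j])).
  apply: filter_from_proper; last by move=> i _; exists i; exact: refl.
  apply: filter_from_filter; first by exists i0.
  move=> i j _ _; have [k [ik jk]] := dir i j; exists k => // l /= kl.
  by split; apply: trans kl.
have [F [UF sF]] := ultraFilterLemma PF.
by exists F; split=> // i; apply: sF; exists i.
Qed.

Lemma nat_ultra : exists F : set_system nat,
  UltraFilter F /\ forall i, F [set j | (i <= j)%N].
Proof.
apply: (directed_ultra 0%N (le := fun i j => (i <= j)%N)) => [//|i j k|i j].
  exact: leq_trans.
by exists (maxn i j); rewrite leq_maxl leq_maxr.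
Qed.

Lemma ultra_fmap (I T : Type) (F : set_system I) (x : I -> T) :
  UltraFilter F -> UltraFilter (x @ F).
Proof.
move=> UF; split; first exact: fmap_proper_filter.
move=> G PG sG; apply/predeqP => A; split; last exact: sG.
move=> GA; have [//|nA] := in_ultra_setVsetC (x @^-1` A) UF.
have GnA : G (~` A) by apply: sG.
have : G (A `&` ~` A) by exact: filterI.
by rewrite setICr => /filter_not_empty.
Qed.

Lemma ultra_lim (T : topologicalType) (I : Type) (F : set_system I) (C : set T)
  (x : I -> T) : UltraFilter F -> compact C -> F [set i | C (x i)] ->
  exists2 p, C p & x @ F --> p.
Proof.
rewrite compact_ultra => UF cC Cx.
by have [p [Cp xp]] := cC _ (ultra_fmap x UF) Cx; exists p.
Qed.

Lemma lim_closed (T : topologicalType) (I : Type) (F : set_system I) (C : set T)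
  (x : I -> T) (p : T) : ProperFilter F -> closed C -> F [set i | C (x i)] ->
  x @ F --> p -> C p.
Proof. by move=> PF cC Cx xp; apply: (closed_cvg C) xp. Qed.

Lemma lim_notin (T : topologicalType) (I : Type) (F : set_system I) (O : set T)
  (x : I -> T) (p : T) : ProperFilter F -> F [set i | ~ O (x i)] ->
  x @ F --> p -> ~ nbhs p O.
Proof.
move=> PF nO xp /xp xO; have {}xO : F [set i | O (x i)] by [].
by have [i [h1 h2]] := filter_ex (filterI nO xO); exact: h1.
Qed.

Section Topology.
Variable L : lcGroup.
Implicit Types (x y z : L) (A B C K U V W O : set L).

Definition sym A := forall x, A x -> A x⁻¹.

Lemma lim_unique (I : Type) (F : set_system I) (x : I -> L) (p q : L) :
  ProperFilter F -> x @ F --> p -> x @ F --> q -> p = q.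
Proof. by move=> PF xp xq; exact: (@cvg_unique L (@lcg_hausdorff L) _ _ _ _ xp xq). Qed.

Lemma nbhs_sym U : nbhs gid U -> exists W, [/\ nbhs gid W, sym W & W `<=` U].
Proof.
move=> nU; exists (U `&` [set x | U x⁻¹]); split; last by move=> x [].
  by apply: filterI => //; exact: nbhs_ginv.
by move=> x [Ux Vx]; split=> //=; rewrite ginvK.
Qed.

Lemma nbhs_split U : nbhs gid U ->
  exists W, [/\ nbhs gid W, sym W & forall x y, W x -> W y -> U (x ∙ y)].
Proof.
move=> nU.
have : nbhs (gid, gid) [set p : L * L | U (p.1 ∙ p.2)].
  by apply: (@nbhs_preimage _ _ (fun p : L * L => p.1 ∙ p.2)); [gcont|rewrite gmul1g].
move=> [[A B] [/= nA nB] AB].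
have [W [nW sW WAB]] := nbhs_sym (filterI nA nB).
by exists W; split=> // x y /WAB[Ax _] /WAB[_ By]; exact: (AB (x, y)).
Qed.

Lemma compact_nbhs U : nbhs gid U ->
  exists C, [/\ compact C, nbhs gid C, sym C & C `<=` U].
Proof.
move=> nU.
have [B nB [cB clB]] := @lcg_locally_compact L gid I.
have {}nB : nbhs gid B by move: nB; rewrite /within /=; apply: filterS => x; exact.
have [W [nW sW WU]] := nbhs_split (filterI nU nB).
have clW : closure W `<=` U `&` B.
  move=> x /(_ _ (nbhs_translate x nW)) [w [Ww /= Ww']].
  have := WU _ _ (sW _ Ww') Ww; rewrite (_ : (w ∙ x⁻¹)⁻¹ ∙ w = x) //; gsimp => //.
exists (closure W `&` [set x | closure W x⁻¹]); split.
- apply: (subclosed_compact _ cB) => [|x [/clW[]]//].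
  apply: closedI; first exact: closed_closure.
  apply: (closed_comp (f := @ginv L)); last exact: closed_closure.
  by move=> x _; exact: ginv_continuous.
- apply: filterS nW => x Wx; split; apply: subset_closure => //.
  exact: sW.
- by move=> x [? ?]; split=> //=; rewrite ginvK.
- by move=> x [/clW[]].
Qed.

Lemma compact_gmul A B : compact A -> compact B ->
  compact [set x | exists a b, [/\ A a, B b & x = a ∙ b]].
Proof.
move=> cA cB.
rewrite (_ : [set x | _] = (fun p : L * L => p.1 ∙ p.2) @` (A `*` B)).
  apply: continuous_compact; last exact: compact_setX.
  by apply: continuous_subspaceT; exact: gmul_continuous.
apply/predeqP => x; split; first by move=> [a [b [Aa Bb ->]]]; exists (a, b).
by move=> [[a b] [/= Aa Bb] <-]; exists a, b.
Qed.

Lemma compact_spow A n : compact A -> compact (spow A n).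
Proof.
by move=> cA; elim: n => [|n IH] /=; [exact: compact_set1|exact: compact_gmul].
Qed.

Lemma compact_ginv A : compact A -> compact [set x | A x⁻¹].
Proof.
move=> cA; rewrite (_ : [set x | _] = ginv @` A).
  apply: continuous_compact => //.
  by apply: continuous_subspaceT; exact: ginv_continuous.
apply/predeqP => x; split; first by exists x⁻¹ => //; rewrite ginvK.
by move=> [y Ay <-] /=; rewrite ginvK.
Qed.

Lemma closure_subgrp A : subgrp A -> subgrp (closure A).
Proof.
move=> sA; split; first by apply: subset_closure; exact: subgrp1.
split=> [x y cx cy|x cx].
- move=> V nV; have : nbhs (x, y) [set p : L * L | V (p.1 ∙ p.2)].
    by apply: (@nbhs_preimage _ _ (fun p : L * L => p.1 ∙ p.2)); first gcont.
  move=> [[X Y] [/= nX nY] XY].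
  have [a [Aa Xa]] := cx _ nX; have [b [Ab Yb]] := cy _ nY.
  by exists (a ∙ b); split; [exact: subgrpM|exact: (XY (a, b))].
- move=> V nV; have := cx [set z | V z⁻¹] (@nbhs_preimage _ _ ginv x V (@ginv_continuous L) nV).
  by move=> [a [Aa Va]]; exists a⁻¹; split=> //; exact: subgrpV.
Qed.

Lemma nbhs_of_compact K O : compact K -> (forall k, K k -> nbhs k O) ->
  exists2 W, nbhs gid W & forall w k, W w -> K k -> O (w ∙ k).
Proof.
move=> cK KO; apply: (@tube L L L (fun p => p.1 ∙ p.2)) => //; first gcont.
by move=> k Kk; rewrite /= gmul1g; exact: KO.
Qed.

Lemma nbhs_conj_compact C V : compact C -> nbhs gid V ->
  exists2 W, nbhs gid W & forall w k, W w -> C k -> V (k⁻¹ ∙ w ∙ k).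
Proof.
move=> cC nV; apply: (@tube L L L (fun p => p.2⁻¹ ∙ p.1 ∙ p.2)) => //; first gcont.
by move=> k Ck; rewrite /= gmulg1 gmulVg.
Qed.

(** The factors from [K] are moved to the right end. Each passage conjugates a factor from [W] by an
    element of [K], and compactness of [K] yields one [W] that is small enough for all these
    conjugations. *)
Lemma thicken_aux K n V : compact K -> subgrp K -> nbhs gid V ->
  exists2 W, nbhs gid W & forall x,
    spow [set y | exists k w k', [/\ K k, W w, K k' & y = k ∙ w ∙ k']] n x ->
    exists w k, [/\ V w, K k & x = w ∙ k].
Proof.
move=> cK sK; elim: n V => [|n IH] V nV.
  exists V => // x /= ->; exists gid, gid; split; rewrite ?gmul1g //.
    exact: nbhs_singleton.
  exact: subgrp1.
have [V' [nV' _ VV]] := nbhs_split nV.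
have [V2 nV2 V2V] := nbhs_conj_compact cK nV'.
have [W nW WV] := IH _ nV2.
exists (W `&` V2); first exact: filterI.
move=> x /= [q [y [[k [w [k' [Kk [Ww V2w] Kk' ->]]]] Wy ->]]].
have [w1 [k1 [V2w1 Kk1 ->]]] : exists w k, [/\ V2 w, K k & y = w ∙ k].
  by apply: WV; apply: spowS_sub Wy => _ [a [b [c [? [? ?] ? ->]]]]; exists a, b, c.
exists ((k ∙ w ∙ k⁻¹) ∙ (k ∙ k' ∙ w1 ∙ (k ∙ k')⁻¹)), (k ∙ k' ∙ k1); split.
- apply: VV.
    have := V2V w k⁻¹ V2w (subgrpV sK Kk); by rewrite ginvK.
  have := V2V w1 (k ∙ k')⁻¹ V2w1 (subgrpV sK (subgrpM sK Kk Kk')); by rewrite ginvK.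
- by apply: subgrpM => //; exact: subgrpM.
- by gsimp.
Qed.

(** The witness is [K C K] with [C] a small compact neighbourhood of the identity. Stability under
    [K] on both sides later makes escape from [U] a matter of cosets of [K]. *)
Lemma thicken K n O : compact K -> subgrp K -> (forall k, K k -> nbhs k O) ->
  exists U, [/\ compact U, sym U, (forall k, K k -> nbhs k U),
    (forall k u k', K k -> U u -> K k' -> U (k ∙ u ∙ k')) & spow U n `<=` O].
Proof.
move=> cK sK KO; have [V nV VO] := nbhs_of_compact cK KO.
have [W nW WV] := thicken_aux n cK sK nV.
have [C [cC nC sC CW]] := compact_nbhs nW.
exists [set y | exists k w k', [/\ K k, C w, K k' & y = k ∙ w ∙ k']]; split.
- have := compact_gmul (compact_gmul cK cC) cK; congr compact.
  apply/predeqP => y; split.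
    by move=> [_ [k' [[k [w [Kk Cw ->]]] Kk' ->]]]; exists k, w, k'.
  move=> [k [w [k' [Kk Cw Kk' ->]]]]; exists (k ∙ w), k'; split=> //.
  by exists k, w.
- move=> _ [k [w [k' [Kk Cw Kk' ->]]]]; exists k'⁻¹, w⁻¹, k⁻¹.
  by split; [exact: subgrpV|exact: sC|exact: subgrpV|rewrite !ginvM gmulA].
- move=> k Kk; apply: filterS (nbhs_translate k nC) => y /= Cy.
  by exists gid, (y ∙ k⁻¹), k; split=> //; [exact: subgrp1|gsimp].
- move=> a _ b Ka [k [w [k' [Kk Cw Kk' ->]]]] Kb; exists (a ∙ k), w, (k' ∙ b).
  by split; [exact: subgrpM| |exact: subgrpM|gsimp].
- move=> x Ux; have [w [k [Vw Kk ->]]] : exists w k, [/\ V w, K k & x = w ∙ k].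
    by apply: WV; apply: spowS_sub Ux => _ [a [b [c [? ? ? ->]]]]; exists a, b, c; split=> //; exact: CW.
  exact: VO.
Qed.

(** Turns a statement about all times into one about a bounded time: points of [Q n] outside [O]
    would have an ultralimit that lies in every [Q n]. *)
Lemma decreasing_compact (Q : nat -> set L) C O : compact C ->
  (forall n, closed (Q n)) -> (forall n, Q n `<=` C) ->
  (forall m n, (m <= n)%N -> Q n `<=` Q m) ->
  (forall x, (forall n, Q n x) -> nbhs x O) -> exists n, Q n `<=` O.
Proof.
move=> cC clQ QC dQ QO; apply: contrapT => nQ.
have /choice [x Px] : forall n, exists x, Q n x /\ ~ O x.
  move=> n; apply: contrapT => nx; apply: nQ; exists n => y Qy.
  by apply: contrapT => nO; apply: nx; exists y.
have [F [UF Fn]] := nat_ultra.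
have [|p Cp xp] := ultra_lim (x := x) UF cC; first by apply: filterE => i; apply: QC (Px i).1.
have /QO : forall n, Q n p.
  move=> n; apply: (lim_closed _ (clQ n) _ xp).
  by apply: filterS (Fn n) => i /= ni; apply: dQ ni _ (Px i).1.
by apply: (lim_notin _ _ xp); apply: filterE => i; exact: (Px i).2.
Qed.

End Topology.

(** * Haar functional of a closed subgroup *)

Section Bump.
Variables (R : realType) (L : lcGroup).
Local Open Scope ring_scope.

Lemma bump_function (V : set L) : nbhs gid V -> exists b : L -> R,
  [/\ continuous b, (forall x, 0 <= b x <= 1), b gid = 1 & forall x, ~ V x -> b x = 0].
Proof.
move=> nV.
have cr := @locally_compact_completely_regular L R (@lcg_locally_compact L) (@lcg_hausdorff L).
have clB : closed (~` (interior V)) by apply: open_closedC; exact: open_interior.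
have nB : ~ (~` (interior V)) (gid : L) by move=> h; apply: h.
have /(@uniform_separatorP L R) [f [cf f01 f0 f1]] := cr gid _ clB nB.
exists (fun x => 1 - f x); split.
- by move=> x; apply: cvgB; [exact: cvg_cst|exact: cf].
- move=> x; have /= := f01 (f x) (ex_intro2 _ _ x I erefl).
  by rewrite in_itv /= => /andP[? ?]; apply/andP; split; lra.
- by rewrite (f0 (f gid) (ex_intro2 _ _ gid erefl erefl)) subr0.
- move=> x nVx; rewrite (f1 (f x)) ?subrr //; exists x => // /interior_subset.
  exact: nVx.
Qed.

(** The near-covering form of compactness is applied to the filter of finite lists ordered by
    inclusion. *)
Lemma finite_cover (C : set L) (f : L -> set L) : compact C ->
  (forall x, C x -> open (f x) /\ f x x) ->
  exists s : seq L, (forall x, x \in s -> C x) /\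
    forall y, C y -> exists2 x, x \in s & f x y.
Proof.
move=> /compact_near_coveringP cC fC.
pose ok (s : seq L) := forall x, x \in s -> C x.
pose F := filter_from [set s | ok s] (fun s => [set t | ok t /\ {subset s <= t}]).
have PF : ProperFilter F.
  apply: filter_from_proper; last by move=> s oks; exists s; split.
  apply: filter_from_filter; first by exists [::].
  move=> s t oks okt; exists (s ++ t).
    by move=> x; rewrite mem_cat => /orP[/oks|/okt].
  by move=> u [oku su]; split; split=> // x xs; apply: su; rewrite mem_cat xs ?orbT.
have /filter_ex [s [oks sP]] : F [set s | ok s /\ C `<=` [set y | exists2 x, x \in s & f x y]].
  apply: filterI; first by exists [::] => // s [].
  apply: (cC _ F (fun s y => exists2 x, x \in s & f x y)) => x Cx.
  have [ofx fxx] := fC x Cx.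
  exists (f x, [set t | ok t /\ {subset [:: x] <= t}]).
    split; first exact: open_nbhs_nbhs.
    by exists [:: x] => // y; rewrite inE => /eqP ->.
  by move=> [y t] [/= fxy [_ xt]]; exists x => //; apply: xt; rewrite mem_head.
by exists s.
Qed.

Lemma open_gt_fun (g : L -> R) (c : R) : continuous g -> open [set x | c < g x].
Proof.
move=> cg; rewrite (_ : [set x | c < g x] = g @^-1` [set y | c < y]) //.
by apply: open_comp; [move=> x _; exact: cg|exact: open_gt].
Qed.

Lemma compact_bounded_fun (g : L -> R) (C : set L) : compact C -> continuous g ->
  exists2 B, 0 <= B & forall x, C x -> `|g x| <= B.
Proof.
move=> cC cg; have cgC : compact (g @` C).
  by apply: continuous_compact => //; exact: continuous_subspaceT.
have [M [_ MB]] := compact_bounded cgC.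
exists (`|M| + 1); first by rewrite addr_ge0.
move=> x Cx; apply: (MB (`|M| + 1)); last by exists x.
by rewrite (le_lt_trans (ler_norm _)) // ltrDl.
Qed.

Lemma unif_cont_compact (g : L -> R) (C : set L) e : compact C -> continuous g ->
  0 < e -> exists2 W, nbhs gid W & forall w k, W w -> C k -> `|g (k ∙ w) - g k| < e.
Proof.
move=> cC cg e0.
have cgg : continuous (fun p : L * L => g (p.2 ∙ p.1) - g p.2).
  move=> p; apply: (@cvgB R R^o).
    apply: (@continuous_comp _ _ _ (fun p : L * L => p.2 ∙ p.1)); last exact: cg.
    by move: p; gcont.
  apply: (@continuous_comp _ _ _ (fun p : L * L => p.2)); last exact: cg.
  by move: p; gcont.
have [k Ck|W nW WP] := @tube L L R (fun p => g (p.2 ∙ p.1) - g p.2) C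
  [set y | `|y| < e] cgg cC.
  rewrite /= gmulg1 subrr; apply: filterS (nbhsx_ballx (0 : R^o) e e0) => y.
  by rewrite /ball /= sub0r normrN.
by exists W => // w k Ww Ck; exact: (WP w k).
Qed.

End Bump.

Lemma nbhs_ultra (L : lcGroup) : exists F : set_system (set L), UltraFilter F /\
  forall V, nbhs gid V -> F [set V' | nbhs gid V' /\ V' `<=` V].
Proof.
have PF : ProperFilter (filter_from [set V : set L | nbhs gid V]
    (fun V => [set V' | nbhs gid V' /\ V' `<=` V])).
  apply: filter_from_proper; last by move=> V nV; exists V; split.
  apply: filter_from_filter; first by exists setT; exact: filterT.
  move=> V W nV nW; exists (V `&` W); first exact: filterI.
  by move=> V' [nV' VV]; split; split=> // x /VV[].
have [F [UF sF]] := ultraFilterLemma PF.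
by exists F; split=> // V nV; apply: sF; exists V.
Qed.

(** * Covering numbers of functions *)

Section Covering.
Variables (R : realType) (L : lcGroup) (H : set L).
Hypotheses (sH : subgrp H) (clH : closed H).
Local Open Scope ring_scope.
Implicit Types (h g k psi chi : L -> R) (s : seq (R * L)).

Definition csupp h := exists C, [/\ compact C, C `<=` H &
  forall x, H x -> ~ C x -> h x = 0].

Definition Cc h := continuous h /\ csupp h.
Definition Ccp h := Cc h /\ forall x, 0 <= h x.

Definition wsum s psi x : R := \sum_(p <- s) p.1 * psi (p.2⁻¹ ∙ x).
Definition wtot s : R := \sum_(p <- s) p.1.
Definition wok s := forall p, p \in s -> 0 <= p.1 /\ H p.2.

Definition cov h psi c := exists s, [/\ wok s,
  forall x, H x -> h x <= wsum s psi x & c = wtot s].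

Lemma cov_add h g psi c d : cov h psi c -> cov g psi d ->
  cov (fun x => h x + g x) psi (c + d).
Proof.
move=> [s [oks hs ->]] [t [okt gt ->]]; exists (s ++ t); split.
- by move=> p; rewrite mem_cat => /orP[/oks|/okt].
- by move=> x Hx; rewrite /wsum big_cat; apply: lerD; [exact: hs|exact: gt].
- by rewrite /wtot big_cat.
Qed.

Lemma cov_scale a h psi c : 0 <= a -> cov h psi c -> cov (fun x => a * h x) psi (a * c).
Proof.
move=> a0 [s [oks hs ->]]; exists [seq (a * p.1, p.2) | p <- s]; split.
- by move=> _ /mapP [p ps ->] /=; have [p0 Hp] := oks p ps; split=> //; exact: mulr_ge0.
- move=> x Hx; rewrite /wsum big_map /=.
  under eq_bigr do rewrite -mulrA.
  by rewrite -mulr_sumr; apply: ler_wpM2l => //; exact: hs.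
- by rewrite /wtot big_map /= mulr_sumr.
Qed.

Lemma cov_mono h g psi c : (forall x, H x -> h x <= g x) -> cov g psi c -> cov h psi c.
Proof.
move=> hg [s [oks gs ->]]; exists s; split=> // x Hx.
by apply: le_trans (gs _ Hx); exact: hg.
Qed.

Lemma cov_translate z h psi c : H z -> cov h psi c -> cov (fun x => h (z ∙ x)) psi c.
Proof.
move=> Hz [s [oks hs ->]]; exists [seq (p.1, z⁻¹ ∙ p.2) | p <- s]; split.
- move=> _ /mapP [p ps ->] /=; have [p0 Hp] := oks p ps; split=> //.
  by apply: subgrpM => //; exact: subgrpV.
- move=> x Hx; rewrite /wsum big_map /=.
  apply: le_trans (hs _ (subgrpM sH Hz Hx)) _; rewrite /wsum.
  by apply: ler_sum => p _; rewrite ginvM ginvK gmulA.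
- by rewrite /wtot big_map.
Qed.

Lemma cov_trans h chi psi c d : cov h chi c -> cov chi psi d -> cov h psi (c * d).
Proof.
move=> [s [oks hs ->]] cd.
suff : cov (fun x => wsum s chi x) psi (wtot s * d) by apply: cov_mono.
elim: s oks {hs} => [|p s IH] oks.
  exists [::]; split=> //; last by rewrite /wtot !big_nil mul0r.
  by move=> x Hx; rewrite /wsum !big_nil.
rewrite /wtot big_cons mulrDl -/(wtot s).
have [p0 Hp] := oks p (mem_head _ _).
apply: (@cov_mono _ (fun x => p.1 * chi (p.2⁻¹ ∙ x) + wsum s chi x)).
  by move=> x Hx; rewrite /wsum big_cons.
apply: cov_add; last by apply: IH => q qs; apply: oks; rewrite inE qs orbT.
apply: cov_scale => //; apply: (@cov_translate p.2⁻¹) => //.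
exact: subgrpV.
Qed.

Lemma cov_ge h psi c x : (forall y, psi y <= 1) -> cov h psi c -> H x -> h x <= c.
Proof.
move=> psi1 [s [oks hs ->]] Hx; apply: le_trans (hs _ Hx) _.
rewrite /wsum /wtot big_seq [leRHS]big_seq; apply: ler_sum => p /oks[p0 _].
by rewrite -[leRHS]mulr1; apply: ler_wpM2l.
Qed.

Lemma cov_ge0 h psi c : cov h psi c -> 0 <= c.
Proof.
move=> [s [oks _ ->]]; rewrite /wtot big_seq; apply: sumr_ge0 => p.
by move=> /oks[].
Qed.

Lemma cov_ex h psi x0 : Cc h -> continuous psi -> (forall x, 0 <= psi x) ->
  H x0 -> 0 < psi x0 -> exists c, cov h psi c.
Proof.
move=> [ch [C [cC CH h0]]] cpsi psi0 Hx0 px0.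
have [B B0 hB] := compact_bounded_fun cC ch.
have [|s [sC sP]] := @finite_cover L C
    (fun x => [set y | psi x0 / 2 < psi ((x ∙ x0⁻¹)⁻¹ ∙ y)]) cC.
  move=> x Cx; split; last by rewrite /=; gsimp; lra.
  apply: open_gt_fun => y; apply: (@continuous_comp _ _ _ (gmul (x ∙ x0⁻¹)⁻¹)); last exact: cpsi.
  by move: y; gcont.
(* Where [h] is carried it is at most [B], and some chosen translate of [psi] exceeds [psi x0 / 2];
   hence this weight. *)
pose w := [seq (2 * B / psi x0, x ∙ x0⁻¹) | x <- s].
have c0 : 0 <= 2 * B / psi x0 by rewrite divr_ge0 // ?mulr_ge0 // ltW.
exists (wtot w), w; split=> //.
  move=> _ /mapP [x xs ->]; split=> //=; apply: subgrpM => //; last exact: subgrpV.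
  by apply: CH; exact: sC.
move=> x Hx; have [Cx|nCx] := pselect (C x); last first.
  rewrite h0 // /wsum big_map; apply: sumr_ge0 => y _; exact: mulr_ge0.
have [y ys yx] := sP x Cx.
rewrite /wsum big_map (big_rem y) //=.
apply: (@le_trans _ _ (2 * B / psi x0 * psi ((y ∙ x0⁻¹)⁻¹ ∙ x))); last first.
  by rewrite lerDl; apply: sumr_ge0 => z _; exact: mulr_ge0.
apply: le_trans (ler_norm _) _; apply: le_trans (hB x Cx) _.
rewrite [leLHS](_ : B = 2 * B / psi x0 * (psi x0 / 2)); last by field; rewrite gt_eqF.
by apply: ler_wpM2l => //; exact: ltW.
Qed.

(** The covering number [(h : psi)] of Weil's construction of Haar measure, with translates along
    [H]. *)
Definition cnum h psi : R := inf [set c | cov h psi c].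

Definition bumpy psi := [/\ continuous psi, (forall x, 0 <= psi x <= 1) & psi gid = 1].

Lemma bumpy_cov h psi : Cc h -> bumpy psi -> exists c, cov h psi c.
Proof.
move=> Ch [cp p01 p1]; apply: (@cov_ex _ _ gid) => //; last by rewrite p1.
  by move=> x; case/andP: (p01 x).
exact: subgrp1.
Qed.

Lemma cnum_le h psi c : cov h psi c -> cnum h psi <= c.
Proof.
move=> hc; apply: ge_inf => //; by exists 0 => d /cov_ge0.
Qed.

Lemma le_cnum h psi m : (exists c, cov h psi c) -> (forall c, cov h psi c -> m <= c) ->
  m <= cnum h psi.
Proof. by move=> ex hm; apply: lb_le_inf => //; move=> c; exact: hm. Qed.

Lemma cnum_ge0 h psi : (exists c, cov h psi c) -> 0 <= cnum h psi.
Proof. by move=> ex; apply: le_cnum => // c /cov_ge0. Qed.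

Lemma cnum_add h g psi : (exists c, cov h psi c) -> (exists c, cov g psi c) ->
  cnum (fun x => h x + g x) psi <= cnum h psi + cnum g psi.
Proof.
move=> hc gc; rewrite -lerBlDr; apply: le_cnum => // c hc'.
rewrite lerBlDr -lerBlDl; apply: le_cnum => // d gd'.
by rewrite lerBlDl; apply: cnum_le; exact: cov_add.
Qed.

Lemma cnum_scale a h psi : 0 < a -> (exists c, cov h psi c) ->
  cnum (fun x => a * h x) psi = a * cnum h psi.
Proof.
move=> a0 hc; apply/eqP; rewrite eq_le; apply/andP; split.
  rewrite -ler_pdivrMl //; apply: le_cnum => // c hc'; rewrite ler_pdivrMl //.
  by apply: cnum_le; apply: cov_scale => //; exact: ltW.
apply: le_cnum; first by case: hc => c hc; exists (a * c); apply: cov_scale => //; exact: ltW.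
move=> c /(cov_scale (a := a^-1)) hc'; rewrite mulrC -ler_pdivlMr // mulrC.
apply: cnum_le; apply: cov_mono (hc' _); last by rewrite invr_ge0 ltW.
by move=> x _; rewrite mulrA mulVf ?mul1r // gt_eqF.
Qed.

Lemma cnum_mono h g psi : (forall x, H x -> h x <= g x) -> (exists c, cov g psi c) ->
  cnum h psi <= cnum g psi.
Proof.
by move=> hg gc; apply: le_cnum => // c gc'; apply: cnum_le; apply: cov_mono gc'.
Qed.

Lemma cnum_translate z h psi : H z -> (exists c, cov h psi c) ->
  cnum (fun x => h (z ∙ x)) psi = cnum h psi.
Proof.
move=> Hz hc; apply/eqP; rewrite eq_le; apply/andP; split.
  by apply: le_cnum => // c hc'; apply: cnum_le; exact: cov_translate.
apply: le_cnum; first by case: hc => c hc; exists c; exact: cov_translate.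
move=> c /(cov_translate (subgrpV sH Hz)) hc'; apply: cnum_le.
by apply: cov_mono hc' => x _; gsimp.
Qed.

Lemma cnum_trans h chi psi : (exists c, cov h chi c) -> (exists c, cov chi psi c) ->
  cnum h psi <= cnum h chi * cnum chi psi.
Proof.
move=> hc cp; have aux h' g' (m d : R) : (exists c, cov h' g' c) -> 0 <= d ->
    (forall c, cov h' g' c -> m <= d * c) -> m <= d * cnum h' g'.
  move=> ex; rewrite le_eqVlt => /predU1P[<- hm|d0 hm].
    by have [c hc'] := ex; have := hm c hc'; rewrite !mul0r.
  by rewrite -ler_pdivrMl //; apply: le_cnum => // c hc'; rewrite ler_pdivrMl //; exact: hm.
rewrite aux // ?cnum_ge0 // => d cd; rewrite mulrC; apply: aux => //.
  exact: cov_ge0 cd.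
by move=> c hc'; rewrite mulrC; apply: cnum_le; apply: cov_trans hc' cd.
Qed.

Lemma Cc_weaken h g : continuous g -> Cc h -> (forall x, H x -> h x = 0 -> g x = 0) -> Cc g.
Proof.
move=> cg [_ [C [cC CH h0]]] hg; split=> //; exists C; split=> // x Hx nC.
by apply: hg => //; exact: h0.
Qed.

Lemma Cc_add h g : Cc h -> Cc g -> Cc (fun x => h x + g x).
Proof.
move=> [ch [C [cC CH h0]]] [cg [D [cD DH g0]]]; split.
  by move=> x; apply: cvgD; [exact: ch|exact: cg].
exists (C `|` D); split; first exact: compactU.
  by move=> x [/CH|/DH].
by move=> x Hx nCD; rewrite h0 ?g0 ?addr0 // => ?; apply: nCD; [right|left].
Qed.

Lemma Cc_scale a h : Cc h -> Cc (fun x => a * h x).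
Proof.
move=> Ch; apply: Cc_weaken (Ch) _; last by move=> x _ ->; rewrite mulr0.
by move=> x; apply: cvgM; [exact: cvg_cst|exact: Ch.1].
Qed.

Lemma Cc_mul h g : Cc h -> continuous g -> Cc (fun x => h x * g x).
Proof.
move=> Ch cg; apply: Cc_weaken (Ch) _; last by move=> x _ ->; rewrite mul0r.
by move=> x; apply: cvgM; [exact: Ch.1|exact: cg].
Qed.

Lemma Cc_translate z h : H z -> Cc h -> Cc (fun x => h (z ∙ x)).
Proof.
move=> Hz [ch [C [cC CH h0]]]; split.
  move=> x; apply: (@continuous_comp _ _ _ (gmul z)); last exact: ch.
  by move: x; gcont.
exists [set x | exists a b, [/\ [set z⁻¹] a, C b & x = a ∙ b]]; split.
- by apply: compact_gmul => //; exact: compact_set1.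
- move=> _ [_ [b [-> Cb ->]]]; apply: subgrpM => //; last exact: CH.
  exact: subgrpV.
- move=> x Hx nC; apply: h0; first exact: subgrpM.
  by move=> Cb; apply: nC; exists z⁻¹, (z ∙ x); split=> //; gsimp.
Qed.

Lemma Ccp_add h g : Ccp h -> Ccp g -> Ccp (fun x => h x + g x).
Proof. by move=> [Ch h0] [Cg g0]; split=> [|x]; [exact: Cc_add|exact: addr_ge0]. Qed.

Lemma Ccp_scale a h : 0 <= a -> Ccp h -> Ccp (fun x => a * h x).
Proof. by move=> a0 [Ch h0]; split=> [|x]; [exact: Cc_scale|exact: mulr_ge0]. Qed.

Lemma Ccp_bump : exists2 h, Ccp h & bumpy h.
Proof.
have [C [cC nC sC _]] := compact_nbhs (filterT : nbhs (gid : L) setT).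
have [b [cb b01 b1 b0]] := bump_function R nC.
exists b => //; split; last by move=> x; case/andP: (b01 x).
split=> //; exists (C `&` H); split; first exact: compact_closedI.
  by move=> x [].
by move=> x Hx nCH; apply: b0 => Cx; exact: nCH.
Qed.

Lemma Ccp_ge1 (C : set L) : compact C -> C `<=` H ->
  exists2 k, Ccp k & forall x, C x -> 1 <= k x.
Proof.
move=> cC CH; have [b [Cb b0] [cb b01 b1]] := Ccp_bump.
have [|s [sC sP]] := @finite_cover L C (fun x => [set y | 1 / 2 < b (x⁻¹ ∙ y)]) cC.
  move=> x Cx; split; last by rewrite /= gmulVg b1; lra.
  apply: open_gt_fun => y; apply: (@continuous_comp _ _ _ (gmul x⁻¹)); last exact: cb.
  by move: y; gcont.
have Ck : Ccp (fun x => \sum_(y <- s) b (y⁻¹ ∙ x)).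
  have {sP} : forall x, x \in s -> H x by move=> x /sC /CH.
  elim: s {sC} => [|y s IH] sH'.
    have [z0 _] := Ccp_scale (lexx 0) (conj Cb b0).
    split=> [|x]; last by rewrite big_nil.
    rewrite (_ : (fun x => _) = (fun x => 0 * b x)) //.
    by apply/funext => x; rewrite big_nil mul0r.
  rewrite (_ : (fun x => _) = (fun x => b (y⁻¹ ∙ x) + \sum_(z <- s) b (z⁻¹ ∙ x))).
    apply: Ccp_add; last by apply: IH => z zs; apply: sH'; rewrite inE zs orbT.
    split; last by move=> x; exact: b0.
    by apply: Cc_translate => //; apply: subgrpV => //; apply: sH'; exact: mem_head.
  by apply/funext => x; rewrite big_cons.
exists (fun x => 2 * \sum_(y <- s) b (y⁻¹ ∙ x)); first exact: Ccp_scale.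
move=> x Cx; have [y ys /= yx] := sP x Cx.
rewrite (big_rem y) //=.
have : 0 <= \sum_(z <- rem y s) b (z⁻¹ ∙ x) by apply: sumr_ge0.
by lra.
Qed.

Lemma Cc_unif_cont h e : Cc h -> 0 < e -> exists2 V, nbhs gid V &
  forall z x, H z -> H x -> V (z⁻¹ ∙ x) -> `|h x - h z| < e.
Proof.
move=> [ch [C [cC CH h0]]] e0.
have [W nW WP] := unif_cont_compact cC ch e0.
have [V [nV sV VW]] := nbhs_sym nW; exists V => // z x Hz Hx Vx.
have [Cs|nCs] := pselect (C z).
  by have := WP _ z (VW _ Vx) Cs; rewrite gmulA gmulgV gmul1g.
have [Cx|nCx] := pselect (C x); last by rewrite !h0 // subrr normr0.
have := WP _ x (VW _ (sV _ Vx)) Cx; rewrite ginvM ginvK gmulA gmulgV gmul1g.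
by rewrite distrC.
Qed.

(** A covering of [h = h1 + h2 + e k] is split with the weights [h_i / d], [d = h1 + h2 + e], which
    vary by less than [e] across a translate of a narrow [psi]. The summand [e] keeps the quotients
    continuous, and [k >= 1] on the support of [h1 + h2] gives [d <= h] there. *)
Lemma cnum_almost_add h1 h2 : Ccp h1 -> Ccp h2 -> exists2 k, Ccp k & forall e, 0 < e ->
  exists2 V, nbhs gid V & forall psi, bumpy psi -> (forall x, ~ V x -> psi x = 0) ->
    cnum h1 psi + cnum h2 psi <=
    (1 + 2 * e) * (cnum (fun x => h1 x + h2 x) psi + e * cnum k psi).
Proof.
move=> Ch1 Ch2; have [[C12 h12] [c12 s12]] := (Ccp_add Ch1 Ch2, (Ccp_add Ch1 Ch2).1).
have [C [cC CH hC]] := s12.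
have [k Ck k1] := Ccp_ge1 cC CH; exists k => // e e0.
pose d x := h1 x + h2 x + e.
have d0 x : 0 < d x by rewrite /d ltr_wpDl //; exact: h12.
have cg (h : L -> R) : Ccp h -> Cc (fun x => h x / d x).
  move=> Ch; apply: Cc_mul; first exact: Ch.1.
  move=> x; apply: cvgV; first by rewrite gt_eqF.
  by apply: cvgD; [exact: c12|exact: cvg_cst].
have [V1 nV1 P1] := Cc_unif_cont (cg _ Ch1) e0.
have [V2 nV2 P2] := Cc_unif_cont (cg _ Ch2) e0.
exists (V1 `&` V2); first exact: filterI.
move=> psi bp pV; have [cp p01 p1] := bp.
pose h x := h1 x + h2 x + e * k x.
have Ch : Cc h by apply: Cc_add => //; apply: Cc_scale; exact: Ck.1.
have key (hi : L -> R) (s : seq (R * L)) (V : set L) : Ccp hi ->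
    (forall x, hi x <= h1 x + h2 x) ->
    (forall x, ~ V x -> psi x = 0) ->
    (forall z x, H z -> H x -> V (z⁻¹ ∙ x) -> `|hi x / d x - hi z / d z| < e) ->
    wok s -> (forall x, H x -> h x <= wsum s psi x) ->
    cnum hi psi <= \sum_(p <- s) p.1 * (hi p.2 / d p.2 + e).
  move=> Chi hile pV' Phi oks hs; apply: cnum_le.
  exists [seq (p.1 * (hi p.2 / d p.2 + e), p.2) | p <- s]; split.
  - move=> _ /mapP[p ps ->] /=; have [p0 Hp] := oks p ps; split=> //.
    by rewrite mulr_ge0 // addr_ge0 ?(ltW e0) // divr_ge0 ?Chi.2 // ltW.
  - move=> x Hx; rewrite /wsum big_map /=.
    have hx : hi x <= hi x / d x * h x.
      have [Cx|nC] := pselect (C x).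
        rewrite -[leLHS](@divfK _ (d x)) ?gt_eqF // ler_wpM2l //.
          by rewrite divr_ge0 ?Chi.2 // ltW.
        by rewrite /d /h lerD2l; have := k1 x Cx; nra.
      have : hi x <= 0 by rewrite (le_trans (hile x)) // hC.
      move=> hi0; have -> : hi x = 0 by apply/eqP; rewrite eq_le hi0 Chi.2.
      by rewrite !mul0r.
    apply: (le_trans hx); apply: (@le_trans _ _ (hi x / d x * wsum s psi x)).
      by apply: ler_wpM2l; [rewrite divr_ge0 ?Chi.2 // ltW|exact: hs].
    rewrite /wsum mulr_sumr big_seq [leRHS]big_seq; apply: ler_sum => p ps.
    have [p0 Hp] := oks p ps.
    rewrite (mulrCA (hi x / d x)) -(mulrA p.1); apply: ler_wpM2l => //.
    have [Vx|nV] := pselect (V (p.2⁻¹ ∙ x)); last by rewrite pV' // !(mulr0, mul0r).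
    have := Phi _ _ Hp Hx Vx; rewrite ltr_norml => /andP[_ lt].
    have q0 : 0 <= psi (p.2⁻¹ ∙ x) by case/andP: (p01 (p.2⁻¹ ∙ x)).
    by apply: ler_wpM2r => //; lra.
  - by rewrite /wtot big_map.
have main : cnum h1 psi + cnum h2 psi <= (1 + 2 * e) * cnum h psi.
  rewrite -ler_pdivrMl; last by lra.
  apply: le_cnum; first exact: bumpy_cov.
  move=> c [s [oks hs ->]]; rewrite ler_pdivrMl; last by lra.
  have le1 x : h1 x <= h1 x + h2 x by rewrite lerDl Ch2.2.
  have le2 x : h2 x <= h1 x + h2 x by rewrite lerDr Ch1.2.
  have k1' := key h1 s _ Ch1 le1 pV (fun z x Hz Hx V => P1 z x Hz Hx V.1) oks hs.
  have k2' := key h2 s _ Ch2 le2 pV (fun z x Hz Hx V => P2 z x Hz Hx V.2) oks hs.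
  apply: le_trans (lerD k1' k2') _; rewrite -big_split /= /wtot mulr_sumr.
  rewrite big_seq [leRHS]big_seq; apply: ler_sum => p ps; have [p0 _] := oks p ps.
  rewrite -mulrDr mulrC; apply: ler_wpM2r => //.
  have : (h1 p.2 + h2 p.2) / d p.2 <= 1 by rewrite ler_pdivrMr // mul1r /d lerDl ltW.
  by rewrite mulrDl; lra.
apply: le_trans main _; apply: ler_wpM2l; first by lra.
rewrite -cnum_scale //; last by apply: bumpy_cov => //; exact: Ck.1.
apply: cnum_add; apply: bumpy_cov => //.
by apply: Cc_scale; exact: Ck.1.
Qed.

End Covering.

Lemma lim_le (R : realType) (I : Type) (F : set_system I) (u v : I -> R) (a b : R) :
  ProperFilter F -> u @ F --> a -> v @ F --> b -> F [set i | (u i <= v i)%R] -> (a <= b)%R.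
Proof.
move=> PF ua vb uv; rewrite -subr_ge0.
apply: (@lim_closed _ _ F [set y : R | (0 <= y)%R] (fun i => (v i - u i)%R)).
- exact: closed_ge.
- by apply: filterS uv => i /=; rewrite subr_ge0.
- exact: cvgB vb ua.
Qed.

Lemma ultra_lim_real (R : realType) (I : Type) (F : set_system I) (u : I -> R) (B : R) :
  UltraFilter F -> F [set i | (`|u i| <= B)%R] -> exists p : R, u @ F --> p.
Proof.
move=> UF uB; have [|p _ up] := @ultra_lim _ _ F `[(- B)%R, B] u UF (@segment_compact _ _ _).
  by apply: filterS uB => i /=; rewrite in_itv /= ler_norml.
by exists p.
Qed.

Section Haar.
Variables (R : realType) (L : lcGroup) (H : set L).
Hypotheses (sH : subgrp H) (clH : closed H).
Local Open Scope ring_scope.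
Implicit Types (h g k psi : L -> R).
Local Notation Cc := (@Cc R L H).
Local Notation Ccp := (@Ccp R L H).

(** Covering numbers divided by that of a fixed bump [h0], in the ultralimit over shrinking supports
    of [psi]. Transitivity of coverings bounds the ratios above by [(h : h0)], and below by a
    positive constant because [h0] is covered by translates of [h]. *)
Lemma haar_pos : exists I : (L -> R) -> R,
  [/\ (forall h g, Ccp h -> Ccp g -> I (fun x => h x + g x) = I h + I g),
      (forall a h, 0 < a -> Ccp h -> I (fun x => a * h x) = a * I h),
      (forall h g, Ccp h -> Ccp g -> (forall x, H x -> h x <= g x) -> I h <= I g),
      (forall z h, H z -> Ccp h -> I (fun x => h (z ∙ x)) = I h) &
      (forall h x, Ccp h -> H x -> 0 < h x -> 0 < I h)].
Proof.
have [F [UF FV]] := nbhs_ultra L.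
have /choice [psi Ppsi] : forall V : set L, exists psi : L -> R, nbhs gid V ->
    bumpy psi /\ (forall x, ~ V x -> psi x = 0).
  move=> V; have [nV|nV] := pselect (nbhs gid V); last by exists (fun=> 0).
  by have [b [cb b01 b1 b0]] := bump_function R nV; exists b.
have [h0 Ch0 bh0] := Ccp_bump R clH.
have F1 : F [set V | nbhs gid V] by apply: filterS (FV setT filterT) => V [].
have exc h V : Ccp h -> nbhs gid V -> exists c, cov H h (psi V) c.
  by move=> [Ch _] nV; apply: bumpy_cov => //; exact: (Ppsi V nV).1.
have d0 V : nbhs gid V -> 0 < cnum H h0 (psi V).
  move=> nV; apply: (@lt_le_trans _ _ 1) => //; apply: le_cnum; first exact: exc.
  move=> c; have [_ _ <-] := bh0; move=> hc; apply: (cov_ge _ hc); last exact: subgrp1.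
  by have [[_ p01 _] _] := Ppsi V nV; move=> y; case/andP: (p01 y).
pose a h V := cnum H h (psi V) / cnum H h0 (psi V).
have exh0 h : Ccp h -> exists c, cov H h h0 c by move=> [Ch _]; exact: bumpy_cov.
have a0 h V : Ccp h -> nbhs gid V -> 0 <= a h V.
  by move=> Ch nV; rewrite divr_ge0 // ?cnum_ge0 ?(ltW (d0 _ nV)) //; exact: exc.
have aB h V : Ccp h -> nbhs gid V -> a h V <= cnum H h h0.
  move=> Ch nV; rewrite ler_pdivrMr ?d0 //; apply: cnum_trans => //; first exact: exh0.
  exact: exc.
pose I h := lim (a h @ F).
have aI h : Ccp h -> a h @ F --> I h.
  move=> Ch; have [|p ap] := @ultra_lim_real R _ F (a h) (cnum H h h0) UF.
    by apply: filterS F1 => V nV /=; rewrite ger0_norm ?a0 // aB.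
  by apply: cvgP ap.
have uniq h p : Ccp h -> a h @ F --> p -> I h = p.
  by move=> Ch ap; apply: (cvg_unique _ (aI h Ch) ap); exact: Rhausdorff.
exists I; split.
- move=> h g Ch Cg; have Chg := Ccp_add Ch Cg.
  apply/eqP; rewrite eq_le; apply/andP; split.
    apply: (@lim_le _ _ F _ _ _ _ _ (aI _ Chg) (cvgD (aI _ Ch) (aI _ Cg))).
    apply: filterS F1 => V nV /=; rewrite -mulrDl.
    by apply: ler_wpM2r; [rewrite invr_ge0 ltW ?d0|apply: cnum_add; exact: exc].
  have [k Ck kP] := cnum_almost_add sH clH Ch Cg.
  have le e : 0 < e -> I h + I g <= (1 + 2 * e) * (I (fun x => h x + g x) + e * I k).
    move=> e0; have [V nV VP] := kP e e0.
    apply: (@lim_le _ _ F _ _ _ _ _ (cvgD (aI _ Ch) (aI _ Cg))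
      (cvgM (cvg_cst (1 + 2 * e)) (cvgD (aI _ Chg) (cvgM (cvg_cst e) (aI _ Ck))))).
    apply: filterS (FV V nV) => V' [nV' V'V].
    change (a h V' + a g V' <= (1 + 2 * e) * (a (fun x => h x + g x) V' + e * a k V')).
    rewrite /a -mulrDl [e * (_ / _)]mulrA -mulrDl mulrA.
    apply: ler_wpM2r; first by rewrite invr_ge0 ltW ?d0.
    apply: VP; first exact: (Ppsi V' nV').1.
    by move=> x nVx; apply: (Ppsi V' nV').2 => /V'V.
  have I0 u : Ccp u -> 0 <= I u.
    move=> Cu; apply: (@lim_le _ _ F _ _ _ _ _ (cvg_cst 0) (aI _ Cu)).
    by apply: filterS F1 => V nV; exact: a0.
  have := I0 _ Chg; have := I0 _ Ck.
  set X := I h + I g; set K := I k; set Y := I (fun x => h x + g x) => K0 Y0.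
  rewrite leNgt; apply/negP => lt.
  (* For [e <= 1] the bound [(1 + 2e)(Y + eK)] is at most [Y + e(2Y + 3K)], which this [e] keeps
     below [X]. *)
  pose e := Num.min 1 ((X - Y) / (2 * (2 * Y + 3 * K + 1))).
  have D0 : 0 < 2 * (2 * Y + 3 * K + 1) by lra.
  have e0 : 0 < e by rewrite lt_min ltr01 divr_gt0 // subr_gt0.
  have e1 : e <= 1 by rewrite ge_min lexx.
  have e2 : e * (2 * (2 * Y + 3 * K + 1)) <= X - Y by rewrite -ler_pdivlMr // ge_min lexx orbT.
  have := le e e0; rewrite -/X -/Y -/K => leX.
  have : e * e * K <= e * K by rewrite ler_wpM2r // ger_pMr.
  have : 0 <= e * Y by rewrite mulr_ge0 // ltW.
  by nra.
- move=> c h c0 Ch; apply: uniq; first by apply: Ccp_scale => //; exact: ltW.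
  apply: cvg_trans (cvgM (cvg_cst c) (aI _ Ch)).
  apply: near_eq_cvg; apply: filterS F1 => V nV.
  by rewrite /a /= cnum_scale // ?mulrA //; exact: exc.
- move=> h g Ch Cg hg; apply: (@lim_le _ _ F _ _ _ _ _ (aI _ Ch) (aI _ Cg)).
  apply: filterS F1 => V nV /=; apply: ler_wpM2r; first by rewrite invr_ge0 ltW ?d0.
  by apply: cnum_mono => //; exact: exc.
- move=> z h Hz Ch; apply: uniq.
    by split=> [|x]; [apply: Cc_translate => //; exact: Ch.1|exact: Ch.2].
  apply: cvg_trans (aI _ Ch); apply: near_eq_cvg; apply: filterS F1 => V nV.
  by rewrite /a /= cnum_translate //; exact: exc.
- move=> h x Ch Hx hx.
  have ex1 : exists c, cov H h0 h c.
    by apply: (cov_ex _ Ch0.1 _ _ Hx) => //; [exact: Ch.1.1|exact: Ch.2].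
  have pos : 0 < cnum H h0 h + 1 by rewrite ltr_wpDl // cnum_ge0.
  apply: (@lt_le_trans _ _ (cnum H h0 h + 1)^-1); first by rewrite invr_gt0.
  apply: (@lim_le _ _ F _ _ _ _ _ (cvg_cst _) (aI _ Ch)).
  apply: filterS F1 => V nV /=; rewrite ler_pdivlMr ?d0 // ler_pdivrMl //.
  apply: le_trans (cnum_trans sH ex1 (exc _ _ Ch nV)) _.
  by apply: ler_wpM2r; [apply: cnum_ge0; exact: exc|rewrite lerDl].
Qed.

(** Functions live on all of [L], but monotonicity is tested on [H], so only their values on [H]
    count. A subgroup thus needs no space of its own. *)
Definition haar_functional (J : (L -> R) -> R) :=
  [/\ (forall h g, Cc h -> Cc g -> J (fun x => h x + g x) = J h + J g),
      (forall a h, Cc h -> J (fun x => a * h x) = a * J h),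
      (forall h g, Cc h -> Cc g -> (forall x, H x -> h x <= g x) -> J h <= J g),
      (forall z h, H z -> Cc h -> J (fun x => h (z ∙ x)) = J h) &
      (forall h x, Cc h -> (forall y, H y -> 0 <= h y) -> H x -> 0 < h x -> 0 < J h)].

Definition fpos h x : R := Num.max (h x) 0.
Definition fneg h x : R := Num.max (- h x) 0.

Lemma fpos_neg h x : h x = fpos h x - fneg h x.
Proof.
by rewrite /fpos /fneg; case: (lerP (h x) 0); case: (lerP (- h x) 0); lra.
Qed.

Lemma Ccp_fpos h : Cc h -> Ccp (fpos h).
Proof.
move=> Ch; split; last by move=> x; rewrite /fpos le_max lexx orbT.
apply: Cc_weaken (Ch) _; last by move=> x _; rewrite /fpos => ->; rewrite maxxx.
by move=> x; apply: (@continuous_max R L h (fun=> 0)); [exact: Ch.1|exact: cvg_cst].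
Qed.

Lemma Ccp_fneg h : Cc h -> Ccp (fneg h).
Proof.
move=> Ch; have /Ccp_fpos := Cc_scale (-1) Ch; congr Ccp.
by apply/funext => x; rewrite /fpos /fneg mulN1r.
Qed.

Lemma haar : exists J, haar_functional J.
Proof.
have [I [Iadd Isc Imono Iinv Ipos]] := haar_pos.
have I0 h : Ccp h -> 0 <= I h.
  move=> Ch; have C2 : Ccp (fun x => 2 * h x) by apply: Ccp_scale.
  have : I h <= I (fun x => 2 * h x) by apply: Imono => // x _; have := Ch.2 x; lra.
  by rewrite Isc //; lra.
pose J h := I (fpos h) - I (fneg h).
(* Any decomposition into nonnegative functions computes [J]; linearity follows without knowing the
   positive part of a sum. *)
have Jd h p q : Cc h -> Ccp p -> Ccp q -> (forall x, H x -> h x = p x - q x) -> J h = I p - I q.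
  move=> Ch Cp Cq hpq; have [Cf Cg] := (Ccp_fpos Ch, Ccp_fneg Ch).
  suff : I (fpos h) + I q = I p + I (fneg h) by rewrite /J; lra.
  rewrite -!Iadd //; apply/eqP; rewrite eq_le; apply/andP; split; apply: Imono;
    try exact: Ccp_add; by move=> x Hx; have := hpq x Hx; rewrite fpos_neg; lra.
have Jadd h g : Cc h -> Cc g -> J (fun x => h x + g x) = J h + J g.
  move=> Ch Cg; have [[Cf Cf'] [Cn Cn']] := ((Ccp_fpos Ch, Ccp_fpos Cg), (Ccp_fneg Ch, Ccp_fneg Cg)).
  rewrite (@Jd _ (fun x => fpos h x + fpos g x) (fun x => fneg h x + fneg g x)).
  - by rewrite !Iadd // /J; lra.
  - exact: Cc_add.
  - exact: Ccp_add.
  - exact: Ccp_add.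
  - by move=> x _ /=; rewrite {1}fpos_neg {1}(fpos_neg g); lra.
have Jpos a h : 0 < a -> Cc h -> J (fun x => a * h x) = a * J h.
  move=> a0 Ch; rewrite (@Jd _ (fun x => a * fpos h x) (fun x => a * fneg h x)).
  - by rewrite !Isc ?mulrBr //; [exact: Ccp_fneg|exact: Ccp_fpos].
  - exact: Cc_scale.
  - by apply: Ccp_scale; [exact: ltW|exact: Ccp_fpos].
  - by apply: Ccp_scale; [exact: ltW|exact: Ccp_fneg].
  - by move=> x _; rewrite {1}fpos_neg mulrBr.
have Jge0 h : Cc h -> (forall x, H x -> 0 <= h x) -> 0 <= J h.
  move=> Ch h0; have Cz := Ccp_scale (lexx 0) (Ccp_fpos Ch).
  rewrite subr_ge0; apply: Imono; [exact: Ccp_fneg|exact: Ccp_fpos|].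
  move=> x Hx; rewrite /fneg /fpos; have := h0 x Hx => hx.
  by rewrite max_r ?max_l //; lra.
have J0 h : Cc h -> (forall x, H x -> h x = 0) -> J h = 0.
  move=> Ch h0; rewrite (@Jd _ (fpos h) (fpos h)) ?subrr //; try exact: Ccp_fpos.
  by move=> x Hx; rewrite h0 // subrr.
have JN h : Cc h -> J (fun x => - 1 * h x) = - J h.
  move=> Ch; have := Jadd _ _ Ch (Cc_scale (-1) Ch); rewrite J0.
  - by lra.
  - by apply: Cc_add => //; exact: Cc_scale.
  - by move=> x _; lra.
exists J; split=> //.
- move=> a h Ch; case: (ltrgt0P a) => [a0|a0|->]; first exact: Jpos.
    have -> : (fun x => a * h x) = (fun x => (- a) * (- 1 * h x)).
      by apply/funext => x; rewrite mulN1r mulrNN.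
    by rewrite Jpos ?oppr_gt0 //; [rewrite JN // mulrNN|exact: Cc_scale].
  by rewrite mul0r J0 //; [exact: Cc_scale|move=> x _; rewrite mul0r].
- move=> h g Ch Cg hg; rewrite -subr_ge0 -JN // -Jadd //; last exact: Cc_scale.
  apply: Jge0; first by apply: Cc_add => //; exact: Cc_scale.
  by move=> x Hx; have := hg x Hx; lra.
- move=> z h Hz Ch; have Ct := Cc_translate sH Hz Ch.
  rewrite (@Jd _ (fun x => fpos h (z ∙ x)) (fun x => fneg h (z ∙ x))) //.
  - by rewrite !Iinv //; [exact: Ccp_fneg|exact: Ccp_fpos].
  - by have [C p] := Ccp_fpos Ch; split=> [|x]; [exact: Cc_translate|exact: p].
  - by have [C p] := Ccp_fneg Ch; split=> [|x]; [exact: Cc_translate|exact: p].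
  - by move=> x _; exact: fpos_neg.
- move=> h x Ch h0 Hx hx; have Cf := Ccp_fpos Ch.
  have -> : J h = I (fpos h).
    have Cz : Ccp (fun x => 0 * fpos h x) by exact: Ccp_scale.
    rewrite (@Jd _ (fpos h) (fun x => 0 * fpos h x)) //; last first.
      by move=> y Hy; rewrite mul0r subr0 /fpos max_l // h0.
    have : I (fun x => 2 * (0 * fpos h x)) = I (fun x => 0 * fpos h x).
      by congr I; apply/funext => y; rewrite !mul0r mulr0.
    by rewrite Isc //; lra.
  by apply: (Ipos _ x) => //; rewrite /fpos lt_max hx.
Qed.

End Haar.

(** * Gleason's functions *)

Section Gleason.
Variables (R : realType) (L : lcGroup).
Local Open Scope ring_scope.

Definition left_unif_cont (b : L -> R) := forall e : R, 0 < e ->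
  exists2 W, nbhs gid W & forall w y, W w -> `|b (w ∙ y) - b y| <= e.

Lemma compact_left_unif_cont (b : L -> R) (C : set L) : continuous b -> compact C ->
  (forall x, ~ C x -> b x = 0) -> left_unif_cont b.
Proof.
move=> cb cC b0 e e0.
have cb' : continuous (fun x => b x⁻¹).
  by move=> x; apply: (@continuous_comp _ _ _ ginv); [exact: ginv_continuous|exact: cb].
have [W nW WP] := unif_cont_compact (compact_ginv cC) cb' e0.
have [V [nV sV VW]] := nbhs_sym nW; exists V => // w y Vw.
have [Cy|nCy] := pselect (C y).
  have := WP _ y⁻¹ (VW _ (sV _ Vw)); rewrite /= ginvM !ginvK => /(_ Cy) /ltW //.
have [Cy'|nCy'] := pselect (C (w ∙ y)); last by rewrite !b0 // subrr normr0 ltW.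
have := WP w (w ∙ y)⁻¹ (VW _ Vw); rewrite /= ginvK (ginvM (w ∙ y)⁻¹) ginvK => /(_ Cy').
by rewrite gmulA gmulVg gmul1g distrC => /ltW.
Qed.

Lemma left_unif_continuous (b : L -> R) : left_unif_cont b -> continuous b.
Proof.
move=> ub x; apply/(@cvgrPdist_le R R^o) => e e0.
have [W nW WP] := ub e e0.
apply: filterS (nbhs_translate x nW) => y /= Wy.
by have := WP _ x Wy; rewrite gmulgVK distrC.
Qed.

(** [tau] is the supremum of the translates of a bump by [K]. It stays uniformly continuous since
    conjugates of a small element by the compact [K] are uniformly small. *)
Lemma invariant_bump (U K : set L) : compact U -> compact K -> subgrp K ->
  (forall k, K k -> nbhs k U) -> exists tau : L -> R,
  [/\ left_unif_cont tau, (forall x, 0 <= tau x <= 1), tau gid = 1,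
      (forall x, ~ U x -> tau x = 0) & forall k x, K k -> tau (k ∙ x) = tau x].
Proof.
move=> cU cK sK KU.
have [V nV VP] : exists2 V, nbhs gid V & forall v k, V v -> K k -> U (k ∙ v).
  apply: (@tube L L L (fun p => p.2 ∙ p.1)) => //; first gcont.
  by move=> k Kk; rewrite /= gmulg1; exact: KU.
have [C [cC nC sC CV]] := compact_nbhs nV.
have [b [cb b01 b1 b0]] := bump_function R nC.
have ub := compact_left_unif_cont cb cC b0.
pose S x := [set b (k ∙ x) | k in K].
pose tau x := sup (S x).
have ubS x : ubound (S x) 1 by move=> _ [k _ <-]; case/andP: (b01 (k ∙ x)).
have hS x : has_sup (S x).
  by split; [exists (b (gid ∙ x)); exists gid => //; exact: subgrp1|exists 1].
have le_tau x k : K k -> b (k ∙ x) <= tau x.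
  by move=> Kk; apply: ub_le_sup; [exact: (hS x).2|exists k].
have tau_le x c : (forall k, K k -> b (k ∙ x) <= c) -> tau x <= c.
  by move=> bc; apply: ge_sup; [exact: (hS x).1|move=> _ [k Kk <-]; exact: bc].
have tau0 x : 0 <= tau x.
  apply: le_trans (le_tau x gid (subgrp1 sK)); by case/andP: (b01 (gid ∙ x)).
have tau1 x : tau x <= 1 by apply: tau_le => k _; case/andP: (b01 (k ∙ x)).
exists tau; split.
- move=> e e0; have [W nW WP] := ub e e0.
  have [W' nW' W'P] := nbhs_conj_compact cK nW.
  have [W2 [nW2 sW2 W2W]] := nbhs_sym nW'.
  have one w y : W2 w -> tau (w ∙ y) <= tau y + e.
    move=> W2w; apply: tau_le => k Kk.
    have Ww : W (k ∙ w ∙ k⁻¹).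
      by have := W'P w k⁻¹ (W2W _ W2w) (subgrpV sK Kk); rewrite ginvK.
    have := WP _ (k ∙ y) Ww; rewrite !gmulA gmulgVK -(gmulA k w y) => /ler_normlP[_ le].
    by have := le_tau y k Kk; lra.
  exists W2 => // w y W2w; apply/ler_normlP.
  have h1 := one w y W2w; have := one w⁻¹ (w ∙ y) (sW2 _ W2w).
  by rewrite gmulA gmulVg gmul1g => h2; split; lra.
- by move=> x; rewrite tau0 tau1.
- apply/eqP; rewrite eq_le tau1 /=; apply: le_trans (le_tau gid gid (subgrp1 sK)).
  by rewrite gmul1g b1.
- move=> x nU; apply/eqP; rewrite eq_le tau0 andbT; apply: tau_le => k Kk.
  rewrite b0 // => /CV Vkx; apply: nU.
  by have := VP _ k⁻¹ Vkx (subgrpV sK Kk); rewrite gmulA gmulVg gmul1g.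
- move=> k x Kk; apply/eqP; rewrite eq_le; apply/andP; split; apply: tau_le => l Kl.
    by rewrite gmulA; apply: le_tau; exact: subgrpM.
  have := le_tau (k ∙ x) (l ∙ k⁻¹) (subgrpM sK Kl (subgrpV sK Kk)).
  by rewrite gmulA gmulgVK.
Qed.

Section Theta.
Variables (U : set L) (tau : L -> R) (Q : set L) (n : nat).
Hypotheses (tau01 : forall x, 0 <= tau x <= 1)
  (tauU : forall x, ~ U x -> tau x = 0) (ucT : left_unif_cont tau)
  (Q1 : Q gid) (symQ : sym Q) (n0 : (0 < n)%N) (QU : spow Q n `<=` U).

(** Gleason's function: [tau] is spread along products of at most [n] elements of [Q] with linearly
    decaying weight. A further factor from [Q] costs [1/n], which is the Lipschitz bound
    [theta_Q]. *)
Definition theta_set x : set R :=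
  [set r | exists k y, [/\ (k <= n)%N, spow Q k y & r = (1 - k%:R / n%:R) * tau (y⁻¹ ∙ x)]].
Definition theta x := sup (theta_set x).

Let coef k : (k <= n)%N -> 0 <= 1 - k%:R / n%:R :> R /\ 1 - k%:R / n%:R <= 1 :> R.
Proof.
move=> kn; have n0' : (0 : R) < n%:R by rewrite ltr0n.
have q1 : k%:R / n%:R <= 1 :> R by rewrite ler_pdivrMr // mul1r ler_nat.
have q0 : 0 <= k%:R / n%:R :> R by rewrite divr_ge0.
by split; lra.
Qed.

Let term_le1 x r : theta_set x r -> r <= 1.
Proof.
move=> [k [y [kn _ ->]]]; have [c0 c1] := coef kn.
by have /andP[t0 t1] := tau01 (y⁻¹ ∙ x); rewrite -[leRHS]mulr1; apply: ler_pM.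
Qed.

Let hS x : has_sup (theta_set x).
Proof.
split; last by exists 1 => r; exact: term_le1.
by exists ((1 - 0%:R / n%:R) * tau (gid⁻¹ ∙ x)), 0%N, gid.
Qed.

Let le_theta x k y : (k <= n)%N -> spow Q k y ->
  (1 - k%:R / n%:R) * tau (y⁻¹ ∙ x) <= theta x.
Proof. by move=> kn Qy; apply: ub_le_sup; [exact: (hS x).2|exists k, y]. Qed.

Let theta_le x c : (forall k y, (k <= n)%N -> spow Q k y ->
  (1 - k%:R / n%:R) * tau (y⁻¹ ∙ x) <= c) -> theta x <= c.
Proof.
by move=> bc; apply: ge_sup; [exact: (hS x).1|move=> _ [k [y [kn Qy ->]]]; exact: bc].
Qed.

Lemma tau_theta x : tau x <= theta x.
Proof.
by have := @le_theta x 0%N gid (leq0n _) erefl; rewrite mul0r subr0 mul1r ginv1 gmul1g.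
Qed.

Lemma theta_ge0 x : 0 <= theta x.
Proof. by apply: le_trans (tau_theta x); case/andP: (tau01 x). Qed.

Lemma theta_le1 x : theta x <= 1.
Proof. by apply: theta_le => k y kn Qy; apply: (@term_le1 x); exists k, y. Qed.

Lemma theta_supp x : ~ spow U 2 x -> theta x = 0.
Proof.
move=> nU; apply/eqP; rewrite eq_le theta_ge0 andbT; apply: theta_le => k y kn Qy.
rewrite tauU ?mulr0 // => Uyx; apply: nU.
have Uy : U y by apply: QU; apply: spow_le Qy.
rewrite (_ : x = y ∙ (y⁻¹ ∙ x)); last by gsimp.
by apply: spowS => //; exact: spow1.
Qed.

Lemma theta_Q a x : Q a -> `|theta (a ∙ x) - theta x| <= n%:R^-1.
Proof.
have n0' : (0 : R) < n%:R by rewrite ltr0n.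
have one b y : Q b -> theta y <= theta (b ∙ y) + n%:R^-1.
  move=> Qb; apply: theta_le => k z kn Qz.
  have t1 : tau (z⁻¹ ∙ y) <= 1 by case/andP: (tau01 (z⁻¹ ∙ y)).
  have t0 : 0 <= tau (z⁻¹ ∙ y) by case/andP: (tau01 (z⁻¹ ∙ y)).
  have i0 : (0 : R) <= n%:R^-1 by rewrite invr_ge0.
  move: kn; rewrite leq_eqVlt => /predU1P[->|kn].
    by rewrite divff ?gt_eqF // subrr mul0r addr_ge0 // theta_ge0.
  have := @le_theta (b ∙ y) k.+1 (b ∙ z) kn (spowS Qb Qz).
  rewrite ginvM gmulA gmulgVK -natr1 mulrDl mul1r => le.
  set i := n%:R^-1 in le i0 *; set t := tau _ in le t0 t1 *.
  have : i * t <= i by rewrite -[leRHS]mulr1; apply: ler_wpM2l.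
  by nra.
move=> Qa; apply/ler_normlP; have h1 := one a x Qa.
have := one a⁻¹ (a ∙ x) (symQ Qa); rewrite gmulA gmulVg gmul1g => h2.
by split; lra.
Qed.

(** As [y^-1 c x = (y^-1 c y) (y^-1 x)], translation by [c] acts on the terms of the supremum
    through conjugates by elements of [U] only. The bound therefore depends neither on [Q] nor on
    [n]. *)
Lemma theta_unif c e : (forall y z, U y -> `|tau (y⁻¹ ∙ c ∙ y ∙ z) - tau z| <= e) ->
  forall x, `|theta (c ∙ x) - theta x| <= e.
Proof.
move=> ce.
have e0 : 0 <= e.
  apply: le_trans (normr_ge0 _) (ce gid gid _); apply: QU.
  by apply: (@spow_le L Q 0) => //.
have mul_le (w t s : R) : 0 <= w -> w <= 1 -> t <= s + e -> w * t <= w * s + e.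
  move=> w0 w1 ts; apply: (@le_trans _ _ (w * (s + e))); first exact: ler_wpM2l.
  by rewrite mulrDr lerD2l -[leRHS]mul1r; apply: ler_wpM2r.
move=> x; apply/ler_normlP; split.
  suff : theta x <= theta (c ∙ x) + e by lra.
  apply: theta_le => k y kn Qy; have [c0 c1] := coef kn.
  have Uy : U y by apply: QU; apply: spow_le Qy.
  have := ce y (y⁻¹ ∙ x) Uy; rewrite !gmulA gmulgK => /ler_normlP[h _].
  apply: le_trans (mul_le _ _ (tau (y⁻¹ ∙ c ∙ x)) c0 c1 _) _; first by lra.
  by rewrite lerD2r -gmulA; exact: le_theta.
suff : theta (c ∙ x) <= theta x + e by lra.
apply: theta_le => k y kn Qy; have [c0 c1] := coef kn.
have Uy : U y by apply: QU; apply: spow_le Qy.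
have := ce y (y⁻¹ ∙ x) Uy; rewrite !gmulA gmulgK => /ler_normlP[_ h].
apply: le_trans (mul_le _ _ (tau (y⁻¹ ∙ x)) c0 c1 _) _; first by lra.
by rewrite lerD2r; exact: le_theta.
Qed.

End Theta.

Lemma normalizes_spow (U K : set L) n x k : (forall u k, U u -> K k -> K (u⁻¹ ∙ k ∙ u)) ->
  spow U n x -> K k -> K (x⁻¹ ∙ k ∙ x).
Proof.
move=> UK; elim: n x k => [|n IH] x k /=; first by move=> ->; gsimp.
move=> [q [y [Uq Uy ->]]] Kk.
have -> : (q ∙ y)⁻¹ ∙ k ∙ (q ∙ y) = y⁻¹ ∙ (q⁻¹ ∙ k ∙ q) ∙ y by gsimp.
by apply: IH => //; exact: UK.
Qed.

(* The second differences of the convolution square [phi] of Gleason's function are small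
   relative to [1/n], uniformly in [Q] and [n]. *)
Lemma gleason (U K : set L) (m : nat) : compact U -> sym U -> compact K -> subgrp K ->
  (forall k, K k -> nbhs k U) -> (forall u k, U u -> K k -> K (u⁻¹ ∙ k ∙ u)) ->
  exists (m0 M : R) (W : R -> set L),
  [/\ 0 < m0, 0 < M, (forall e : R, 0 < e -> sym (W e) /\ forall k, K k -> nbhs k (W e)) &
   forall Q n, Q gid -> sym Q -> (0 < n)%N -> spow Q n `<=` U -> exists phi : L -> R,
   [/\ m0 <= phi gid, (forall x, phi x != 0 -> spow U 4 x), (forall x, `|phi x| <= M),
       (forall (e : R) b x, 0 < e -> W e b -> `|phi (b ∙ x) - phi x| <= M * e) &
       (forall (e : R) a b x, 0 < e -> Q a -> W e b -> spow U m x ->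
         `|(phi (a⁻¹ ∙ (b⁻¹ ∙ x)) - phi (b⁻¹ ∙ x)) - (phi (a⁻¹ ∙ x) - phi x)|
         <= M * e / n%:R)]].
Proof.
move=> cU sU cK sK KU UK; have sT : subgrp [set: L] by [].
have [J [Jadd Jsc Jmono Jinv Jpos]] := haar R (H := [set: L]) sT (@closedT L).
have [tau [ucT tau01 tau1 tauU tauK]] := invariant_bump cU cK sK KU.
have U1 : U gid by apply: nbhs_singleton; apply: KU; exact: subgrp1.
have cT := left_unif_continuous ucT.
have [k1 [Ck1 k10] k1P] := Ccp_ge1 R (H := [set: L])
  sT (@closedT L) (@compact_spow L U 3 cU) (@subsetT _ _).
pose M := J k1.
have CcI (h : L -> R) : continuous h -> (forall x, ~ spow U 3 x -> h x = 0) -> Cc [set: L] h.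
  move=> ch h0; split=> //; exists (spow U 3); split=> //; first exact: compact_spow.
  by move=> x _; exact: h0.
have Jbound (h : L -> R) c : 0 <= c -> continuous h -> (forall x, ~ spow U 3 x -> h x = 0) ->
    (forall x, `|h x| <= c) -> `|J h| <= c * M.
  move=> c0 ch h0 hc; have Ch := CcI h ch h0.
  have le x : `|h x| <= c * k1 x.
    have [Ux|nU] := pselect (spow U 3 x); last by rewrite h0 // normr0 mulr_ge0.
    by apply: le_trans (hc x) _; rewrite ler_peMr // k1P.
  apply/ler_normlP; rewrite /M -Jsc // -mulN1r -Jsc //.
  split; apply: Jmono; try exact: Cc_scale; try done; move=> x _;
    have /ler_normlP[] := le x; lra.
have M0 : 0 < M.
  apply: (Jpos k1 gid) => //; apply: (@lt_le_trans _ _ 1) => //; apply: k1P.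
  exact: (@spow_le L U 0).
have Ct2 : Cc [set: L] (fun x => tau x * tau x).
  apply: CcI; first by move=> x; apply: cvgM; exact: cT.
  move=> x nU; rewrite tauU ?mulr0 // => Ux; apply: nU.
  by apply: (@spow_le L U 1) => //; exact: spow1.
pose m0 := J (fun x => tau x * tau x).
have m00 : 0 < m0.
  apply: (Jpos _ gid Ct2) => //; last by rewrite tau1 mulr1.
  by move=> y _; apply: mulr_ge0; case/andP: (tau01 y).
(* A factor from [K] stays in [K] under conjugation by products of elements of [U], and [tau] is
   [K]-invariant; so [W e] can be a neighbourhood of the whole of [K]. *)
have Wex (e : R) : exists W, 0 < e -> [/\ sym W, (forall k, K k -> nbhs k W) &
    forall b x y z, W b -> spow U m x -> U y ->
      `|tau (y⁻¹ ∙ (x⁻¹ ∙ b ∙ x) ∙ y ∙ z) - tau z| <= e].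
  have [e0|] := ltrP 0 e; last by exists setT.
  have [W0 nW0 W0P] := ucT e e0.
  have [W1 nW1 W1P] := nbhs_conj_compact (@compact_spow L U m.+1 cU) nW0.
  pose W2 : set L := [set b | exists w k, [/\ W1 w, K k & b = w ∙ k]].
  have W2P b x y z : W2 b -> spow U m x -> U y ->
      `|tau (y⁻¹ ∙ (x⁻¹ ∙ b ∙ x) ∙ y ∙ z) - tau z| <= e.
    move=> [w [k [W1w Kk ->]]] Ux Uy.
    have Uxy : spow U m.+1 (x ∙ y) by rewrite -addn1; apply: spowD => //; exact: spow1.
    have Kk' := normalizes_spow UK Uxy Kk.
    rewrite -(tauK _ z Kk').
    have -> : y⁻¹ ∙ (x⁻¹ ∙ (w ∙ k) ∙ x) ∙ y ∙ z =
       ((x ∙ y)⁻¹ ∙ w ∙ (x ∙ y)) ∙ (((x ∙ y)⁻¹ ∙ k ∙ (x ∙ y)) ∙ z) by gsimp.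
    by apply: W0P; exact: W1P.
  have nW2 k : K k -> nbhs k W2.
    move=> Kk; apply: filterS (nbhs_translate k nW1) => b /= Wb.
    by exists (b ∙ k⁻¹), k; split=> //; gsimp.
  exists (W2 `&` [set b | W2 b⁻¹]) => _; split.
  - by move=> b [? ?]; split=> //=; rewrite ginvK.
  - move=> k Kk; apply: filterI; first exact: nW2.
    apply: (@nbhs_preimage _ _ ginv); first exact: ginv_continuous.
    by apply: nW2; exact: subgrpV.
  - by move=> b x y z [Wb _]; exact: W2P.
have [W WP] := choice Wex.
exists m0, M, W; split=> // [e e0|Q n Q1 sQ n0 QU]; first by have [] := WP e e0.
pose th := theta tau Q n.
have th0 x : 0 <= th x by exact: theta_ge0.
have th1 x : th x <= 1 by exact: theta_le1.
have thn x : `|th x| <= 1 by rewrite ger0_norm.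
have thU x : ~ spow U 2 x -> th x = 0 by apply: theta_supp.
have thW e b x v : 0 < e -> W e b -> spow U m x -> `|th (x⁻¹ ∙ b ∙ x ∙ v) - th v| <= e.
  move=> e0 Wb Ux; apply: (@theta_unif U tau Q n) => // y z Uy.
  by have [_ _] := WP e e0; apply.
have thuc : left_unif_cont th.
  move=> e e0; have [sW nW _] := WP e e0; exists (W e); first by apply: nW; exact: subgrp1.
  move=> w y Ww; have := @thW e w gid y e0 Ww; gsimp; apply.
  exact: (@spow_le L U 0).
have cth := left_unif_continuous thuc.
have ctr (z : L) : continuous (fun u => th (z ∙ u)).
  move=> u; apply: (@continuous_comp _ _ _ (gmul z)); last exact: cth.
  by move: u; gcont.
have U23 x : spow U 2 x -> spow U 3 x by apply: spow_le.
pose phi x := J (fun u => th (x ∙ u) * th u).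
have cphi (z z' : L) : continuous (fun u => th (z ∙ u) * th (z' ∙ u)).
  by move=> u; apply: cvgM; exact: ctr.
have Cphi x : Cc [set: L] (fun u => th (x ∙ u) * th u).
  apply: CcI; last by move=> u nU; rewrite (thU u) ?mulr0 // => /U23.
  by move=> u; apply: cvgM; [exact: ctr|exact: cth].
(* substituting [x^-1 u] for [u] *)
have dphi a x : phi (a⁻¹ ∙ x) - phi x = J (fun u => (th (a⁻¹ ∙ u) - th u) * th (x⁻¹ ∙ u)).
  have sub z : phi (z ∙ x) = J (fun u => th (z ∙ u) * th (x⁻¹ ∙ u)).
    rewrite /phi -(Jinv x⁻¹) //; congr J; apply/funext => u.
    by congr (th _ * _); gsimp.
  have C1 z : Cc [set: L] (fun u => th (z ∙ u) * th (x⁻¹ ∙ u)).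
    have := Cc_translate sT (z := x⁻¹) I (Cphi (z ∙ x)).
    by congr Cc; apply/funext => u; congr (th _ * _); gsimp.
  have e : phi x = phi (gid ∙ x) by rewrite gmul1g.
  rewrite {}e !sub -[X in _ - X]mul1r -mulNr -Jsc // -Jadd //; last exact: Cc_scale.
  congr J; apply/funext => u; rewrite gmul1g; lra.
exists phi; split.
- apply: Jmono => // x _; rewrite gmul1g.
  have t0 : 0 <= tau x by case/andP: (tau01 x).
  have tt := @tau_theta tau Q n tau01 n0 x.
  by apply: ler_pM.
- move=> x phix; apply: contrapT => nU; move/eqP: phix; apply.
  suff -> : phi x = J (fun u => 0 * (tau u * tau u)) by rewrite Jsc ?mul0r.
  congr J.
  apply/funext => u; rewrite mul0r.
  have [Uu|nUu] := pselect (spow U 2 u); last by rewrite (thU u) ?mulr0.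
  rewrite thU ?mul0r // => Uxu; apply: nU.
  rewrite (_ : x = (x ∙ u) ∙ u⁻¹); last by gsimp.
  by apply: (@spowD L U 2 2) => //; exact: spowV.
- move=> x; rewrite -[leRHS]mul1r; apply: Jbound => //; first exact: (Cphi x).1.
    by move=> u nU; rewrite (thU u) ?mulr0 // => /U23.
  by move=> u; rewrite normrM -[leRHS]mulr1; apply: ler_pM.
- move=> e b x e0 Wb.
  have -> : phi (b ∙ x) - phi x = J (fun u => (th (b ∙ x ∙ u) - th (x ∙ u)) * th u).
    rewrite -[X in _ - X]mul1r -mulNr -Jsc // -Jadd //; last exact: Cc_scale.
    by congr J; apply/funext => u; lra.
  rewrite mulrC; apply: Jbound => //; first exact: ltW.
  + move=> u; apply: cvgM; last exact: cth.
    by apply: (@cvgB R R^o); exact: ctr.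
  + by move=> u nU; rewrite (thU u) ?mulr0 // => /U23.
  + move=> u; rewrite normrM -[leRHS]mulr1; apply: ler_pM => //.
    have := @thW e b gid (x ∙ u) e0 Wb; gsimp; apply; exact: (@spow_le L U 0).
- move=> e a b x e0 Qa Wb Ux; rewrite !dphi.
  have Qa' : Q a⁻¹ by exact: sQ.
  have Ua : U a⁻¹ by apply: QU; apply: (@spow_le L Q 1) => //; exact: spow1.
  have cD z : continuous (fun u => (th (a⁻¹ ∙ u) - th u) * th (z ∙ u)).
    move=> u; apply: cvgM; last exact: ctr.
    by apply: (@cvgB R R^o); [exact: ctr|exact: cth].
  have D0 u : ~ spow U 3 u -> th (a⁻¹ ∙ u) - th u = 0.
    move=> nU; rewrite (thU u) ?subr0; last by move=> /U23.
    rewrite thU // => Uau; apply: nU; rewrite (_ : u = a ∙ (a⁻¹ ∙ u)); last by gsimp.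
    by apply: spowS => //; rewrite -[a]ginvK; exact: sU.
  have CD z : Cc [set: L] (fun u => (th (a⁻¹ ∙ u) - th u) * th (z ∙ u)).
    by apply: CcI => // u nU; rewrite D0 ?mul0r.
  rewrite -[X in _ - X]mul1r -mulNr -Jsc // -Jadd //; last exact: Cc_scale.
  (* The two differences fall on different factors of the correlation: one in the direction [Q], of
     size [1/n], and one in the direction [W e], of size [e]. Hence the product [e / n]. *)
  have -> : (fun u => (th (a⁻¹ ∙ u) - th u) * th ((b⁻¹ ∙ x)⁻¹ ∙ u) +
      - 1 * ((th (a⁻¹ ∙ u) - th u) * th (x⁻¹ ∙ u))) =
      (fun u => (th (a⁻¹ ∙ u) - th u) * (th (x⁻¹ ∙ b ∙ u) - th (x⁻¹ ∙ u))).
    by apply/funext => u; rewrite ginvM ginvK; lra.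
  rewrite (_ : M * e / n%:R = n%:R^-1 * e * M); last by lra.
  apply: Jbound => //.
  + by rewrite mulr_ge0 ?invr_ge0 // ltW.
  + move=> u; apply: cvgM.
      by apply: (@cvgB R R^o); [exact: ctr|exact: cth].
    by apply: (@cvgB R R^o); exact: ctr.
  + by move=> u nU; rewrite D0 ?mul0r.
  + move=> u; rewrite normrM; apply: ler_pM => //; first exact: theta_Q.
    have := @thW e b x (x⁻¹ ∙ u) e0 Wb Ux; gsimp; exact.
Qed.

End Gleason.

(** * Compact subgroups: isolating a small closed subgroup *)

Section CompactHaar.
Variables (R : realType) (L : lcGroup) (H : set L).
Hypotheses (cH : compact H) (sH : subgrp H).
Local Open Scope ring_scope.
Variable J : (L -> R) -> R.
Hypothesis haarJ : haar_functional H J.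
Implicit Types (h g u : L -> R) (x y z w v : L).

Let CcH h : continuous h -> Cc H h.
Proof. by move=> ch; split=> //; exists H; split. Qed.

Let JD h g : continuous h -> continuous g -> J (fun x => h x + g x) = J h + J g.
Proof. by case: haarJ => Jadd _ _ _ _ ch cg; apply: Jadd; exact: CcH. Qed.

Let JZ a h : continuous h -> J (fun x => a * h x) = a * J h.
Proof. by case: haarJ => _ Jsc _ _ _ ch; apply: Jsc; exact: CcH. Qed.

Let Jle h g : continuous h -> continuous g -> (forall x, H x -> h x <= g x) -> J h <= J g.
Proof. by case: haarJ => _ _ Jm _ _ ch cg; apply: Jm; exact: CcH. Qed.

Let Jext h g : continuous h -> continuous g -> (forall x, H x -> h x = g x) -> J h = J g.
Proof.
by move=> ch cg e; apply/eqP; rewrite eq_le; apply/andP; split; apply: Jle => // x Hx; rewrite e.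
Qed.

Let Jtrans z h : H z -> continuous h -> J (fun x => h (z ∙ x)) = J h.
Proof. by case: haarJ => _ _ _ Ji _ Hz ch; apply: Ji => //; exact: CcH. Qed.

Lemma ctsD h g : continuous h -> continuous g -> continuous (fun x => h x + g x).
Proof. by move=> ch cg x; apply: cvgD; [exact: ch|exact: cg]. Qed.
Lemma ctsB h g : continuous h -> continuous g -> continuous (fun x => h x - g x).
Proof. by move=> ch cg x; apply: cvgB; [exact: ch|exact: cg]. Qed.
Lemma ctsM h g : continuous h -> continuous g -> continuous (fun x => h x * g x).
Proof. by move=> ch cg x; apply: cvgM; [exact: ch|exact: cg]. Qed.
Lemma cts_cst (c : R) : continuous (fun _ : L => c).
Proof. by move=> x; exact: cvg_cst. Qed.
Lemma ctsZ a h : continuous h -> continuous (fun x => a * h x).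
Proof. by move=> ch; apply: ctsM => //; exact: cts_cst. Qed.
Arguments ctsZ a [h] _.
Lemma cts_comp (X : topologicalType) h (f : X -> L) : continuous h -> continuous f ->
  continuous (fun p => h (f p)).
Proof.
by move=> ch cf p; apply: (@continuous_comp _ _ _ f); [exact: cf|exact: ch].
Qed.
Lemma cts_shift z h : continuous h -> continuous (fun x => h (z ∙ x)).
Proof. by move=> ch; apply: cts_comp => //; gcont. Qed.

Let J1 := J (fun=> 1).

Let J1_gt0 : 0 < J1.
Proof.
case: haarJ => _ _ _ _ Jp; apply: (Jp _ gid) => //; last exact: subgrp1.
by apply: CcH; exact: cts_cst.
Qed.

Let Jcst c : J (fun=> c) = c * J1.
Proof. by rewrite -JZ; [congr J; apply/funext => x; rewrite mulr1|exact: cts_cst]. Qed.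

Let JB h g : continuous h -> continuous g -> J (fun x => h x - g x) = J h - J g.
Proof.
move=> ch cg; rewrite -[X in _ - X]mul1r -mulNr -JZ // -JD //; last exact: ctsZ.
by congr J; apply/funext => x; rewrite mulN1r.
Qed.

Let Jabs h (c : R) : continuous h -> (forall x, H x -> `|h x| <= c) -> `|J h| <= c * J1.
Proof.
move=> ch hc; apply/ler_normlP; rewrite -Jcst; split.
  rewrite -mulN1r -JZ //; apply: Jle; [exact: ctsZ|exact: cts_cst|].
  by move=> x Hx; have /ler_normlP[] := hc x Hx; lra.
apply: Jle => //; first exact: cts_cst.
by move=> x Hx; have /ler_normlP[] := hc x Hx; lra.
Qed.

Let ip h g := J (fun x => h x * g x).
Let n2 h := ip h h.

Let ipC h g : ip h g = ip g h.
Proof. by congr J; apply/funext => x; rewrite mulrC. Qed.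

Let ipD h g u : continuous h -> continuous g -> continuous u ->
  ip (fun x => h x + g x) u = ip h u + ip g u.
Proof.
move=> ch cg cu; rewrite /ip -JD; try exact: ctsM.
by congr J; apply/funext => x; rewrite mulrDl.
Qed.

Let ipZ a h u : continuous h -> continuous u -> ip (fun x => a * h x) u = a * ip h u.
Proof.
move=> ch cu; rewrite /ip -JZ; last exact: ctsM.
by congr J; apply/funext => x; rewrite mulrA.
Qed.

Let ipB h g u : continuous h -> continuous g -> continuous u ->
  ip (fun x => h x - g x) u = ip h u - ip g u.
Proof.
move=> ch cg cu; rewrite /ip -JB; try exact: ctsM.
by congr J; apply/funext => x; rewrite mulrBl.
Qed.

Let ip_ext h g h' g' : continuous h -> continuous g -> continuous h' -> continuous g' ->
  (forall x, H x -> h x = h' x) -> (forall x, H x -> g x = g' x) -> ip h g = ip h' g'.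
Proof.
move=> ch cg ch' cg' e1 e2; apply: Jext; [exact: ctsM|exact: ctsM|].
by move=> x Hx; rewrite e1 // e2.
Qed.

Let n2_ge0 h : continuous h -> 0 <= n2 h.
Proof.
move=> ch; rewrite -[leLHS](mul0r J1) -Jcst; apply: Jle; [exact: cts_cst|exact: ctsM|].
by move=> x _; rewrite -expr2 sqr_ge0.
Qed.

Let n2_eq0 h : continuous h -> n2 h <= 0 -> forall x, H x -> h x = 0.
Proof.
move=> ch h0 x Hx; apply: contrapT => hx; suff : 0 < n2 h by rewrite ltNge h0.
case: haarJ => _ _ _ _ Jp; apply: (Jp _ x) => //; first by apply: CcH; exact: ctsM.
  by move=> y _; rewrite -expr2 sqr_ge0.
by rewrite -expr2 exprn_even_gt0 //=; apply/eqP.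
Qed.

Let n2_bound h (c : R) : 0 <= c -> continuous h -> (forall x, H x -> h x ^+ 2 <= c) -> n2 h <= c * J1.
Proof.
move=> c0 ch hc; apply: le_trans (ler_norm _) _; apply: Jabs; first exact: ctsM.
by move=> x Hx; rewrite -expr2 ger0_norm ?sqr_ge0 // hc.
Qed.

Let n2Z a h : continuous h -> n2 (fun x => a * h x) = a ^+ 2 * n2 h.
Proof.
move=> ch; rewrite /n2 ipZ //; last exact: ctsZ.
by rewrite ipC ipZ // mulrA expr2.
Qed.

Let n2B h g : continuous h -> continuous g ->
  n2 (fun x => h x - g x) = n2 h - 2 * ip h g + n2 g.
Proof.
move=> ch cg; have cB := ctsB ch cg; rewrite /n2 ipB // ipC (ipC g) !ipB //.
by rewrite (ipC g h); lra.
Qed.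

Let n2D_le h g : continuous h -> continuous g ->
  n2 (fun x => h x + g x) <= 2 * n2 h + 2 * n2 g.
Proof.
move=> ch cg; have := n2_ge0 (ctsB ch cg); rewrite n2B //.
have cD := ctsD ch cg.
have -> : n2 (fun x => h x + g x) = n2 h + 2 * ip h g + n2 g.
  by rewrite /n2 ipD // ipC (ipC g) !ipD // (ipC g h); lra.
by lra.
Qed.

Let CS h g : continuous h -> continuous g -> ip h g ^+ 2 <= n2 h * n2 g.
Proof.
move=> ch cg; have [g0|g0] := ltrP 0 (n2 g); last first.
  have -> : ip h g = 0.
    rewrite -(mul0r J1) -Jcst; apply: Jext; [exact: ctsM|exact: cts_cst|].
    by move=> x Hx; rewrite (n2_eq0 cg) // mulr0.
  by rewrite expr2 mul0r mulr_ge0 ?n2_ge0.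
have := n2_ge0 (ctsB ch (ctsZ (ip h g / n2 g) cg)).
rewrite n2B //; last exact: ctsZ.
rewrite n2Z // ipC ipZ // (ipC g h) => le.
have : 0 <= (n2 h - 2 * (ip h g / n2 g * ip h g) + (ip h g / n2 g) ^+ 2 * n2 g) * n2 g.
  by rewrite mulr_ge0 // ltW.
have -> : (n2 h - 2 * (ip h g / n2 g * ip h g) + (ip h g / n2 g) ^+ 2 * n2 g) * n2 g =
   n2 h * n2 g - ip h g ^+ 2 by field; rewrite gt_eqF.
by rewrite subr_ge0.
Qed.

Let J_sum (I : Type) (l : seq I) (f : I -> L -> R) : (forall i, continuous (f i)) ->
  continuous (fun x => \sum_(i <- l) f i x) /\
  J (fun x => \sum_(i <- l) f i x) = \sum_(i <- l) J (f i).
Proof.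
move=> cf; elim: l => [|i l [IH1 IH2]].
  have e : (fun x => \sum_(i <- [::]) f i x) = (fun=> 0).
    by apply/funext => x; rewrite big_nil.
  by rewrite e big_nil Jcst mul0r; split=> //; exact: cts_cst.
have e : (fun x => \sum_(j <- i :: l) f j x) = (fun x => f i x + \sum_(j <- l) f j x).
  by apply/funext => x; rewrite big_cons.
by rewrite e big_cons JD // IH2; split=> //; exact: ctsD.
Qed.

Let J_param_cts (F : L * L -> R) : continuous F -> continuous (fun z => J (fun w => F (z, w))).
Proof.
move=> cF z; apply/(@cvgrPdist_le R R^o) => e e0.
have cFz y : continuous (fun w => F (y, w)).
  move=> w; apply: (@continuous_comp _ _ _ (fun w => (y, w))); last exact: cF.
  by apply: cvg_pair; [exact: cvg_cst|exact: cvg_id].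
pose d := e / J1.
have d0 : 0 < d by rewrite divr_gt0.
have [|w Hw|W nW WP] := @tube L L R (fun p => F (p.1 ∙ z, p.2) - F (z, p.2)) H
    [set r | `|r| <= d] _ cH.
- move=> p; apply: (@cvgB R R^o).
    apply: (@continuous_comp _ _ _ (fun p : L * L => (p.1 ∙ z, p.2))); last exact: cF.
    apply: cvg_pair; last exact: cvg_snd.
    by apply: cvg_gmul; [exact: cvg_fst|exact: cvg_cst].
  apply: (@continuous_comp _ _ _ (fun p : L * L => (z, p.2))); last exact: cF.
  by apply: cvg_pair; [exact: cvg_cst|exact: cvg_snd].
- rewrite /= gmul1g subrr; apply: filterS (nbhsx_ballx (0 : R^o) d d0) => r.
  by rewrite /ball /= sub0r normrN => /ltW.
apply: filterS (nbhs_translate z nW) => y /= Wy.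
rewrite distrC -JB // (_ : e = d * J1); last by rewrite /d divfK ?gt_eqF.
apply: Jabs; first exact: ctsB.
by move=> w Hw; have := WP _ w Wy Hw; rewrite /= gmulgVK.
Qed.

(** A partition of unity [p s] approximates [F (z, w)] uniformly on [H] by the sum of
    [p s z * F (s, w)], for which the exchange is linearity. *)
Let fubini (F : L * L -> R) : continuous F ->
  J (fun z => J (fun w => F (z, w))) = J (fun w => J (fun z => F (z, w))).
Proof.
move=> cF.
have cFz y : continuous (fun w => F (y, w)).
  move=> w; apply: (@continuous_comp _ _ _ (fun w => (y, w))); last exact: cF.
  by apply: cvg_pair; [exact: cvg_cst|exact: cvg_id].
have cFw y : continuous (fun z => F (z, y)).
  move=> z; apply: (@continuous_comp _ _ _ (fun z => (z, y))); last exact: cF.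
  by apply: cvg_pair; [exact: cvg_id|exact: cvg_cst].
have cF' : continuous (fun p : L * L => F (p.2, p.1)).
  move=> p; apply: (@continuous_comp _ _ _ (fun p : L * L => (p.2, p.1))); last exact: cF.
  by apply: cvg_pair; [exact: cvg_snd|exact: cvg_fst].
have cA := J_param_cts cF; have cB := J_param_cts cF'.
apply/eqP; rewrite -subr_eq0 -normr_le0; apply/ler_addgt0Pl => e0 e00; rewrite addr0.
pose e := e0 / (2 * J1 * J1).
have e_gt0 : 0 < e by rewrite divr_gt0 // !mulr_gt0.
have [|[s w] [Hs Hw]|V nV VP] := @tube L (L * L)%type R
    (fun p => F (p.2.1 ∙ p.1, p.2.2) - F (p.2.1, p.2.2)) (H `*` H) [set r | `|r| <= e] _ (compact_setX cH cH).
- move=> p; apply: (@cvgB R R^o).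
    apply: (@continuous_comp _ _ _ (fun p : L * (L * L) => (p.2.1 ∙ p.1, p.2.2))); last exact: cF.
    apply: cvg_pair.
      apply: cvg_gmul; last exact: cvg_fst.
      by apply: (@continuous_comp _ _ _ snd fst); [exact: cvg_snd|exact: cvg_fst].
    by apply: (@continuous_comp _ _ _ snd snd); exact: cvg_snd.
  apply: (@continuous_comp _ _ _ (fun p : L * (L * L) => (p.2.1, p.2.2))); last exact: cF.
  apply: cvg_pair.
    by apply: (@continuous_comp _ _ _ snd fst); [exact: cvg_snd|exact: cvg_fst].
  by apply: (@continuous_comp _ _ _ snd snd); exact: cvg_snd.
- rewrite /= gmulg1 subrr; apply: filterS (nbhsx_ballx (0 : R^o) e e_gt0) => r.
  by rewrite /ball /= sub0r normrN => /ltW.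
have [b [cb b01 b1 b0]] := bump_function R nV.
have [|l [lH lP]] := @finite_cover L H (fun x => [set y | 1 / 2 < b (x⁻¹ ∙ y)]) cH.
  move=> x Hx; split; last by rewrite /= gmulVg b1; lra.
  by apply: open_gt_fun; exact: cts_shift.
pose D z := \sum_(s <- l) b (s⁻¹ ∙ z).
have cD : continuous D by apply: (@J_sum _ l (fun s z => b (s⁻¹ ∙ z)) _).1 => s; exact: cts_shift.
have b_ge0 y : 0 <= b y by case/andP: (b01 y).
have D12 z : H z -> 1 / 2 <= D z.
  move=> Hz; have [s sl /= sz] := lP z Hz; rewrite /D (big_rem s) //=.
  have : 0 <= \sum_(y <- rem s l) b (y⁻¹ ∙ z) by apply: sumr_ge0.
  by lra.
(* The maximum changes nothing on [H], where [D >= 1/2], and keeps [E] continuous on all of [L]. *)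
pose E z := (Num.max (D z) (1 / 2))^-1.
have E0 z : 0 < Num.max (D z) (1 / 2) by rewrite lt_max; apply/orP; right; lra.
have cE : continuous E.
  move=> z; apply: cvgV; first by rewrite gt_eqF.
  by apply: (@continuous_max R L D (fun=> 1 / 2)); [exact: cD|exact: cvg_cst].
pose p s z := b (s⁻¹ ∙ z) * E z.
have cp s : continuous (p s) by apply: ctsM => //; exact: cts_shift.
have p0 s z : 0 <= p s z by rewrite mulr_ge0 // invr_ge0 ltW.
have p1 z : H z -> \sum_(s <- l) p s z = 1.
  move=> Hz; rewrite /p -mulr_suml -/(D z) /E max_l ?D12 // divff // gt_eqF //.
  by have := D12 z Hz; lra.
have approx z w : H z -> H w -> `|F (z, w) - \sum_(s <- l) p s z * F (s, w)| <= e.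
  move=> Hz Hw; rewrite -[F (z, w)]mul1r -(p1 z Hz) mulr_suml -sumrB.
  apply: le_trans (ler_norm_sum _ _ _) _.
  rewrite -[leRHS]mul1r -(p1 z Hz) mulr_suml big_seq [leRHS]big_seq.
  apply: ler_sum => s sl; rewrite -mulrBr normrM ger0_norm //.
  have [Vz|nVz] := pselect (V (s⁻¹ ∙ z)); last by rewrite /p b0 // !mul0r.
  apply: ler_wpM2l => //.
  by have := VP _ (s, w) Vz (conj (lH s sl) Hw); rewrite /= gmulA gmulgV gmul1g.
pose A z := J (fun w => F (z, w)); pose B w := J (fun z => F (z, w)).
pose X := \sum_(s <- l) J (p s) * A s.
have hA : `|J A - X| <= e * J1 * J1.
  have [c1 e1] := @J_sum _ l (fun s z => A s * p s z) (fun s => ctsZ (A s) (cp s)).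
  have -> : X = J (fun z => \sum_(s <- l) A s * p s z).
    by rewrite e1; apply: eq_bigr => s _; rewrite JZ // mulrC.
  rewrite -JB //; apply: Jabs; first exact: ctsB.
  move=> z Hz; have [c2 e2] := @J_sum _ l (fun s w => p s z * F (s, w)) (fun s => ctsZ (p s z) (cFz s)).
  have -> : \sum_(s <- l) A s * p s z = J (fun w => \sum_(s <- l) p s z * F (s, w)).
    by rewrite e2; apply: eq_bigr => s _; rewrite JZ // mulrC.
  rewrite -JB //; apply: Jabs; first exact: ctsB.
  by move=> w Hw; exact: approx.
have hB : `|J B - X| <= e * J1 * J1.
  have [c1 e1] := @J_sum _ l (fun s w => J (p s) * F (s, w)) (fun s => ctsZ (J (p s)) (cFz s)).
  have -> : X = J (fun w => \sum_(s <- l) J (p s) * F (s, w)).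
    by rewrite e1; apply: eq_bigr => s _; rewrite JZ.
  rewrite -JB //; apply: Jabs; first exact: ctsB.
  move=> w Hw; have [c2 e2] := @J_sum _ l (fun s z => F (s, w) * p s z) (fun s => ctsZ (F (s, w)) (cp s)).
  have -> : \sum_(s <- l) J (p s) * F (s, w) = J (fun z => \sum_(s <- l) F (s, w) * p s z).
    by rewrite e2; apply: eq_bigr => s _; rewrite JZ // mulrC.
  rewrite -JB //; apply: Jabs; first exact: ctsB.
  move=> z Hz; have := approx z w Hz Hw; congr (`|_ - _| <= _).
  by apply: eq_bigr => s _; rewrite mulrC.
have e0E : e0 = e * J1 * J1 + e * J1 * J1 by rewrite /e; field; rewrite gt_eqF.
rewrite e0E; apply: le_trans (lerD hA hB).
rewrite [`|J B - X|]distrC; apply: le_trans (ler_normD _ _).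
by rewrite addrA subrK.
Qed.

(** * A convolution operator and the stabilizer of its top eigenspace *)

Section Operator.
Variables (tau : L -> R) (x0 : L).
Hypotheses (ucT : left_unif_cont tau) (tauV : forall x, tau x⁻¹ = tau x)
  (tau01 : forall x, 0 <= tau x <= 1) (tau1 : tau gid = 1)
  (Hx0 : H x0) (tau_x0 : forall w, tau (x0⁻¹ ∙ w) * tau w = 0).

Let cT := left_unif_continuous ucT.

(** This operator commutes with left translations by [H], is symmetric because [tau] is even, and is
    compact in the form of the equicontinuity [T_equi]. *)
Let T h z := J (fun w => tau (z⁻¹ ∙ w) * h w).

Let cTw z : continuous (fun w => tau (z⁻¹ ∙ w)).
Proof. exact: cts_shift. Qed.

Let T_cts h : continuous h -> continuous (T h).
Proof.
move=> ch; apply: (@J_param_cts (fun p => tau (p.1⁻¹ ∙ p.2) * h p.2)) => p.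
apply: cvgM.
  by move: p; apply: (@cts_comp _ tau (fun p : L * L => p.1⁻¹ ∙ p.2)) => //; gcont.
by move: p; apply: (@cts_comp _ h (fun p : L * L => p.2)) => //; gcont.
Qed.

Let T_equi (e : R) : 0 < e -> exists2 W, nbhs gid W & forall h z z', continuous h ->
  W (z⁻¹ ∙ z') -> (T h z - T h z') ^+ 2 <= e ^+ 2 * J1 * n2 h.
Proof.
move=> e0; have [W nW WP] := ucT e0; exists W => // h z z' ch Wz.
rewrite /T -JB; try exact: ctsM.
have -> : J (fun w => tau (z⁻¹ ∙ w) * h w - tau (z'⁻¹ ∙ w) * h w) =
    ip (fun w => tau (z⁻¹ ∙ w) - tau (z'⁻¹ ∙ w)) h.
  by congr J; apply/funext => w; rewrite mulrBl.
have cd : continuous (fun w => tau (z⁻¹ ∙ w) - tau (z'⁻¹ ∙ w)) by exact: ctsB.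
apply: le_trans (CS cd ch) _; apply: ler_wpM2r; first exact: n2_ge0.
apply: n2_bound => //; first exact: sqr_ge0.
move=> w Hw; have := WP _ (z'⁻¹ ∙ w) Wz; rewrite !gmulA gmulgK => le.
by rewrite -real_normK ?num_real // ler_sqr ?nnegrE // ltW.
Qed.

Let T_bd h z : continuous h -> T h z ^+ 2 <= J1 * n2 h.
Proof.
move=> ch; rewrite -[T h z]/(ip (fun w => tau (z⁻¹ ∙ w)) h).
apply: le_trans (CS (@cTw z) ch) _; apply: ler_wpM2r; first exact: n2_ge0.
rewrite -[leRHS]mul1r; apply: n2_bound => // w Hw.
by have /andP[t0 t1] := tau01 (z⁻¹ ∙ w); rewrite expr_le1.
Qed.

Let TB h g z : continuous h -> continuous g -> T (fun x => h x - g x) z = T h z - T g z.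
Proof.
move=> ch cg; rewrite /T -JB; try exact: ctsM.
by congr J; apply/funext => w; rewrite mulrBr.
Qed.

Let TZ a h z : continuous h -> T (fun x => a * h x) z = a * T h z.
Proof.
move=> ch; rewrite /T -JZ; last exact: ctsM.
by congr J; apply/funext => w; rewrite mulrCA.
Qed.

Let T_shift h y z : H y -> continuous h -> T (fun x => h (y ∙ x)) z = T h (y ∙ z).
Proof.
move=> Hy ch; rewrite /T -[RHS](Jtrans (z := y) Hy); last exact: ctsM.
by congr J; apply/funext => w; congr (tau _ * _); gsimp.
Qed.

Let T_ext h g z : continuous h -> continuous g -> (forall x, H x -> h x = g x) -> T h z = T g z.
Proof.
move=> ch cg e; apply: Jext; [exact: ctsM|exact: ctsM|].
by move=> x Hx; rewrite e.
Qed.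

Let T_sym h g : continuous h -> continuous g -> ip (T h) g = ip h (T g).
Proof.
move=> ch cg.
pose F (p : L * L) := tau (p.1⁻¹ ∙ p.2) * h p.2 * g p.1.
have cF : continuous F.
  move=> p; apply: cvgM.
    apply: cvgM.
      by move: p; apply: (@cts_comp _ tau (fun p : L * L => p.1⁻¹ ∙ p.2)) => //; gcont.
    by move: p; apply: (@cts_comp _ h (fun p : L * L => p.2)) => //; gcont.
  by move: p; apply: (@cts_comp _ g (fun p : L * L => p.1)) => //; gcont.
have -> : ip (T h) g = J (fun z => J (fun w => F (z, w))).
  congr J; apply/funext => z; rewrite mulrC /T -JZ; last exact: ctsM.
  by congr J; apply/funext => w; rewrite /F /= mulrC.
rewrite (fubini cF); congr J; apply/funext => w; rewrite /T -JZ; last exact: ctsM.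
congr J; apply/funext => z; rewrite /F /= -[tau (w⁻¹ ∙ z)]tauV ginvM ginvK.
by rewrite mulrAC mulrC.
Qed.

Definition class_inv u := continuous u /\
  forall y v, H y -> H v -> u (y ∙ x0 ∙ y⁻¹ ∙ v) = u v.

(** The orthogonal complement of the functions fixed by all conjugates of [x0]. A nonzero
    eigenfunction found in it must be moved by some conjugate of [x0]. *)
Let S h := continuous h /\ forall u, class_inv u -> ip h u = 0.

Let Hconj y : H y -> H (y ∙ x0 ∙ y⁻¹).
Proof. by move=> Hy; apply: subgrpM => //; [exact: subgrpM|exact: subgrpV]. Qed.

Let S_T h : S h -> S (T h).
Proof.
move=> [ch hu]; split; first exact: T_cts.
move=> u [cu ui]; rewrite T_sym //; apply: hu; split; first exact: T_cts.
move=> y v Hy Hv; rewrite -T_shift //; last exact: Hconj.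
apply: T_ext => //; first exact: cts_shift.
by move=> x Hx; exact: ui.
Qed.

Let S_B h g : S h -> S g -> S (fun x => h x - g x).
Proof.
move=> [ch hu] [cg gu]; split; first exact: ctsB.
by move=> u iu; rewrite ipB //; [rewrite hu // gu // subrr|exact: iu.1].
Qed.

Let S_Z a h : S h -> S (fun x => a * h x).
Proof.
move=> [ch hu]; split; first exact: ctsZ.
by move=> u iu; rewrite ipZ //; [rewrite hu // mulr0|exact: iu.1].
Qed.

Let S_shift y h : H y -> S h -> S (fun x => h (y ∙ x)).
Proof.
move=> Hy [ch hu]; split; first exact: cts_shift.
move=> u [cu ui]; rewrite -(hu (fun x => u (y⁻¹ ∙ x))).
  rewrite /ip -(Jtrans (z := y) Hy (h := fun x => h x * u (y⁻¹ ∙ x))).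
    by congr J; apply/funext => x; congr (_ * u _); gsimp.
  by apply: ctsM => //; exact: cts_shift.
split; first exact: cts_shift.
move=> z v Hz Hv; have Hy' := subgrpV sH Hy.
rewrite -(ui (y⁻¹ ∙ z) (y⁻¹ ∙ v)); try exact: subgrpM.
by congr u; gsimp.
Qed.

(** The squared norm of [T] on [S]. Working with [T] applied twice avoids the sign of an
    eigenvalue. *)
Let Lam := sup [set n2 (T h) | h in [set h | S h /\ n2 h <= 1]].

Let Lam_bd h : continuous h -> n2 h <= 1 -> n2 (T h) <= J1 * J1.
Proof.
move=> ch h1; apply: n2_bound; [exact: ltW|exact: T_cts|].
move=> x _; apply: le_trans (T_bd x ch) _; rewrite -[leRHS]mulr1.
by apply: ler_wpM2l => //; exact: ltW.
Qed.

Let Lam_sup h : S h -> n2 h <= 1 -> n2 (T h) <= Lam.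
Proof.
move=> Sh h1; apply: ub_le_sup; last by exists h.
by exists (J1 * J1) => _ [g [[cg _] g1] <-]; exact: Lam_bd.
Qed.

Let S_h0 : S (fun v => tau (x0⁻¹ ∙ v) - tau v).
Proof.
split; first by apply: ctsB.
move=> u [cu ui]; rewrite ipB // /ip.
rewrite -(Jtrans (z := x0) Hx0 (h := fun x => tau (x0⁻¹ ∙ x) * u x)); last exact: ctsM.
rewrite (Jext (g := fun x => tau x * u x)) ?subrr //.
- by apply: ctsM; [exact: (@cts_shift x0 (fun y => tau (x0⁻¹ ∙ y)) (@cTw x0))|exact: cts_shift].
- exact: ctsM.
- move=> x Hx; rewrite gmulA gmulVg gmul1g; congr (_ * _).
  have := ui gid x (subgrp1 sH) Hx; by rewrite gmul1g ginv1 gmulg1.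
Qed.

(** On [h0], the difference of the translate of [tau] by [x0] and [tau], the operator takes at [x0]
    the value [T tau gid] minus the pairing of [tau] with its translate. The pairing vanishes by
    [tau_x0], and [T tau gid] is positive. *)
Let Lam_gt0 : 0 < Lam.
Proof.
pose h0 v := tau (x0⁻¹ ∙ v) - tau v.
have ch0 : continuous h0 by exact: S_h0.1.
have n0 : 0 < n2 (T h0).
  rewrite ltNge; apply/negP => /(n2_eq0 (T_cts ch0)) /(_ x0 Hx0).
  rewrite TB // (T_shift _ (subgrpV sH Hx0)) // gmulVg {2}/T.
  have -> : J (fun w => tau (x0⁻¹ ∙ w) * tau w) = 0.
    rewrite -(mul0r J1) -Jcst; congr J; apply/funext => w; exact: tau_x0.
  rewrite subr0 => T0; suff : 0 < T tau gid by rewrite T0 ltxx.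
  case: haarJ => _ _ _ _ Jp; apply: (Jp _ gid); last by rewrite ginv1 gmul1g tau1 mulr1.
  - by apply: CcH; exact: ctsM.
  - by move=> y _; apply: mulr_ge0; [case/andP: (tau01 (gid⁻¹ ∙ y))|case/andP: (tau01 y)].
  - exact: subgrp1.
pose c := (1 + n2 h0)^-1.
have n20 := n2_ge0 ch0.
have c0 : 0 < c by rewrite invr_gt0; lra.
have cc : c * (1 + n2 h0) = 1 by rewrite mulVf // gt_eqF //; lra.
apply: (@lt_le_trans _ _ (n2 (T (fun x => c * h0 x)))).
  have -> : T (fun x => c * h0 x) = (fun x => c * T h0 x) by apply/funext => z; rewrite TZ.
  by rewrite n2Z ?mulr_gt0 ?exprn_gt0 //; exact: T_cts.
apply: Lam_sup; first exact: S_Z S_h0.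
rewrite n2Z // expr2 -mulrA; nra.
Qed.

Let T_le h : S h -> n2 (T h) <= Lam * n2 h.
Proof.
move=> Sh; have ch := Sh.1; have [h0|h0] := ltrP 0 (n2 h); last first.
  have hz := n2_eq0 ch h0.
  apply: (@le_trans _ _ 0); last by rewrite mulr_ge0 ?n2_ge0 // ltW.
  rewrite -[leRHS](mul0r J1); apply: n2_bound => //; first exact: T_cts.
  move=> x _; rewrite (T_ext _ (g := fun=> 0 * 0)) //; last first.
  - by move=> y Hy; rewrite hz // mul0r.
  - exact: cts_cst.
  rewrite TZ; last exact: cts_cst.
  by rewrite mul0r expr2 mul0r.
pose c := (Num.sqrt (n2 h))^-1.
have c2 : c ^+ 2 = (n2 h)^-1 by rewrite exprVn sqr_sqrtr // ltW.
have := Lam_sup (S_Z c Sh); rewrite n2Z // c2 mulVf ?gt_eqF // => /(_ (lexx _)).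
have -> : T (fun x => c * h x) = (fun x => c * T h x) by apply/funext => z; rewrite TZ.
rewrite n2Z; last exact: T_cts.
by rewrite c2 ler_pdivrMl // mulrC.
Qed.

Let Z h := S h /\ forall x, H x -> T (T h) x = Lam * h x.

(** The images of a maximizing sequence are bounded and equicontinuous, so they converge uniformly
    on [H] along an ultrafilter. As [T (T h)] pairs with [h] to [n2 (T h)], which is nearly [Lam],
    the difference [T (T h) - Lam h] is small in norm. *)
Let eigen : exists2 g, Z g & 0 < n2 g.
Proof.
pose iv (n : nat) : R := n.+1%:R^-1.
have iv0 n : 0 < iv n by rewrite invr_gt0.
have /choice [h hP] : forall n : nat, exists h, [/\ S h, n2 h <= 1 & Lam - iv n < n2 (T h)].
  move=> n; have : Lam - iv n < Lam by rewrite ltrBlDr ltrDl.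
  move=> /sup_gt [|_ [h [Sh h1] <-] lt]; last by exists h.
  exists (n2 (T (fun v => 0 * (tau (x0⁻¹ ∙ v) - tau v)))).
  exists (fun v => 0 * (tau (x0⁻¹ ∙ v) - tau v)) => //; split; first exact: (S_Z 0 S_h0).
  by rewrite n2Z ?expr0n ?mul0r //; exact: S_h0.1.
have [F [UF Fn]] := nat_ultra.
pose gn n := T (h n).
have Sn n : S (h n) by have [] := hP n.
have cn n : continuous (h n) by exact: (Sn n).1.
have h1 n : n2 (h n) <= 1 by have [] := hP n.
have cgn n : continuous (gn n) by exact: T_cts.
have bdn n z : `|gn n z| <= J1 + 1.
  have : gn n z ^+ 2 <= J1.
    by apply: le_trans (T_bd z (cn n)) _; rewrite -[leRHS]mulr1 ler_wpM2l // ltW.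
  move=> le; rewrite -ler_sqr ?nnegrE ?addr_ge0 ?(ltW J1_gt0) // real_normK ?num_real //.
  by apply: le_trans le _; have := J1_gt0; nra.
have /choice [g gP] : forall z, exists p : R, (fun n => gn n z) @ F --> p.
  move=> z; apply: (@ultra_lim_real R _ F _ (J1 + 1)) => //.
  by apply: filterE => n; exact: bdn.
have equi e : 0 < e -> exists2 W, nbhs gid W & forall z z', W (z⁻¹ ∙ z') ->
    (forall n, `|gn n z - gn n z'| <= e) /\ `|g z - g z'| <= e.
  move=> e0; pose d := e / (J1 + 1).
  have d0 : 0 < d by rewrite divr_gt0 // addr_gt0.
  have [W nW WP] := T_equi d0; exists W => // z z' Wz.
  have en n : `|gn n z - gn n z'| <= e.
    have J0 := J1_gt0; have eE : e = d * (J1 + 1) by rewrite /d divfK // gt_eqF // addr_gt0.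
    rewrite -ler_sqr ?nnegrE ?(ltW e0) // real_normK ?num_real //.
    apply: le_trans (WP (h n) z z' (cn n) Wz) _; rewrite eE [(d * (J1 + 1)) ^+ 2]exprMn -[d ^+ 2 * J1 * _]mulrA.
    apply: ler_wpM2l; first exact: sqr_ge0.
    have := h1 n; have := n2_ge0 (cn n); nra.
  split=> //; apply/ler_normlP; split.
    rewrite opprB; apply: (@lim_le R _ F _ _ _ _ _ (cvgB (gP z') (gP z)) (cvg_cst e)).
    by apply: filterE => n; have /ler_normlP[] := en n; rewrite opprB.
  apply: (@lim_le R _ F _ _ _ _ _ (cvgB (gP z) (gP z')) (cvg_cst e)).
  by apply: filterE => n; have /ler_normlP[] := en n.
have cg : continuous g.
  move=> z; apply/(@cvgrPdist_le R R^o) => e e0.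
  have [W nW WP] := equi e e0.
  by apply: filterS (nbhs_translate_left z nW) => y /= Wy; exact: (WP z y Wy).2.
have unif e : 0 < e -> F [set n | forall z, H z -> `|gn n z - g z| <= e].
  move=> e0; have e3 : 0 < e / 3 by rewrite divr_gt0.
  have [W nW WP] := equi _ e3.
  have [|l [lH lP]] := @finite_cover L H (fun x => interior [set y | W (x⁻¹ ∙ y)]) cH.
    move=> x Hx; split; first exact: open_interior.
    exact: nbhs_translate_left.
  have : F [set n | forall s, s \in l -> `|gn n s - g s| <= e / 3].
    elim: l {lH lP} => [|s l IH]; first by apply: filterE => n s; rewrite in_nil.
    have Fs : F [set n | `|gn n s - g s| <= e / 3].
      have /(@cvgrPdist_le R R^o) /(_ _ e3) := gP s.
      by apply: filterS => n /=; rewrite distrC.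
    by apply: filterS2 IH Fs => n IH Fs s'; rewrite inE => /predU1P[->//|]; exact: IH.
  apply: filterS => n hl z Hz; have [s sl /interior_subset /= Wz] := lP z Hz.
  have [q1 q2] := WP _ _ Wz.
  have -> : gn n z - g z = - (gn n s - gn n z) + (gn n s - g s) + (g s - g z) by lra.
  have -> : e = e / 3 + e / 3 + e / 3 by lra.
  apply: le_trans (ler_normD _ _) _; apply: lerD => //.
  apply: le_trans (ler_normD _ _) _; rewrite normrN; apply: lerD; [exact: q1|exact: hl].
have n2lim e : 0 < e -> F [set n | n2 (fun z => gn n z - g z) <= e].
  move=> e0; pose d := Num.min 1 (e / J1).
  have d0 : 0 < d by rewrite lt_min ltr01 divr_gt0.
  apply: filterS (unif d d0) => n hn /=.
  have dd : d * J1 <= e by rewrite -ler_pdivlMr // ge_min lexx orbT.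
  apply: le_trans dd; apply: n2_bound; [exact: ltW|exact: ctsB|].
  move=> z Hz; rewrite -real_normK ?num_real //.
  have d1 : d <= 1 by rewrite ge_min lexx.
  apply: (@le_trans _ _ (d ^+ 2)); first by rewrite ler_sqr ?nnegrE ?hn // ltW.
  by rewrite expr2 ger_pMr.
have Sgn n : S (gn n) by exact: S_T.
have Sg : S g.
  split=> // u iu; have cu := iu.1; apply/eqP; rewrite -sqrf_eq0 eq_le sqr_ge0 andbT.
  have u0 := n2_ge0 cu.
  apply/ler_addgt0Pl => e e0; rewrite addr0; pose d := e / (n2 u + 1).
  have d0 : 0 < d by rewrite divr_gt0 //; lra.
  have [n hn] := filter_ex (n2lim d d0).
  have -> : ip g u = - ip (fun z => gn n z - g z) u by rewrite ipB // (Sgn n).2 // sub0r opprK.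
  rewrite sqrrN; apply: le_trans (CS (ctsB (cgn n) cg) cu) _.
  have dE : d * (n2 u + 1) = e by rewrite /d divfK // gt_eqF //; lra.
  apply: (@le_trans _ _ (d * n2 u)); first exact: ler_wpM2r.
  by nra.
have est n : n2 (fun z => T (T (gn n)) z - Lam * gn n z) <= Lam * Lam * iv n.
  have cTT : continuous (fun z => T (gn n) z - Lam * h n z).
    by apply: ctsB; [exact: T_cts|exact: ctsZ].
  have -> : (fun z => T (T (gn n)) z - Lam * gn n z) = T (fun z => T (gn n) z - Lam * h n z).
    apply/funext => z; rewrite TB ?TZ //; [exact: T_cts|exact: ctsZ].
  have SS : S (fun z => T (gn n) z - Lam * h n z) by apply: S_B; [exact: S_T|exact: S_Z].
  apply: le_trans (T_le SS) _; rewrite -mulrA; apply: ler_wpM2l; first exact: ltW.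
  rewrite n2B; [|exact: T_cts|exact: ctsZ].
  rewrite n2Z // ipC ipZ //; last exact: T_cts.
  rewrite -T_sym // -/(gn n).
  have [_ _ lt] := hP n; rewrite -/(gn n) in lt.
  have le1 := T_le (Sgn n); have L0 := Lam_gt0.
  have -> : ip (gn n) (gn n) = n2 (gn n) by [].
  have : Lam ^+ 2 * n2 (h n) <= Lam ^+ 2 by rewrite ger_pMr ?exprn_gt0.
  have : Lam * (Lam - iv n) <= Lam * n2 (gn n) by rewrite ler_wpM2l // ltW.
  by rewrite !expr2; nra.
exists g.
  split=> // x Hx; apply/eqP; rewrite -subr_eq0; apply/eqP.
  have cTg : continuous (fun z => T (T g) z - Lam * g z).
    by apply: ctsB; [do 2 apply: T_cts|exact: ctsZ].
  apply: (n2_eq0 cTg) => //; apply/ler_addgt0Pl => e e0; rewrite addr0.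
  have L0 := Lam_gt0.
  pose d := e / (2 * (8 * Lam * Lam)).
  have d0 : 0 < d by rewrite divr_gt0 // !mulr_gt0.
  have Fe : F [set n | Lam * Lam * iv n <= e / 4].
    have e' : 0 < e / 4 / (Lam * Lam) by rewrite !divr_gt0 // mulr_gt0.
    have [N NP] : exists N : nat, N.+1%:R^-1 < e / 4 / (Lam * Lam).
      by have [N _ NP] := near_infty_natSinv_lt (PosNum e'); exists N; exact: (NP N (leqnn N)).
    apply: filterS (Fn N) => n /= Nn; rewrite mulrC -ler_pdivlMr ?mulr_gt0 //.
    by apply: le_trans (ltW NP); rewrite lef_pV2 ?posrE // ler_nat.
  have [n [h2 h3]] := filter_ex (filterI (n2lim d d0) Fe).
  pose dn z := gn n z - g z.
  have Sd : S dn by exact: S_B.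
  have cd : continuous dn by exact: Sd.1.
  have -> : (fun z => T (T g) z - Lam * g z) =
      (fun z => (T (T (gn n)) z - Lam * gn n z) + - 1 * (T (T dn) z - Lam * dn z)).
    apply/funext => z; have -> : T dn = (fun z => T (gn n) z - T g z) by apply/funext => w; rewrite TB.
    by rewrite TB; [rewrite /dn; lra|exact: T_cts|exact: T_cts].
  have cdd : continuous (fun z => T (T dn) z - Lam * dn z).
    by apply: ctsB; [do 2 apply: T_cts|exact: ctsZ].
  apply: le_trans (n2D_le _ _) _.
  - by apply: ctsB; [do 2 apply: T_cts|exact: ctsZ].
  - exact: ctsZ.
  rewrite n2Z //.
  have le1 : n2 (fun z => T (T dn) z - Lam * dn z) <= 4 * Lam * Lam * n2 dn.
    have -> : (fun z => T (T dn) z - Lam * dn z) = (fun z => T (T dn) z + (- Lam) * dn z).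
      by apply/funext => z; rewrite mulNr.
    apply: le_trans (n2D_le _ _) _; [by do 2 apply: T_cts|exact: ctsZ|].
    rewrite n2Z // sqrrN.
    have := T_le (S_T Sd); have := T_le Sd; have := n2_ge0 cd.
    set a := n2 dn; set b := n2 (T dn); set c := n2 (T (T dn)) => a0 ba cb.
    have : Lam * b <= Lam * (Lam * a) by rewrite ler_wpM2l // ltW.
    rewrite expr2; nra.
  have h3' : Lam * Lam * iv n <= e / 4 by exact: h3.
  have := est n; have dE : d * (2 * (8 * Lam * Lam)) = e by rewrite /d divfK // gt_eqF // !mulr_gt0.
  have : 4 * Lam * Lam * n2 dn <= 4 * Lam * Lam * d.
    by apply: ler_wpM2l => //; rewrite !mulr_ge0 // ltW.
  by rewrite expr2; nra.
rewrite ltNge; apply/negP => g0; have L0 := Lam_gt0.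
have L4 : 0 < Lam / 4 by rewrite divr_gt0.
have Fe : F [set n | iv n <= Lam / 4].
  have [N NP] : exists N : nat, N.+1%:R^-1 < Lam / 4.
    by have [N _ NP] := near_infty_natSinv_lt (PosNum L4); exists N; exact: (NP N (leqnn N)).
  apply: filterS (Fn N) => n /= Nn.
  by apply: le_trans (ltW NP); rewrite lef_pV2 ?posrE // ler_nat.
have [n [h2 h3]] := filter_ex (filterI (n2lim _ L4) Fe).
have := n2D_le (ctsB (cgn n) cg) cg.
have -> : (fun x => gn n x - g x + g x) = gn n by apply/funext => x; rewrite subrK.
have [_ _ lt] := hP n; rewrite -/(gn n) in lt.
rewrite /= in h2 h3 *; lra.
Qed.

Let Z_cts h : Z h -> continuous h. Proof. by case=> -[]. Qed.

Let Z_B h g : Z h -> Z g -> Z (fun x => h x - g x).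
Proof.
move=> [Sh hL] [Sg gL]; have [ch cg] := (Sh.1, Sg.1); split; first exact: S_B.
move=> x Hx; have -> : T (fun x => h x - g x) = (fun x => T h x - T g x).
  by apply/funext => z; rewrite TB.
by rewrite TB; [rewrite hL // gL // mulrBr|exact: T_cts|exact: T_cts].
Qed.

Let Z_shift y h : H y -> Z h -> Z (fun x => h (y ∙ x)).
Proof.
move=> Hy [Sh hL]; have ch := Sh.1; split; first exact: S_shift.
move=> x Hx; have -> : T (fun x => h (y ∙ x)) = (fun x => T h (y ∙ x)).
  by apply/funext => z; rewrite T_shift.
by rewrite T_shift //; [rewrite hL //; exact: subgrpM|exact: T_cts].
Qed.

(** An eigenfunction is [T (T h) / Lam], so the equicontinuity of [T] holds uniformly over the
    eigenspace. This uniformity plays the part of finite dimension: small elements act near the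
    identity in norm, at distance at most one half. *)
Let Z_close : exists2 W, nbhs gid W & forall c h, W c -> H c -> Z h ->
  n2 (fun z => h (c ∙ z) - h z) <= n2 h / 4.
Proof.
have L0 := Lam_gt0; have J0 := J1_gt0.
pose e := Num.min 1 (Lam / (4 * J1 ^+ 2)).
have e0 : 0 < e by rewrite lt_min ltr01 divr_gt0 // mulr_gt0 // exprn_gt0.
have e1 : e <= 1 by rewrite ge_min lexx.
have e2 : e * (4 * J1 ^+ 2) <= Lam.
  by rewrite -ler_pdivlMr ?mulr_gt0 ?exprn_gt0 // ge_min lexx orbT.
have [W0 nW0 W0P] := T_equi e0.
have [W1 nW1 W1P] := nbhs_conj_compact cH nW0.
exists [set c | W1 c⁻¹]; first exact: nbhs_ginv.
move=> c h /= Wc Hc [Sh hL]; have ch := Sh.1; have h0 := n2_ge0 ch.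
have key z : H z -> (h (c ∙ z) - h z) ^+ 2 <= e ^+ 2 * J1 * Lam^-1 * n2 h.
  move=> Hz; have Hcz := subgrpM sH Hc Hz.
  have -> : h (c ∙ z) - h z = Lam^-1 * (T (T h) (c ∙ z) - T (T h) z).
    by rewrite !hL // -mulrBr mulrA mulVf ?mul1r // gt_eqF.
  rewrite exprMn.
  have : (T (T h) (c ∙ z) - T (T h) z) ^+ 2 <= e ^+ 2 * J1 * n2 (T h).
    apply: W0P; first exact: T_cts.
    by have := W1P _ _ Wc Hz; rewrite ginvM.
  have := T_le Sh => TL le.
  have -> : e ^+ 2 * J1 * Lam^-1 * n2 h = Lam^-1 ^+ 2 * (e ^+ 2 * J1 * (Lam * n2 h)).
    by field; rewrite gt_eqF.
  apply: ler_wpM2l; first exact: sqr_ge0.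
  apply: le_trans le _; apply: ler_wpM2l => //.
  by rewrite mulr_ge0 ?sqr_ge0 // ltW.
have c0 : 0 <= e ^+ 2 * J1 * Lam^-1 * n2 h.
  by rewrite !mulr_ge0 ?sqr_ge0 ?invr_ge0 // ltW.
apply: le_trans (n2_bound c0 _ key) _; first by apply: ctsB => //; exact: cts_shift.
have -> : e ^+ 2 * J1 * Lam^-1 * n2 h * J1 = (e ^+ 2 * J1 ^+ 2 * Lam^-1) * n2 h by lra.
rewrite mulrC; apply: ler_wpM2l => //; rewrite ler_pdivrMr //.
have : e ^+ 2 <= e by rewrite expr2 ger_pMr.
have : 0 < J1 ^+ 2 by rewrite exprn_gt0.
move: (J1 ^+ 2) (e ^+ 2) e2 => a b e2 a0 ba.
have : b * a <= e * a by rewrite ler_wpM2r // ltW.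
by lra.
Qed.

(** [K] is the pointwise stabilizer of the eigenspace. The rest is the proof that an orthogonal
    group has no small subgroups: if [y] in [D] moves an eigenfunction, the powers [y^(2^k)] move
    some eigenfunction too far. *)
Lemma isolate_op : exists K W, [/\ closed K, subgrp K, K `<=` H, ~ K x0 &
  nbhs gid W /\ forall D : set L, subgrp D -> D `<=` H ->
    (forall y, D y -> exists w k, [/\ W w, K k & y = w ∙ k]) -> D `<=` K].
Proof.
pose K := [set y | H y /\ forall h, Z h -> forall v, H v -> h (y ∙ v) = h v].
have sK : subgrp K.
  split; first by split; [exact: subgrp1|move=> h _ v _; rewrite gmul1g].
  split=> [x y [Hx xP] [Hy yP]|x [Hx xP]].
    split; first exact: subgrpM.
    by move=> h Zh v Hv; rewrite -gmulA xP //; [exact: yP|exact: subgrpM].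
  split; first exact: subgrpV.
  move=> h Zh v Hv; rewrite -(xP h Zh (x⁻¹ ∙ v)) ?gmulA ?gmulgV ?gmul1g //.
  by apply: subgrpM => //; exact: subgrpV.
have [W nW WP] := Z_close.
exists K, W; split=> //.
- move=> y cy; split.
    by apply: (compact_closedL cH); apply: closureS cy => x [].
  move=> h Zh v Hv.
  have cl : closed [set y | h (y ∙ v) - h v = 0].
    have cc : continuous (fun y => h (y ∙ v) - h v).
      apply: ctsB; last exact: cts_cst.
      by apply: (@cts_comp _ h (fun y => y ∙ v)); [exact: Z_cts|gcont].
    by apply: (@closed_comp _ _ _ [set 0 : R] (fun x _ => cc x)); exact: closed_eq.
  apply/eqP; rewrite -subr_eq0; apply/eqP; apply: cl.
  by apply: closureS cy => x [_ xP] /=; rewrite xP // subrr.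
- by move=> y [].
- move=> [_ xP]; have [g Zg g0] := eigen.
  (* Translates of eigenfunctions are eigenfunctions, so if [x0] fixed them all, its conjugates
     would too; [g] would then be orthogonal to itself. *)
  suff ci : class_inv g by have [[_ /(_ g ci) gg] _] := Zg; move: g0; rewrite /n2 gg ltxx.
  split; first exact: Z_cts.
  move=> y v Hy Hv.
  have := xP _ (Z_shift Hy Zg) (y⁻¹ ∙ v); rewrite !gmulA gmulgV gmul1g; apply.
  by apply: subgrpM => //; exact: subgrpV.
split=> // D sD DH DP.
have close y h : D y -> Z h -> n2 (fun z => h (y ∙ z) - h z) <= n2 h / 4.
  move=> Dy Zh; have [w [k [Ww [Hk kP] yE]]] := DP y Dy.
  have Hw : H w.
    rewrite (_ : w = y ∙ k⁻¹); last by rewrite yE gmulgK.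
    by apply: subgrpM => //; [exact: DH|exact: subgrpV].
  apply: le_trans (WP w h Ww Hw Zh); rewrite le_eqVlt; apply/orP; left; apply/eqP.
  have ch := Z_cts Zh.
  have e x : H x -> h (y ∙ x) - h x = h (w ∙ x) - h x.
    by move=> Hx; rewrite yE -gmulA (kP _ (Z_shift Hw Zh)).
  by apply: ip_ext; try exact: e; apply: ctsB => //; exact: cts_shift.
move=> y Dy; split; first exact: DH.
move=> h Zh v Hv; have ch := Z_cts Zh.
pose a k := n2 (fun z => h (y ^^ (2 ^ k) ∙ z) - h z).
(* With [d = y' h - h] one has [2 d = (y'^2 h - h) - (y' d - d)], where the last term has at most
   half the norm of [d]. So [a] grows by a factor [7/4] at each doubling; linear growth is
   enough. *)
have ak k : (1 + k%:R / 2) * a 0%N <= a k.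
  elim: k => [|k IH]; first by rewrite mul0r addr0 mul1r.
  pose y' := y ^^ (2 ^ k); have Dy' : D y' by exact: subgrpX.
  have Hy' := DH _ Dy'.
  pose d z := h (y' ∙ z) - h z.
  have Zd : Z d by apply: Z_B => //; exact: Z_shift.
  have cd := Z_cts Zd.
  have cX : continuous (fun z => h (y ^^ (2 ^ k.+1) ∙ z) - h z) by apply: ctsB => //; exact: cts_shift.
  have cE : continuous (fun z => d (y' ∙ z) - d z) by apply: ctsB => //; exact: cts_shift.
  have le1 := close y' d Dy' Zd.
  have le2 := n2D_le cX (ctsZ (- 1) cE).
  have dE : (fun x => (h (y ^^ (2 ^ k.+1) ∙ x) - h x) + - 1 * (d (y' ∙ x) - d x)) = (fun x => 2 * d x).
    apply/funext => z; rewrite /d expnS mul2n -addnn pwD -/y' !gmulA; lra.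
  rewrite dE !n2Z // -/(a k.+1) in le2.
  have akE : a k = n2 d by [].
  have a0 : 0 <= a 0%N by apply: n2_ge0; apply: ctsB => //; exact: cts_shift.
  have dk0 : 0 <= k%:R * a 0%N by rewrite mulr_ge0.
  rewrite akE in IH; rewrite !expr2 in le2; rewrite -natr1.
  by nra.
have a0 : a 0%N <= 0.
  rewrite leNgt; apply/negP => a0.
  pose B := n2 h / a 0%N.
  have B0 : 0 <= B by apply: divr_ge0; [exact: n2_ge0|exact: ltW].
  have lt := archi_boundP B0; set k := Num.bound B in lt.
  have le1 := ak k; have le2 := close _ h (subgrpX (2 ^ k) sD Dy) Zh.
  rewrite -/(a k) in le2.
  have BE : B * a 0%N = n2 h by rewrite /B divfK // gt_eqF.
  have : B * a 0%N < k%:R * a 0%N by rewrite ltr_pM2r.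
  have := n2_ge0 ch.
  by nra.
have ca : continuous (fun z => h (y ^^ (2 ^ 0) ∙ z) - h z) by apply: ctsB => //; exact: cts_shift.
have := n2_eq0 ca a0 Hv; rewrite expn0 pw1 => e.
by apply/eqP; rewrite -subr_eq0 e.
Qed.

End Operator.

End CompactHaar.

(** * The gap lemma *)

Section Gap.
Variables (R : realType) (L : lcGroup) (H : set L).
Hypotheses (cH : compact H) (sH : subgrp H).
Local Open Scope ring_scope.

Lemma isolate x0 : H x0 -> x0 <> gid -> exists K W, [/\ closed K, subgrp K, K `<=` H, ~ K x0 &
  nbhs gid W /\ forall D : set L, subgrp D -> D `<=` H ->
    (forall y, D y -> exists w k, [/\ W w, K k & y = w ∙ k]) -> D `<=` K].
Proof.
move=> Hx0 nx0; have [J haarJ] := haar R sH (compact_closedL cH).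
have nV : nbhs gid (~` [set x0]).
  apply: open_nbhs_nbhs; split; last by move=> /= e; apply: nx0.
  by apply: closed_openC; apply: compact_closedL; exact: compact_set1.
have [W [nW sW WW]] := nbhs_split nV.
have [C [cC nC sC CW]] := compact_nbhs nW.
have [b [cb b01 b1 b0]] := bump_function R nC.
pose tau x := b x * b x⁻¹.
have ctau : continuous tau.
  move=> x; apply: cvgM; first exact: cb.
  by apply: (@continuous_comp _ _ _ ginv); [exact: ginv_continuous|exact: cb].
have tauC x : ~ C x -> tau x = 0 by move=> nCx; rewrite /tau b0 // mul0r.
apply: (@isolate_op R L H cH sH J haarJ tau x0) => //.
- exact: compact_left_unif_cont cC tauC.
- by move=> x; rewrite /tau ginvK mulrC.
- move=> x; have /andP[p q] := b01 x; have /andP[p' q'] := b01 x⁻¹.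
  by rewrite mulr_ge0 //= -[leRHS]mulr1; apply: ler_pM.
- by rewrite /tau ginv1 b1 mulr1.
- move=> w; have [Cw|nCw] := pselect (C w); last by rewrite (tauC w) ?mulr0.
  have [Cw'|nCw'] := pselect (C (x0⁻¹ ∙ w)); last by rewrite tauC ?mul0r.
  have := WW _ _ (CW _ Cw) (CW _ (sC _ Cw')); case.
  by rewrite /=; gsimp.
Qed.

Lemma gap (O : set L) : nbhs gid O -> exists K W,
  [/\ closed K, subgrp K, K `<=` H, K `<=` O &
  nbhs gid W /\ forall D : set L, subgrp D -> D `<=` H ->
    (forall y, D y -> exists w k, [/\ W w, K k & y = w ∙ k]) -> D `<=` K].
Proof.
move=> nO.
have /choice [KW KWP] : forall x, exists KW : set L * set L, H x -> x <> gid ->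
    [/\ closed KW.1, subgrp KW.1, KW.1 `<=` H, ~ KW.1 x &
    nbhs gid KW.2 /\ forall D : set L, subgrp D -> D `<=` H ->
    (forall y, D y -> exists w k, [/\ KW.2 w, KW.1 k & y = w ∙ k]) -> D `<=` KW.1].
  move=> x; have [[Hx nx]|n] := pselect (H x /\ x <> gid); last first.
    by exists (setT, setT) => Hx nx; case: n.
  by have [K [W KWP]] := isolate Hx nx; exists (K, W).
pose C := H `&` ~` (interior O).
have cC : compact C.
  by apply: compact_closedI => //; apply: open_closedC; exact: open_interior.
have Cne x : C x -> x <> gid by move=> [_ nO'] e; apply: nO'; rewrite e.
have [|l [lC lP]] := @finite_cover L C (fun x => ~` (KW x).1) cC.
  move=> x Cx; have [clK _ _ nK _] := KWP x Cx.1 (Cne x Cx).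
  by split=> //; exact: closed_openC.
pose K := [set y | H y /\ forall x, x \in l -> (KW x).1 y].
pose W := [set w | forall x, x \in l -> (KW x).2 w].
exists K, W; split.
- move=> y cy; split.
    by apply: (compact_closedL cH); apply: closureS cy => x [].
  move=> x xl; have [clK _ _ _ _] := KWP x (lC x xl).1 (Cne _ (lC x xl)).
  by apply: clK; apply: closureS cy => z [_]; exact.
- split; first by split=> [|x xl]; [exact: subgrp1|have [_ /subgrp1] := KWP x (lC x xl).1 (Cne _ (lC x xl))].
  split=> [y z [Hy yP] [Hz zP]|y [Hy yP]].
    split=> [|x xl]; first exact: subgrpM.
    have [_ sK _ _ _] := KWP x (lC x xl).1 (Cne _ (lC x xl)).
    by apply: subgrpM => //; [exact: yP|exact: zP].
  split=> [|x xl]; first exact: subgrpV.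
  have [_ sK _ _ _] := KWP x (lC x xl).1 (Cne _ (lC x xl)).
  by apply: subgrpV => //; exact: yP.
- by move=> y [].
- move=> y [Hy yP]; apply: interior_subset; apply: contrapT => nOy.
  by have [x xl] := lP y (conj Hy nOy); apply; exact: yP.
split.
  rewrite /W; elim: l lC {lP K W} => [|x l IH] lC; first by apply: filterE => w x; rewrite in_nil.
  have xl : x \in x :: l by exact: mem_head.
  have [_ _ _ _ [nW _]] := KWP x (lC x xl).1 (Cne _ (lC x xl)).
  have {}IH := IH (fun z zl => lC z (mem_behead (s := x :: l) zl)).
  by apply: filterS2 nW IH => w Ww IHw z; rewrite inE => /predU1P[->//|]; exact: IHw.
move=> D sD DH DP y Dy; split; first exact: DH.
move=> x xl; have [_ _ _ _ [_ h]] := KWP x (lC x xl).1 (Cne _ (lC x xl)).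
apply: (h D) => // z Dz; have [w [k [Ww [_ Kk] ->]]] := DP z Dz.
by exists w, k; split=> //; [exact: Ww|exact: Kk].
Qed.

End Gap.

(** * Trapping small subgroups *)

Lemma closure_min (T : topologicalType) (A C : set T) : closed C -> A `<=` C -> closure A `<=` C.
Proof. by move=> cC AC x /(closureS AC) /cC. Qed.

(** * Limit groups at a time scale *)

Section LimitGroup.
Variables (L : lcGroup) (I : Type) (F : set_system I).
Hypothesis UF : UltraFilter F.
Variables (Q : I -> set L) (n : I -> nat).
Hypotheses (Q1 : F [set i | Q i gid]) (sQ : F [set i | sym (Q i)]).

(** Limits of what [Q i] reaches within a fixed multiple of [n i] steps. Leaving the multiple [D]
    free is what makes the limits closed under products. *)
Definition limgrp : set L := [set e | exists (D : nat) (x : I -> L),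
  F [set i | spow (Q i) (D * n i) (x i)] /\ x @ F --> e].

Lemma limgrp_subgrp : subgrp limgrp.
Proof.
split.
  exists 0%N, (fun=> gid); split; last exact: cvg_cst.
  by apply: filterE.
split=> [a b [D [x [Fx xa]]] [D' [y [Fy yb]]]|a [D [x [Fx xa]]]].
  exists (D + D')%N, (fun i => x i ∙ y i); split; last exact: cvg_gmul.
  by apply: filterS2 Fx Fy => i hx hy /=; rewrite mulnDl; exact: spowD.
exists D, (fun i => (x i)⁻¹); split; last exact: cvg_ginv.
by apply: filterS2 Fx sQ => i hx si /=; exact: spowV.
Qed.

Lemma limgrp_sub C : closed C -> (forall D, F [set i | spow (Q i) (D * n i) `<=` C]) ->
  limgrp `<=` C.
Proof.
move=> clC FC e [D [x [Fx xe]]]; apply: (lim_closed _ clC _ xe).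
by apply: filterS2 Fx (FC D) => i hx; exact.
Qed.

Lemma limgrp_exit C U : compact C -> (forall D, F [set i | spow (Q i) (D * n i) `<=` C]) ->
  F [set i | (0 < n i)%N] -> F [set i | ~ spow (Q i) (n i).+1 `<=` U] ->
  exists2 p, limgrp p & ~ nbhs p U.
Proof.
move=> cC FC n0 nU.
have /choice [x xP] : forall i, exists x : L, ~ spow (Q i) (n i).+1 `<=` U ->
    spow (Q i) (n i).+1 x /\ ~ U x.
  move=> i; have [s|ns] := pselect (spow (Q i) (n i).+1 `<=` U); first by exists gid.
  by move/existsNP: ns => [x /not_implyP[h1 h2]]; exists x.
(* [n i + 1 <= 2 * n i] as [n i] is positive, so the exit points have limits in the limit group. *)
have F2 : F [set i | spow (Q i) (2 * n i) (x i)].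
  apply: filterS3 Q1 n0 nU => i q1 i0 /xP[h _]; apply: spow_le h => //.
  by move: i0; rewrite /=; lia.
have [|p Cp xp] := ultra_lim (x := x) UF cC.
  by apply: filterS2 F2 (FC 2%N) => i h; exact.
exists p; first by exists 2%N, x.
by apply: (lim_notin _ _ xp); apply: filterS nU => i /xP[].
Qed.

End LimitGroup.

Lemma exit_time (L : lcGroup) (Q U : set L) m : U gid -> ~ spow Q m `<=` U ->
  exists n, [/\ (n < m)%N, spow Q n `<=` U & ~ spow Q n.+1 `<=` U].
Proof.
move=> U1; elim: m => [|m IH] nU; first by case: nU => x /= ->.
have [s|ns] := pselect (spow Q m `<=` U); first by exists m.
by have [n [nm h1 h2]] := IH ns; exists n; split=> //; exact: ltnW.
Qed.

Section Escape.
Variables (R : realType) (L : lcGroup).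
Local Open Scope ring_scope.

(** Turns small second differences into near-linearity of [phi] along the powers of [a]. *)
Lemma telescope_diff (phi : L -> R) (c : R) (a x : L) k :
  (forall s, (s < k)%N -> `|(phi (a⁻¹ ∙ ((a ^^ s)⁻¹ ∙ x)) - phi ((a ^^ s)⁻¹ ∙ x)) -
     (phi (a⁻¹ ∙ x) - phi x)| <= c) ->
  `|phi ((a ^^ k)⁻¹ ∙ x) - phi x - k%:R * (phi (a⁻¹ ∙ x) - phi x)| <= k%:R * c.
Proof.
elim: k => [|k IH] hc; first by rewrite /= ginv1 gmul1g subrr !mul0r subr0 normr0.
have e : (a ^^ k.+1)⁻¹ ∙ x = a⁻¹ ∙ ((a ^^ k)⁻¹ ∙ x) by rewrite pwSr ginvM gmulA.
have h1 := hc k (ltnSn k).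
have h2 := IH (fun s sk => hc s (ltnW sk)).
rewrite e -natr1 !mulrDl !mul1r.
set A := phi (a⁻¹ ∙ ((a ^^ k)⁻¹ ∙ x)) in h1 *; set B := phi ((a ^^ k)⁻¹ ∙ x) in h1 h2 *.
set d := phi (a⁻¹ ∙ x) - phi x in h1 h2 *.
have -> : A - phi x - (k%:R * d + d) = (B - phi x - k%:R * d) + (A - B - d) by lra.
by apply: le_trans (ler_normD _ _) _; exact: lerD.
Qed.

(** Along powers of [q] in [Q] that stay near [K] up to time [j n], Gleason's function is nearly
    linear; being bounded, it has first differences that are a small multiple of [1/n]. So it stays
    positive for [D n] steps, and these steps remain in its support [U^4]. *)
Lemma trapped (U K : set L) (I : Type) (F : set_system I) (Q : I -> set L) (n : I -> nat) :
  compact U -> sym U -> compact K -> subgrp K ->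
  (forall k, K k -> nbhs k U) -> (forall u k, U u -> K k -> K (u⁻¹ ∙ k ∙ u)) ->
  ProperFilter F -> F [set i | Q i gid] -> F [set i | sym (Q i)] -> F [set i | (0 < n i)%N] ->
  F [set i | spow (Q i) (n i) `<=` U] ->
  (forall W j, (forall k, K k -> nbhs k W) ->
     F [set i | forall q s, Q i q -> (s <= j * n i)%N -> W (q ^^ s)]) ->
  forall D, F [set i | spow (Q i) (D * n i) `<=` spow U 4].
Proof.
move=> cU sU cK sK KU UK PF FQ1 FsQ Fn FQU FW D.
have [m0 [M [W [m00 M0 WP G]]]] := gleason R 4 cU sU cK sK KU UK.
(* With [dl = m0 / (2 (D+1))] the constants give [M e = dl / 2] and [2 M <= j dl / 2], so each step
   changes [phi] by at most [dl / n] and [D n] steps by less than [m0]. *)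
pose e := m0 / (4 * M * (D.+1)%:R).
have D0 : (0 : R) < D.+1%:R by rewrite ltr0n.
have e0 : 0 < e by rewrite divr_gt0 // !mulr_gt0.
pose B := 8 * M * D.+1%:R / m0.
have B0 : 0 <= B by rewrite divr_ge0 // ?mulr_ge0 // ltW.
pose j := (Num.bound B).+1.
have jB : B <= j%:R by rewrite (le_trans (ltW (archi_boundP B0))) // ler_nat.
have j0 : (0 : R) < j%:R by rewrite ltr0n.
have [sW nW] := WP e e0.
have F5 : F (([set i | Q i gid] `&` [set i | sym (Q i)]) `&`
    ([set i | (0 < n i)%N] `&` [set i | spow (Q i) (n i) `<=` U])).
  by do 2 ! [apply: filterI => //].
apply: filterS2 F5 (FW (W e) j nW) => i [[Q1 sQ] [n0 QU]] hW.
have [phi [p1 pU pM _ p2]] := G (Q i) (n i) Q1 sQ n0 QU.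
have n0' : (0 : R) < (n i)%:R by rewrite ltr0n.
pose dl := m0 / (2 * D.+1%:R).
have dl0 : 0 < dl by rewrite divr_gt0 // mulr_gt0.
have step q x : Q i q -> spow U 4 x -> `|phi (q⁻¹ ∙ x) - phi x| <= dl / (n i)%:R.
  move=> Qq Ux; pose k := (j * n i)%N.
  have tel : `|phi ((q ^^ k)⁻¹ ∙ x) - phi x - k%:R * (phi (q⁻¹ ∙ x) - phi x)| <= k%:R * (M * e / (n i)%:R).
    apply: telescope_diff => s sk; apply: p2 => //; apply: hW => //; exact: ltnW.
  have kd : k%:R * `|phi (q⁻¹ ∙ x) - phi x| <= 2 * M + k%:R * (M * e / (n i)%:R).
    have b1 := pM ((q ^^ k)⁻¹ ∙ x); have b2 := pM x.
    rewrite -[k%:R in leLHS]ger0_norm // -normrM.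
    set A := phi ((q ^^ k)⁻¹ ∙ x) in tel b1 *; set d := k%:R * _ in tel *.
    have -> : d = (A - phi x) - (A - phi x - d) by lra.
    apply: le_trans (ler_normB _ _) _; apply: lerD => //.
    by apply: le_trans (ler_normB _ _) _; lra.
  have k0 : (0 : R) < k%:R by rewrite natrM mulr_gt0.
  rewrite -(ler_pM2l k0); apply: le_trans kd _.
  have -> : k%:R * (dl / (n i)%:R) = j%:R * dl.
    by rewrite /k natrM; field; rewrite gt_eqF.
  have -> : k%:R * (M * e / (n i)%:R) = j%:R * (M * e).
    by rewrite /k natrM; field; rewrite gt_eqF.
  have -> : M * e = dl / 2 by rewrite /e /dl; field; rewrite !gt_eqF.
  have : B * dl <= j%:R * dl by rewrite ler_wpM2r // ltW.
  have -> : B * dl = 4 * M by rewrite /B /dl; field; rewrite !gt_eqF.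
  by lra.
have main t y : (t <= D * n i)%N -> spow (Q i) t y ->
    spow U 4 y /\ m0 - t%:R * (dl / (n i)%:R) <= phi y.
  elim: t y => [|t IH] y tD /=.
    by move=> ->; rewrite mul0r subr0; split=> //; apply: pU; rewrite gt_eqF // (lt_le_trans m00).
  move=> [q [y' [Qq Qy' ->]]]; have [Uy' py'] := IH y' (ltnW tD) Qy'.
  have := step q⁻¹ y' (sQ _ Qq) Uy'; rewrite ginvK => /ler_normlP[h1 _].
  have ge : m0 - t.+1%:R * (dl / (n i)%:R) <= phi (q ∙ y').
    by rewrite -natr1 mulrDl mul1r; lra.
  split=> //; apply: pU; rewrite gt_eqF //; apply: lt_le_trans ge.
  rewrite subr_gt0; apply: (@le_lt_trans _ _ ((D * n i)%:R * (dl / (n i)%:R))).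
    by rewrite ler_wpM2r ?ler_nat // divr_ge0 // ltW.
  have -> : (D * n i)%:R * (dl / (n i)%:R) = D%:R * dl by rewrite natrM; field; rewrite gt_eqF.
  have : D%:R * dl <= D.+1%:R * dl by rewrite ler_wpM2r ?ler_nat // ltW.
  have -> : D.+1%:R * dl = m0 / 2 by rewrite /dl; field; rewrite gt_eqF.
  by lra.
by move=> y /main[].
Qed.

(** All powers of such elements stay in [V], so the closeness hypothesis of [trapped] holds at every
    time scale as [V] shrinks. *)
Definition cyclic_in (V : set L) : set L := [set x | powers x `<=` V].

Lemma cyclic_in_sym V : sym (cyclic_in V).
Proof.
move=> x xV y [k [->|->]]; rewrite pwV; apply: xV.
  by exists k; right.
by exists k; left; rewrite ginvK.
Qed.

Lemma cyclic_in_gid V : V gid -> cyclic_in V gid.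
Proof. by move=> V1 y [k [->|->]]; rewrite pw_gid ?ginv1. Qed.

Lemma cyclic_in_pw V x k : cyclic_in V x -> V (x ^^ k).
Proof. by apply; exists k; left. Qed.

(* Otherwise the generated sets leave [U0] in [n] steps and, by [trapped], their limit at time
   scale [n] is a compact group; the gap lemma for that group yields a
   neighbourhood left at an earlier time scale, whose limit group cannot exist. *)
Lemma trapping (U0 : set L) : nbhs gid U0 ->
  exists2 V, nbhs gid V & forall n, spow (cyclic_in V) n `<=` U0.
Proof.
move=> nU0; apply: contrapT => nV.
have [C [cC nC sC CU]] := compact_nbhs nU0.
have {nV CU nU0} esc V : nbhs gid V -> exists n, ~ spow (cyclic_in V) n `<=` C.
  move=> nV0; apply: contrapT => h; apply: nV; exists V => // n x Vx; apply: CU.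
  by apply: contrapT => nCx; apply: h; exists n => /(_ x Vx).
have [F [UF FV]] := nbhs_ultra L.
have Fn : F [set V | nbhs gid V] by apply: filterS (FV setT filterT) => V [].
have FQ1 : F [set V | cyclic_in V gid].
  by apply: filterS Fn => V nV; apply: cyclic_in_gid; exact: nbhs_singleton.
have FsQ : F [set V | sym (cyclic_in V)] by apply: filterE => V; exact: cyclic_in_sym.
have trap1 U n : compact U -> sym U -> nbhs gid U -> F [set V | (0 < n V)%N] ->
    F [set V | spow (cyclic_in V) (n V) `<=` U] ->
    forall D, F [set V | spow (cyclic_in V) (D * n V) `<=` spow U 4].
  move=> cU sU nU Fn0 FU; apply: (@trapped U [set gid]) => //.
  - exact: compact_set1.
  - exact: subgrp_gid.
  - by move=> k /= ->.
  - by move=> u k _ /= ->; rewrite gmulg1 gmulVg.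
  - move=> W j nW; apply: filterS (FV W (nW gid erefl)) => V [_ VW] q s Qq _.
    by apply: VW; exact: cyclic_in_pw.
have exit U : nbhs gid U -> exists n : set L -> nat, forall V m, nbhs gid V -> V `<=` U ->
    ~ spow (cyclic_in V) m `<=` U ->
    [/\ (0 < n V)%N, spow (cyclic_in V) (n V) `<=` U & ~ spow (cyclic_in V) (n V).+1 `<=` U]
    /\ (n V < m)%N.
  move=> nU; have U1 := nbhs_singleton nU.
  have /choice [n nP] : forall V, exists n, forall m, nbhs gid V -> V `<=` U ->
      ~ spow (cyclic_in V) m `<=` U ->
      [/\ (0 < n)%N, spow (cyclic_in V) n `<=` U & ~ spow (cyclic_in V) n.+1 `<=` U]
      /\ (n < m)%N.
    move=> V; have [[nV [VU [m nm]]]|no] := pselect (nbhs gid V /\ V `<=` U /\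
        exists m, ~ spow (cyclic_in V) m `<=` U); last first.
      by exists 0%N => m nV VU nm; case: no; split=> //; split=> //; exists m.
    have [n [_ h1 h2]] := exit_time U1 nm.
    exists n => m' _ _ nm'; split; last first.
      rewrite ltnNge; apply/negP => le; apply: nm' => x h; apply: h1.
      by apply: spow_le h => //; apply: cyclic_in_gid; exact: nbhs_singleton.
    split=> //; case: n h1 h2 => // _ h2; case: h2 => x /= [q [y [Qq -> ->]]].
    by rewrite gmulg1; apply: VU; rewrite -(pw1 q); exact: cyclic_in_pw.
  by exists n.
have [n nP] := exit C nC.
have Fex : F [set V | [/\ (0 < n V)%N, spow (cyclic_in V) (n V) `<=` C &
    ~ spow (cyclic_in V) (n V).+1 `<=` C]].
  apply: filterS (FV C nC) => V [nV VC]; have [m nm] := esc V nV.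
  by have [] := nP V m nV VC nm.
have F1 : F [set V | (0 < n V)%N] by apply: filterS Fex => V [].
have F2 : F [set V | spow (cyclic_in V) (n V) `<=` C] by apply: filterS Fex => V [].
have F3 : F [set V | ~ spow (cyclic_in V) (n V).+1 `<=` C] by apply: filterS Fex => V [].
have trC := trap1 C n cC sC nC F1 F2.
pose E := limgrp F cyclic_in n.
have sE : subgrp E by exact: limgrp_subgrp.
have cC4 : compact (spow C 4) by exact: compact_spow.
have EC : E `<=` spow C 4 by apply: limgrp_sub => //; exact: compact_closedL.
have [p Ep np] := limgrp_exit UF FQ1 cC4 trC F1 F3.
pose H := closure E.
have cH : compact H.
  apply: (subclosed_compact _ cC4); first exact: closed_closure.
  by apply: closure_min => //; exact: compact_closedL.
have sH : subgrp H by exact: closure_subgrp.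
have EH : E `<=` H by exact: subset_closure.
have [K [W [clK sK KH KC [nW gapP]]]] := gap R cH sH (nbhs_interior nC).
have cK : compact K by exact: subclosed_compact cH KH.
pose O := [set y : L | exists w k, [/\ W w, K k & y = w ∙ k]].
have nO k : K k -> nbhs k O.
  move=> Kk; apply: filterS (nbhs_translate k nW) => y /= Wy.
  by exists (y ∙ k⁻¹), k; split=> //; gsimp.
have [U [cU sU KU _ UO]] := thicken 4 cK sK nO.
have nU : nbhs gid U by apply: KU; exact: subgrp1.
have U1 : U gid by exact: nbhs_singleton.
have [n2 n2P] := exit U nU.
(* If every multiple of [n] stayed in [U], the gap would put [H] into [K], against the limit [p] of
   exits from [C]. Otherwise the exits from [U] come before [D * n], so their limit group lies in
   [E]. *)
have [[D FD]|noD] := pselect (exists D, F [set V | ~ spow (cyclic_in V) (D * n V) `<=` U]); last first.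
  have allD D : F [set V | spow (cyclic_in V) (D * n V) `<=` U].
    have [//|h] := in_ultra_setVsetC [set V | spow (cyclic_in V) (D * n V) `<=` U] UF.
    by case: noD; exists D.
  have EU : E `<=` U by apply: limgrp_sub => //; exact: compact_closedL.
  have HU : H `<=` U.
    by apply: closure_min => //; exact: compact_closedL.
  apply: np; have /KC : K p; last by [].
  apply: (gapP H) => //; last exact: EH.
  by move=> y Hy; apply: UO; apply: (@spow_le L U 1) => //; apply: spow1; exact: HU.
have Fex2 : F [set V | [/\ (0 < n2 V)%N, spow (cyclic_in V) (n2 V) `<=` U &
    ~ spow (cyclic_in V) (n2 V).+1 `<=` U] /\ (n2 V < D * n V)%N].
  by apply: filterS2 (FV U nU) FD => V [nV VU] nm; exact: n2P.
have G1 : F [set V | (0 < n2 V)%N] by apply: filterS Fex2 => V [[]].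
have G2 : F [set V | spow (cyclic_in V) (n2 V) `<=` U] by apply: filterS Fex2 => V [[]].
have G3 : F [set V | ~ spow (cyclic_in V) (n2 V).+1 `<=` U] by apply: filterS Fex2 => V [[]].
have trU := trap1 U n2 cU sU nU G1 G2.
pose E2 := limgrp F cyclic_in n2.
have cU4 : compact (spow U 4) by exact: compact_spow.
have [p2 Ep2 np2] := limgrp_exit UF FQ1 cU4 trU G1 G3.
apply: np2; apply: KU; apply: (gapP E2) => //; first exact: limgrp_subgrp.
  move=> e [D' [x [Fx xe]]]; apply: EH; exists (D' * D)%N, x; split=> //.
  apply: filterS3 Fx Fex2 FQ1 => V h [_ lt] q1 /=; apply: spow_le h => //.
  by rewrite -mulnA leq_mul2l (ltnW lt) orbT.
move=> y E2y; apply: UO; apply: limgrp_sub E2y => //; exact: compact_closedL.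
Qed.

(** By trapping, the group generated by all subgroups inside [V] has compact closure [H]. Every
    subgroup inside [U], which is contained in [V], lies in [H], where the gap lemma applies. *)
Lemma isolated_subgroup : exists U K : set L, [/\ compact U, compact K, subgrp K,
  (forall k, K k -> nbhs k U) & forall D, subgrp D -> D `<=` U -> D `<=` K].
Proof.
have [C [cC nC sC _]] := compact_nbhs (filterT : nbhs (gid : L) setT).
have [V nV VC] := trapping nC.
pose E := [set x | exists n, spow (cyclic_in V) n x].
have sE : subgrp E.
  apply: spow_bigcup_subgrp; last exact: cyclic_in_sym.
  by apply: cyclic_in_gid; exact: nbhs_singleton.
pose H := closure E.
have cH : compact H.
  apply: (subclosed_compact _ cC); first exact: closed_closure.
  by apply: closure_min; [exact: compact_closedL|move=> x [n]; exact: VC].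
have sH : subgrp H by exact: closure_subgrp.
have [K [W [clK sK KH KV [nW gapP]]]] := gap R cH sH (nbhs_interior nV).
have cK : compact K by exact: subclosed_compact cH KH.
pose O := V `&` [set y : L | exists w k, [/\ W w, K k & y = w ∙ k]].
have nO k : K k -> nbhs k O.
  move=> Kk; apply: filterI; first exact: KV.
  apply: filterS (nbhs_translate k nW) => y /= Wy.
  by exists (y ∙ k⁻¹), k; split=> //; gsimp.
have [U [cU sU KU _ UO]] := thicken 1 cK sK nO.
exists U, K; split=> // D sD DU; apply: gapP => //; last first.
  by move=> y Dy; have [] := UO y (spow1 (DU _ Dy)).
move=> x Dx; apply: subset_closure; exists 1%N; apply: spow1 => y [k [->|->]].
  by have [] := UO (x ^^ k) (spow1 (DU _ (subgrpX k sD Dx))).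
by have [] := UO (x ^^ k)⁻¹ (spow1 (DU _ (subgrpV sD (subgrpX k sD Dx)))).
Qed.

(** For small [w] the conjugate [w^-1 K w] is again a subgroup inside [U0], hence contained in [K].
    The exponent 4 is that of the support of Gleason's function, where [trapped] leaves its limit
    groups. *)
Lemma isolated_normal_subgroup : exists U K : set L,
  [/\ [/\ compact U, sym U & forall k u k', K k -> U u -> K k' -> U (k ∙ u ∙ k')],
      compact K, subgrp K, (forall k, K k -> nbhs k U) &
      (forall u k, U u -> K k -> K (u⁻¹ ∙ k ∙ u)) /\
      forall D, subgrp D -> D `<=` spow U 4 -> D `<=` K].
Proof.
have [U0 [K [cU0 cK sK KU0 iso]]] := isolated_subgroup.
have [W nW WP] : exists2 W, nbhs gid W & forall w k, W w -> K k -> U0 (w⁻¹ ∙ k ∙ w).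
  apply: (@tube L L L (fun p => p.1⁻¹ ∙ p.2 ∙ p.1)) => //; first gcont.
  by move=> k Kk; rewrite /= gmulg1 ginv1 gmul1g; exact: KU0.
have norm w k : W w -> K k -> K (w⁻¹ ∙ k ∙ w).
  move=> Ww Kk; apply: (iso [set x | exists2 k, K k & x = w⁻¹ ∙ k ∙ w]); last by exists k.
    split; first by exists gid; [exact: subgrp1|gsimp].
    split=> [_ _ [a Ka ->] [b Kb ->]|_ [a Ka ->]].
      by exists (a ∙ b); [exact: subgrpM|gsimp].
    by exists a⁻¹; [exact: subgrpV|gsimp].
  by move=> _ [a Ka ->]; exact: WP.
pose O := U0 `&` [set y : L | exists w k, [/\ W w, K k & y = w ∙ k]].
have nO k : K k -> nbhs k O.
  move=> Kk; apply: filterI; first exact: KU0.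
  apply: filterS (nbhs_translate k nW) => y /= Wy.
  by exists (y ∙ k⁻¹), k; split=> //; gsimp.
have [U [cU sU KU KUK UO]] := thicken 4 cK sK nO.
have U1 : U gid by apply: nbhs_singleton; apply: KU; exact: subgrp1.
exists U, K; split=> //; split.
  move=> u k Uu Kk.
  have [_ [w [l [Ww Kl ->]]]] := UO u (@spow_le L U 1 4 U1 isT u (spow1 Uu)).
  rewrite (_ : _ ∙ _ = l⁻¹ ∙ (w⁻¹ ∙ k ∙ w) ∙ l); last by gsimp.
  by apply: subgrpM => //; apply: subgrpM => //; [exact: subgrpV|exact: norm].
by move=> D sD DU; apply: iso => // y /DU /UO[].
Qed.

End Escape.

(** * Escape times near an isolated subgroup *)

Section EscapeTimes.
Variables (R : realType) (L : lcGroup) (U K : set L).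
Hypotheses (cU : compact U) (sU : sym U)
  (KUK : forall k u k', K k -> U u -> K k' -> U (k ∙ u ∙ k'))
  (cK : compact K) (sK : subgrp K) (KU : forall k, K k -> nbhs k U)
  (UK : forall u k, U u -> K k -> K (u⁻¹ ∙ k ∙ u))
  (iso : forall D, subgrp D -> D `<=` spow U 4 -> D `<=` K).

Let clU : closed U. Proof. exact: compact_closedL. Qed.
Let nU : nbhs gid U. Proof. by apply: KU; exact: subgrp1. Qed.
Let U1 : U gid. Proof. exact: nbhs_singleton nU. Qed.
Let U4 : U `<=` spow U 4.
Proof. by move=> x Ux; apply: (@spow_le L U 1) => //; exact: spow1. Qed.
Let cU4 : compact (spow U 4). Proof. exact: compact_spow. Qed.
Let sU4 : sym (spow U 4). Proof. by move=> x; exact: spowV. Qed.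

(** The escape time of [x] from [U] exceeds [n]; its inverse serves as a norm modulo [K]. *)
Definition slow (n : nat) : set L := [set x | forall i, (i <= n)%N -> U (x ^^ i)].

Lemma slow_gid n : slow n gid.
Proof. by move=> i _; rewrite pw_gid. Qed.

Lemma slow_sym n : sym (slow n).
Proof. by move=> x sx i le; rewrite pwV; apply: sU; exact: sx. Qed.

Lemma slow_le m n : (m <= n)%N -> slow n `<=` slow m.
Proof. by move=> mn x sx i im; apply: sx; exact: leq_trans mn. Qed.

Lemma slow_sub n : (0 < n)%N -> slow n `<=` U.
Proof. by move=> n0 x /(_ 1%N n0); rewrite pw1. Qed.

Lemma slow_closed n : closed (slow n).
Proof.
move=> x cx i le.
have cl : closed [set y : L | U (y ^^ i)].
  apply: (@closed_comp _ _ (fun y : L => y ^^ i)) => //.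
  by move=> y _; exact: (@continuous_pw L L id i (@continuous_id_fun L) y).
by apply: cl; apply: closureS cx => y; apply.
Qed.

Lemma slow_nbhs n : nbhs gid (slow n).
Proof.
elim: n => [|n IH].
  by apply: filterE => x i; rewrite leqn0 => /eqP ->.
have : nbhs gid [set x : L | U (x ^^ n.+1)].
  by apply: (@nbhs_preimage _ _ (fun x : L => x ^^ n.+1)); [gcont|rewrite pw_gid].
apply: filterS2 IH => x h1 h2 i; rewrite leq_eqVlt => /predU1P[->//|].
by rewrite ltnS; exact: h1.
Qed.

Lemma slow_pw x N n s : slow N x -> (s * n <= N)%N -> slow n (x ^^ s).
Proof.
move=> sx le i im; rewrite -pwM; apply: sx; apply: leq_trans le.
by rewrite leq_mul2l im orbT.
Qed.

(** [U] normalizes [K], so [(x k)^i] is [x^i] times an element of [K], and [U] is stable under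
    [K]. *)
Lemma slow_mulK n x k : (0 < n)%N -> slow n x -> K k -> slow n (x ∙ k).
Proof.
move=> n0 sx Kk; have Ux := slow_sub n0 sx.
have aux i : exists2 l, K l & (x ∙ k) ^^ i = x ^^ i ∙ l.
  elim: i => [|i [l Kl IH]]; first by exists gid; [exact: subgrp1|rewrite /= gmulg1].
  exists (x⁻¹ ∙ l ∙ x ∙ k); first by apply: subgrpM => //; exact: UK.
  by rewrite !pwSr IH; gsimp.
move=> i le; have [l Kl ->] := aux i.
by rewrite -[x ^^ i]gmul1g; apply: KUK => //; [exact: subgrp1|exact: sx].
Qed.

Let all_slow4 x : (forall i, spow U 4 (x ^^ i)) -> K x.
Proof.
move=> sx; apply: (iso (powers_subgrp x)); last by have := @powers_self L x 1; rewrite pw1.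
by move=> y [i [->|->]]; [exact: sx|apply: sU4; exact: sx].
Qed.

Lemma all_slow x : (forall n, slow n x) -> K x.
Proof. by move=> sx; apply: all_slow4 => i; apply: U4; exact: (sx i i). Qed.

(** An element that never leaves [U] generates a subgroup inside [U], so the decreasing compact sets
    [slow n] meet inside [K]. *)
Lemma slow_small W : (forall k, K k -> nbhs k W) -> exists2 n, (0 < n)%N & slow n `<=` W.
Proof.
move=> KW; have [||m n mn|x sx|n nW] := @decreasing_compact L (fun n => slow n.+1) U W cU.
- by move=> n; exact: slow_closed.
- by move=> n; exact: slow_sub.
- exact: slow_le.
- by apply: KW; apply: all_slow => n; apply: (slow_le (leqnSn n)); exact: sx.
by exists n.+1.
Qed.

(** The escape times from [U] and from [U^4] are comparable, because an element whose powers all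
    stay in [U^4] is already in [K]. *)
Lemma slow4 : exists2 j, (0 < j)%N & forall N x,
  (forall i, (i <= j * N)%N -> spow U 4 (x ^^ i)) -> slow N x.
Proof.
pose Q n := [set x : L | forall i, (i <= n.+1)%N -> spow U 4 (x ^^ i)].
have [n x cx i le|n x Qx|m n mn x Qx i im|x sx|n nW] := @decreasing_compact L Q (spow U 4) U cU4.
- have cl : closed [set y : L | spow U 4 (y ^^ i)].
    apply: (@closed_comp _ _ (fun y : L => y ^^ i)); last exact: compact_closedL.
    by move=> y _; exact: (@continuous_pw L L id i (@continuous_id_fun L) y).
  by apply: cl; apply: closureS cx => y; apply.
- by rewrite -(pw1 x); exact: Qx.
- by apply: Qx; apply: leq_trans im _; rewrite ltnS.
- by apply: KU; apply: all_slow4 => i; exact: (sx i i (leqnSn i)).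
exists n.+1 => // N x sx i iN; apply: nW => s sn; rewrite -pwM; apply: sx.
by rewrite mulnC leq_mul.
Qed.

(** Otherwise products leave [U] at times [m D] far below the escape times of their factors. At that
    scale the powers of each factor are still near [K], so [trapped] applies, and the limit group is
    a subgroup inside [U^4] that is not contained in [K]. *)
Lemma slow_product : exists2 D, (0 < D)%N & forall n, (0 < n)%N -> spow (slow (D * n)) n `<=` U.
Proof.
apply: contrapT => no.
have /choice [n nP] : forall D : nat, exists n, (0 < n)%N /\ ~ spow (slow (D.+1 * n)) n `<=` U.
  move=> D; apply: contrapT => h; apply: no; exists D.+1 => // n n0.
  by apply: contrapT => h'; apply: h; exists n.
have [F [UF Fn]] := nat_ultra.
pose Q D := slow (D.+1 * n D).
have /choice [m mP] : forall D, exists m, [/\ (m < n D)%N, spow (Q D) m `<=` U & ~ spow (Q D) m.+1 `<=` U].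
  by move=> D; exact: exit_time U1 (nP D).2.
have QU D : Q D `<=` U by apply: slow_sub; rewrite muln_gt0 (nP D).1.
have m0 D : (0 < m D)%N.
  have [_ h1 h2] := mP D; case: (m D) h1 h2 => // _ h2; case: h2 => x /= [q [y [Qq -> ->]]].
  by rewrite gmulg1; exact: (QU D).
have Q1 : F [set D | Q D gid] by apply: filterE => D; exact: slow_gid.
have sQ : F [set D | sym (Q D)] by apply: filterE => D; exact: slow_sym.
have Fm : F [set D | (0 < m D)%N] by apply: filterE.
have tr := @trapped R L U K nat F Q m cU sU cK sK KU UK _ Q1 sQ Fm.
have {}tr : forall D, F [set i | spow (Q i) (D * m i) `<=` spow U 4].
  apply: tr; first by apply: filterE => D; have [] := mP D.
  move=> W j KW; have [N N0 NW] := slow_small KW.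
  apply: filterS (Fn (j * N)%N) => D /= le q s Qq sj; apply: NW.
  apply: slow_pw Qq _; have [lt _ _] := mP D.
  apply: (@leq_trans (j * m D * N)); first by rewrite leq_mul2r sj orbT.
  by rewrite mulnAC leq_mul // ltnW.
have Fex : F [set i | ~ spow (Q i) (m i).+1 `<=` U] by apply: filterE => D; have [] := mP D.
have [p Ep np] := limgrp_exit UF Q1 cU4 tr Fm Fex.
apply: np; apply: KU; apply: (iso (limgrp_subgrp UF m sQ)) => //.
by apply: limgrp_sub => //; exact: compact_closedL.
Qed.

(** The quasi-triangle inequality for inverse escape times: [(x y)^s] is a product of [2 s] slow
    elements. *)
Lemma slow_mul : exists2 D, (0 < D)%N & forall n x y, (0 < n)%N ->
  slow (D * n) x -> slow (D * n) y -> slow n (x ∙ y).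
Proof.
have [D D0 DP] := slow_product; exists (D * 2)%N; first by rewrite muln_gt0 D0.
move=> n x y n0; rewrite -mulnA => sx sy s le.
have sxy : spow (slow (D * (2 * n))) (2 * s) ((x ∙ y) ^^ s).
  elim: s {le} => [|s IH]; first by rewrite muln0.
  rewrite mulnS; apply: (@spowD L _ 2); last exact: IH.
  by apply: spowS => //; exact: spow1.
apply: (DP (2 * n)%N); first by rewrite muln_gt0.
by apply: spow_le sxy; [exact: slow_gid|rewrite leq_mul2l le orbT].
Qed.

(* Two elements whose [n/c]-th powers are close have, up to a factor [J], a quotient
   much slower than themselves: Gleason's function is nearly linear along them. *)
Lemma slow_tangent J : (0 < J)%N -> exists (N0 c : nat) (W : set L),
  [/\ (0 < c)%N, (forall k, K k -> nbhs k W) & forall n y y', (N0 <= n)%N ->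
      slow n y -> slow n y' -> W ((y ^^ (n %/ c))⁻¹ ∙ y' ^^ (n %/ c)) ->
      slow (J * n) (y'⁻¹ ∙ y)].
Proof.
move=> J0; have [D D0 DP] := slow_product; have [j j0 jP] := slow4.
(* The exponent is 5 because the telescoping starts at [y' x] with [x] in [U^4]. *)
have [m0 [M [W [m00 M0 WP G]]]] := gleason R 5 cU sU cK sK KU UK.
pose J' := (j * J)%N.
have J'0 : (0 < J'%:R :> R)%R by rewrite ltr0n muln_gt0 j0.
have D0' : (0 < D%:R :> R)%R by rewrite ltr0n.
(* Below, [n <= 2 D mm] and [n <= 2 c k]. The constants [e] and [e'] make the telescoping error and
   the closeness error each at most half of [k dl / n], where [J' n] steps of size [dl / n] add up
   to [m0 / 2]. *)
pose e := (m0 / (16 * D%:R * M * J'%:R))%R.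
have e0 : (0 < e)%R by rewrite divr_gt0 // !mulr_gt0.
have [sWe nWe] := WP e e0.
have [c c0 cW] := slow_small nWe.
have c0' : (0 < c%:R :> R)%R by rewrite ltr0n.
pose e' := (m0 / (8 * c%:R * M * J'%:R))%R.
have e'0 : (0 < e')%R by rewrite divr_gt0 // !mulr_gt0.
have [sWe' nWe'] := WP e' e'0.
exists (D + c)%N, c, (W e'); split=> // n y y' nN sy sy' hW.
have n0 : (0 < n)%N by apply: leq_trans nN; rewrite addn_gt0 D0.
have n0' : (0 < n%:R :> R)%R by rewrite ltr0n.
pose mm := (n %/ D)%N; pose k := (n %/ c)%N.
have Dn : (D <= n)%N by apply: leq_trans nN; exact: leq_addr.
have cn : (c <= n)%N by apply: leq_trans nN; exact: leq_addl.
have half d : (0 < d)%N -> (d <= n)%N -> (0 < n %/ d)%N /\ (n <= 2 * d * (n %/ d))%N.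
  move=> d0 dn; have q0 : (0 < n %/ d)%N by rewrite divn_gt0.
  split=> //; have := ltn_ceil n d0; nia.
have [mm0 mmn] := half D D0 Dn; have [k0 kn] := half c c0 cn.
rewrite -/mm in mm0 mmn; rewrite -/k in k0 kn hW.
pose Q := slow (D * mm).
have leQ : slow n `<=` Q by apply: slow_le; rewrite mulnC leq_divM.
have QU : spow Q mm `<=` U by exact: DP.
have [phi [p1 pU pM p3 p2]] := G Q mm (@slow_gid (D * mm)) (@slow_sym (D * mm)) mm0 QU.
have mm0' : (0 < mm%:R :> R)%R by rewrite ltr0n.
have k0' : (0 < k%:R :> R)%R by rewrite ltr0n.
have Uy' : U y' by exact: slow_sub sy'.
pose w := y'⁻¹ ∙ y.
pose dl := (m0 / (2 * J'%:R))%R.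
have dl0 : (0 < dl)%R by rewrite divr_gt0 // mulr_gt0.
have tel a z : slow n a -> spow U 5 z ->
    (`|phi ((a ^^ k)⁻¹ ∙ z) - phi z - k%:R * (phi (a⁻¹ ∙ z) - phi z)| <= k%:R * (M * e / mm%:R))%R.
  move=> sa Uz; apply: telescope_diff => s sk; apply: p2 => //; first exact: leQ.
  apply: cW; apply: slow_pw sa _.
  apply: (@leq_trans (k * c)); first by rewrite leq_mul2r (ltnW sk) orbT.
  exact: leq_divM.
have step x : spow U 4 x -> (`|phi (w⁻¹ ∙ x) - phi x| <= dl / n%:R)%R.
  move=> Ux; pose z := y' ∙ x.
  have Uz : spow U 5 z by exact: spowS.
  have t1 := tel y z sy Uz; have t2 := tel y' z sy' Uz.
  have close : (`|phi ((y ^^ k)⁻¹ ∙ z) - phi ((y' ^^ k)⁻¹ ∙ z)| <= M * e')%R.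
    have := p3 e' _ ((y' ^^ k)⁻¹ ∙ z) e'0 hW.
    by rewrite !gmulA gmulgK.
  have dE : (phi (w⁻¹ ∙ x) - phi x = (phi (y⁻¹ ∙ z) - phi z) - (phi (y'⁻¹ ∙ z) - phi z))%R.
    have -> : y'⁻¹ ∙ z = x by rewrite /z; gsimp.
    have -> : w⁻¹ ∙ x = y⁻¹ ∙ z by rewrite /w /z; gsimp.
    by lra.
  have kd : (k%:R * `|phi (w⁻¹ ∙ x) - phi x| <= M * e' + 2 * (k%:R * (M * e / mm%:R)))%R.
    rewrite -[(k%:R)%R in leLHS]ger0_norm // -normrM dE mulrBr.
    set A := phi ((y ^^ k)⁻¹ ∙ z) in t1 close; set B := phi ((y' ^^ k)⁻¹ ∙ z) in t2 close.
    set d1 := (k%:R * _)%R in t1 *; set d2 := (k%:R * _)%R in t2 *.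
    have -> : (d1 - d2 = (A - B) - (A - phi z - d1) + (B - phi z - d2))%R by lra.
    apply: le_trans (ler_normD _ _) _.
    apply: (@le_trans _ _ (M * e' + k%:R * (M * e / mm%:R) + k%:R * (M * e / mm%:R)))%R; last by lra.
    apply: lerD => //; apply: le_trans (ler_normB _ _) _; exact: lerD.
  have kn' : (n%:R <= 2 * c%:R * k%:R :> R)%R by rewrite -!natrM ler_nat.
  have mmn' : (n%:R <= 2 * D%:R * mm%:R :> R)%R by rewrite -!natrM ler_nat.
  rewrite -(ler_pM2l k0'); apply: le_trans kd _.
  have q1 : (M * e' <= k%:R * (dl / n%:R) / 2)%R.
    rewrite -(ler_pM2r n0').
    have -> : (k%:R * (dl / n%:R) / 2 * n%:R = k%:R * dl / 2)%R by field; rewrite gt_eqF.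
    apply: (@le_trans _ _ (M * e' * (2 * c%:R * k%:R)))%R.
      by apply: ler_wpM2l => //; rewrite mulr_ge0 // ltW.
    rewrite le_eqVlt; apply/orP; left; apply/eqP.
    by rewrite /e' /dl; field; rewrite !gt_eqF.
  have q2 : (2 * (k%:R * (M * e / mm%:R)) <= k%:R * (dl / n%:R) / 2)%R.
    rewrite -(ler_pM2r n0').
    have -> : (k%:R * (dl / n%:R) / 2 * n%:R = k%:R * dl / 2)%R by field; rewrite gt_eqF.
    apply: (@le_trans _ _ (2 * (k%:R * (M * e / mm%:R)) * (2 * D%:R * mm%:R)))%R.
      apply: ler_wpM2l => //; apply: ltW; apply: mulr_gt0 => //; apply: mulr_gt0 => //.
      by apply: divr_gt0 => //; exact: mulr_gt0.
    rewrite le_eqVlt; apply/orP; left; apply/eqP.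
    by rewrite /e /dl; field; rewrite !gt_eqF.
  by lra.
have main t : (t <= J' * n)%N ->
    spow U 4 (w ^^ t)⁻¹ /\ (m0 - t%:R * (dl / n%:R) <= phi (w ^^ t)⁻¹)%R.
  elim: t => [|t IH] tJ.
    rewrite mul0r subr0 /= ginv1; split=> //.
    by apply: pU; rewrite gt_eqF // (lt_le_trans m00).
  have [Ut pt] := IH (ltnW tJ).
  have := step _ Ut; rewrite -ginvM -pwSr => /ler_normlP[h1 _].
  have ge : (m0 - t.+1%:R * (dl / n%:R) <= phi (w ^^ t.+1)⁻¹)%R.
    by rewrite -natr1 mulrDl mul1r; lra.
  split=> //; apply: pU; rewrite gt_eqF //; apply: lt_le_trans ge.
  rewrite subr_gt0; apply: (@le_lt_trans _ _ ((J' * n)%:R * (dl / n%:R))%R).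
    by rewrite ler_wpM2r ?ler_nat // divr_ge0 // ltW.
  have -> : ((J' * n)%:R * (dl / n%:R) = m0 / 2)%R.
    by rewrite natrM /dl; field; rewrite !gt_eqF.
  by lra.
apply: jP => i le; rewrite -[w ^^ i]ginvK; apply: sU4; apply: (main i _).1.
by rewrite /J' -mulnA.
Qed.

(** Commutators of [U] with [K] lie in [K], so for [b] near [K] the powers of [y] and of its
    conjugate are close modulo [K], and [slow_tangent] applies. The conjugate has powers in [U^4]
    only; [slow4] makes it slow at scale [n / j], a loss repaid by the factor [2 * j]. *)
Lemma slow_commutator J : (0 < J)%N -> exists (N0 : nat) (V : set L),
  (forall k, K k -> nbhs k V) /\ forall n b y, (N0 <= n)%N -> V b -> slow n y ->
    slow (J * n) ((b⁻¹ ∙ y ∙ b)⁻¹ ∙ y).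
Proof.
move=> J0; have [j j0 jP] := slow4.
have [|N1 [c [W [c0 nW P]]]] := @slow_tangent (2 * j * J); first by rewrite !muln_gt0 j0.
have [|[u k] [Uu Kk]|W' nW' W'P] := @tube L (L * L)%type L
    (fun p => p.2.1⁻¹ ∙ (p.1 ∙ p.2.2)⁻¹ ∙ p.2.1 ∙ (p.1 ∙ p.2.2)) (U `*` K) W _ (compact_setX cU cK).
- have c1 : continuous (fun p : L * (L * L) => p.2.1).
    by move=> p; apply: (@continuous_comp _ _ _ snd fst); [exact: cvg_snd|exact: cvg_fst].
  have c2 : continuous (fun p : L * (L * L) => p.2.2).
    by move=> p; apply: (@continuous_comp _ _ _ snd snd); exact: cvg_snd.
  by repeat (first [exact: c1|exact: c2|exact: continuous_fst_fun|apply: continuous_gmul|apply: continuous_ginv]).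
- rewrite /= !gmul1g; apply: nW; apply: subgrpM => //; apply: UK => //.
  exact: subgrpV.
exists (j * N1.+1)%N, (U `&` [set b | exists w k, [/\ W' w, K k & b = w ∙ k]]).
split.
  move=> k Kk; apply: filterI; first exact: KU.
  apply: filterS (nbhs_translate k nW') => y /= Wy.
  by exists (y ∙ k⁻¹), k; split=> //; gsimp.
move=> n b y nN [Ub [w [k [Ww Kk bE]]]] sy.
pose N := (n %/ j)%N.
have NN : (N1.+1 <= N)%N by rewrite /N leq_divRL // mulnC.
have N0 : (0 < N)%N by exact: leq_ltn_trans NN.
have Nn : (j * N <= n)%N by rewrite mulnC leq_divM.
have nj : (n <= 2 * j * N)%N by have := ltn_ceil n j0; rewrite -/N; nia.
have nlt : (J * n <= 2 * j * J * N)%N.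
  have -> : (2 * j * J * N = J * (2 * j * N))%N by lia.
  by rewrite leq_mul2l nj orbT.
apply: slow_le nlt _ _; apply: P; first exact: ltnW.
- by apply: slow_le sy; rewrite (leq_trans _ Nn) // leq_pmull.
- apply: jP => i le; rewrite pw_conj.
  have Ui : U (y ^^ i) by apply: sy; exact: leq_trans Nn.
  rewrite -[_ ∙ b]gmulg1; apply: spow4 => //; exact: sU.
- rewrite pw_conj bE !gmulA -[_ ∙ w ∙ k]gmulA.
  have := W'P w (y ^^ (N %/ c), k) Ww; rewrite /= => h.
  have : W ((y ^^ (N %/ c))⁻¹ ∙ (w ∙ k)⁻¹ ∙ y ^^ (N %/ c) ∙ (w ∙ k)).
    apply: h; split=> //; apply: sy; apply: leq_trans (leq_div _ _) _.
    by rewrite (leq_trans _ Nn) // leq_pmull.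
  by rewrite !gmulA.
Qed.

(** * One-parameter semigroups as limits of accelerated powers *)

Fixpoint inl (T : Type) (x : T) (l : seq T) : Prop :=
  if l is y :: l' then x = y \/ inl x l' else False.

Lemma inl_cat (T : Type) (x : T) l l' : inl x (l ++ l') <-> inl x l \/ inl x l'.
Proof. by elim: l => [|y l IH] /=; [split=> [|[]]; auto|rewrite IH; tauto]. Qed.

(* continuity is not required *)
Definition flow (X : R -> L) :=
  (forall t s : R, 0 <= t -> 0 <= s -> X (t + s) = X t ∙ X s)%R /\
  forall t : R, (0 <= t <= 1)%R -> U (X t).

Lemma flow_mul X n (t : R) : flow X -> (0 <= t)%R -> X (n%:R * t)%R = X t ^^ n.
Proof.
move=> [XD _] t0; elim: n => [|n IH].
  rewrite mul0r; have := XD 0%R 0%R (lexx _) (lexx _); rewrite addr0 => e.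
  by apply: (@gmulIg _ _ _ (X 0%R)); rewrite -e /= gmul1g.
by rewrite -natr1 mulrDl mul1r XD ?mulr_ge0 // IH pwSr.
Qed.

Lemma flow_slow X n (t : R) : flow X -> (0 <= t)%R -> (n%:R * t <= 1)%R -> slow n (X t).
Proof.
move=> fX t0 nt i le; rewrite -flow_mul //; apply: fX.2; rewrite mulr_ge0 //=.
by apply: le_trans nt; rewrite ler_wpM2r // ler_nat.
Qed.

(** Powers [v^k] with [k] at most [T n] are products of at most [T + 1] elements of [U], so
    ultralimits exist. The truncations of [t n], [s n] and [(t + s) n] are additive up to one step,
    and that step disappears since [v] tends to the identity. *)
Lemma limit_flow (I : Type) (F : set_system I) (n : I -> nat) (v : I -> L) :
  UltraFilter F -> F [set i | (0 < n i)%N] -> v @ F --> (gid : L) ->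
  F [set i | slow (n i) (v i)] ->
  exists2 X, flow X & forall t : R, (0 <= t)%R ->
    (fun i => v i ^^ Num.truncn (t * (n i)%:R)%R) @ F --> X t.
Proof.
move=> UF Fn v1 Fs.
have /choice [X XP] : forall t : R, exists x : L, (0 <= t)%R ->
    (fun i => v i ^^ Num.truncn (t * (n i)%:R)%R) @ F --> x.
  move=> t; have [t0|_] := lerP 0%R t; last by exists gid.
  pose T := (Num.truncn t).+1.
  have [|x _ xP] := ultra_lim (x := fun i => v i ^^ Num.truncn (t * (n i)%:R)%R) UF
     (@compact_spow L U T.+1 cU); last by exists x.
  apply: filterS2 Fn Fs => i n0 si; rewrite /mkset; set k := Num.truncn (t * (n i)%:R)%R.
  have kT : (k <= T * n i)%N.
    have : (k%:R <= t * (n i)%:R)%R by rewrite /k truncn_le mulr_ge0.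
    move=> le; rewrite -(ler_nat R) natrM; apply: le_trans le _.
    by rewrite ler_wpM2r // ltW // truncnS_gt.
  rewrite (divn_eq k (n i)) pwD mulnC pwM.
  have q : (k %/ n i <= T)%N by rewrite -(mulnK T n0) leq_div2r.
  have s1 : spow U (k %/ n i) ((v i ^^ n i) ^^ (k %/ n i)) by apply: spow_pw; exact: si.
  apply: (@spow_le L U (k %/ n i + 1)) => //; first by rewrite addn1 ltnS.
  by apply: spowD => //; apply: spow1; apply: si; rewrite ltnW // ltn_mod.
exists X => //; split.
- move=> t s t0 s0.
  pose e i := (Num.truncn ((t + s) * (n i)%:R)%R -
    (Num.truncn (t * (n i)%:R)%R + Num.truncn (s * (n i)%:R)%R))%N.
  have eP i : (Num.truncn ((t + s) * (n i)%:R)%R = Num.truncn (t * (n i)%:R)%R + Num.truncn (s * (n i)%:R)%R + e i)%N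
      /\ (e i <= 1)%N.
    have /andP[a1 a2] := truncn_itv (mulr_ge0 t0 (ler0n R (n i))).
    have /andP[b1 b2] := truncn_itv (mulr_ge0 s0 (ler0n R (n i))).
    have /andP[c1 c2] := truncn_itv (mulr_ge0 (addr_ge0 t0 s0) (ler0n R (n i))).
    rewrite /e; set A := Num.truncn (t * _)%R in a1 a2 *; set B := Num.truncn (s * _)%R in b1 b2 *.
    set C := Num.truncn _ in c1 c2 *.
    have h1 : (A + B < C.+1)%N by rewrite -(ltr_nat R) natrD; lra.
    have h2 : (C < A + B + 2)%N.
      by rewrite -(ltr_nat R) !natrD; rewrite -!natr1 in a2 b2; lra.
    by split; lia.
  have lim1 : (fun i => v i ^^ e i) @ F --> (gid : L).
    move=> O nO; have O1 := nbhs_singleton nO.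
    have Ov : F [set i | O (v i)] by exact: v1.
    change (F [set i | O (v i ^^ e i)]).
    apply: filterS Ov => i Oi; rewrite /mkset; have [_] := eP i.
    by case: (e i) => [//|[|//]] _; rewrite pw1.
  apply: (lim_unique _ (XP _ (addr_ge0 t0 s0))).
  have lim2 := cvg_gmul (cvg_gmul (XP t t0) (XP s s0)) lim1; rewrite gmulg1 in lim2.
  rewrite (_ : (fun i => _) = (fun i => v i ^^ Num.truncn (t * (n i)%:R)%R ∙
    v i ^^ Num.truncn (s * (n i)%:R)%R ∙ v i ^^ e i)).
    exact: lim2.
  by apply/funext => i; rewrite (eP i).1 !pwD.
- move=> t /andP[t0 t1]; apply: (lim_closed _ clU _ (XP t t0)).
  apply: filterS Fs => i si; apply: si.
  have : ((Num.truncn (t * (n i)%:R))%:R <= t * (n i)%:R)%R by rewrite truncn_le mulr_ge0.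
  by move=> le; rewrite -(ler_nat R); apply: le_trans le _; rewrite ler_piMl.
Qed.

(** If no finite list sufficed, pick a counterexample for each finite list and each bound. Along an
    ultrafilter on these pairs the accelerated counterexamples converge to a flow that eventually
    belongs to the list, and at time [1/n] it approximates them by [slow_tangent]. *)
Lemma slow_flow J : (0 < J)%N -> exists (N0 : nat) (l : seq (R -> L)),
  (forall X, inl X l -> flow X) /\ forall n c, (N0 <= n)%N -> slow n c ->
    exists X (s : R), [/\ inl X l, (0 <= s)%R, (s <= n%:R^-1)%R & slow (J * n) ((X s)⁻¹ ∙ c)].
Proof.
move=> J0; apply: contrapT => no.
pose T := {l : seq (R -> L) | forall X, inl X l -> flow X}.
have nilP : forall X : R -> L, inl X [::] -> flow X by [].
pose nilT : T := exist _ [::] nilP.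
have /choice [nc ncP] : forall i : T * nat, exists nc : nat * L, [/\ (i.2 < nc.1)%N, slow nc.1 nc.2 &
    forall X (s : R), inl X (proj1_sig i.1) -> (0 <= s)%R -> (s <= nc.1%:R^-1)%R ->
      ~ slow (J * nc.1) ((X s)⁻¹ ∙ nc.2)].
  move=> [[l lP] N]; apply: contrapT => h; apply: no; exists N.+1, l; split=> // n c nN sc.
  apply: contrapT => h'; apply: h; exists (n, c); split=> // X s Xl s0 sn sl.
  by apply: h'; exists X, s.
have [||[[l lP] N] [[l' lP'] N']|F [UF FT]] := @directed_ultra (T * nat)%type
    (fun i j => (forall X, inl X (proj1_sig i.1) -> inl X (proj1_sig j.1)) /\ (i.2 <= j.2)%N)
    (nilT, 0%N).
- by [].
- by move=> i j k [h1 h2] [h3 h4]; split; [move=> X /h1 /h3|exact: leq_trans h4].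
- have lP2 : forall X, inl X (l ++ l') -> flow X by move=> X /inl_cat[/lP|/lP'].
  exists (exist _ (l ++ l') lP2, maxn N N'); split; split=> /=; rewrite ?leq_maxl ?leq_maxr //.
    by move=> X Xl; apply/inl_cat; left.
  by move=> X Xl; apply/inl_cat; right.
pose n i := (nc i).1; pose c i := (nc i).2.
have Fn N : F [set i | (N < n i)%N].
  apply: filterS (FT (nilT, N)) => i [_ /= le].
  by have [lt _ _] := ncP i; exact: leq_ltn_trans le lt.
have sc i : slow (n i) (c i) by have [] := ncP i.
have n0 i : (0 < n i)%N by have [lt _ _] := ncP i; exact: leq_ltn_trans lt.
have [|ka _ cka] := ultra_lim (x := c) UF cU; first by apply: filterE => i; exact: slow_sub (sc i).
have Kka : K ka.
  apply: all_slow => N; apply: (lim_closed _ (@slow_closed N) _ cka).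
  by apply: filterS (Fn N) => i /= lt; apply: slow_le (sc i); exact: ltnW.
(* Dividing by the limit [ka] in [K] makes the sequence tend to the identity without changing
   slowness. *)
pose v i := c i ∙ ka⁻¹.
have v1 : v @ F --> (gid : L).
  rewrite -(gmulgV ka); apply: cvg_gmul => //; exact: cvg_cst.
have sv i : slow (n i) (v i) by apply: slow_mulK => //; exact: subgrpV.
have Fn0 : F [set i | (0 < n i)%N] by apply: filterE.
have Fsv : F [set i | slow (n i) (v i)] by apply: filterE.
have [X fX XP] := limit_flow UF Fn0 v1 Fsv.
have [N0 [d [W [d0 nW P]]]] := slow_tangent J0.
have [W0 nW0 W0P] := nbhs_of_compact cK nW.
have [W1 [nW1 _ W1P]] := nbhs_split nW0.
have nV k : K k -> nbhs k [set b : L | exists w k, [/\ W1 w, K k & b = w ∙ k]].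
  move=> Kk; apply: filterS (nbhs_translate k nW1) => y /= Wy.
  by exists (y ∙ k⁻¹), k; split=> //; gsimp.
have [N2 N20 N2P] := slow_small nV.
have d0' : (0 < d%:R :> R)%R by rewrite ltr0n.
have td0 : (0 <= d%:R^-1 :> R)%R by rewrite invr_ge0 ltW.
pose td : R := (d%:R^-1)%R.
have lim1 : (fun i => (v i ^^ Num.truncn (td * (n i)%:R)%R)⁻¹ ∙ X td) @ F --> (X td)⁻¹ ∙ X td.
  by apply: cvg_gmul; [apply: cvg_ginv; exact: XP|exact: cvg_cst].
rewrite gmulVg in lim1.
have FX : F [set i | inl X (proj1_sig i.1)].
  have lX : forall Y, inl Y [:: X] -> flow Y by move=> Y [->|].
  by apply: filterS (FT (exist _ [:: X] lX, 0%N)) => i [h _]; apply: h; left.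
have F1 : F [set i | W1 ((v i ^^ Num.truncn (td * (n i)%:R)%R)⁻¹ ∙ X td)] by exact: lim1.
have [i [[h1 h2] [h3 h4]]] := filter_ex (filterI (filterI FX F1) (filterI (Fn N0) (Fn N2))).
rewrite /= in h1 h2 h3 h4.
have ni0 : (0 < (n i)%:R :> R)%R by rewrite ltr0n.
pose p := X (n i)%:R^-1%R.
have ni1 : (0 <= (n i)%:R^-1 :> R)%R by rewrite invr_ge0 ltW.
have [_ _ bad] := ncP i; apply: (bad X (n i)%:R^-1%R h1 ni1 (lexx _)).
have e1 : ((n i)%:R * (n i)%:R^-1 <= 1 :> R)%R by rewrite mulfV // gt_eqF.
have sp : slow (n i) p := flow_slow fX ni1 e1.
have -> : (X (n i)%:R^-1%R)⁻¹ ∙ (nc i).2 = (p⁻¹ ∙ v i) ∙ ka by rewrite /p /v; gsimp.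
apply: slow_mulK => //; first by rewrite muln_gt0 J0; exact: (n0 i).
apply: (P (n i) (v i) p (ltnW h3) (sv i) sp).
pose k := (n i %/ d)%N; change (W ((v i ^^ k)⁻¹ ∙ p ^^ k)).
have kE : Num.truncn (td * (n i)%:R)%R = k.
  apply: truncn_def; rewrite /td mulrC ler_pdivlMr // ltr_pdivrMr // -!natrM ler_nat ltr_nat.
  by rewrite leq_divM /= ltn_ceil.
rewrite kE in h2.
(* The part of [1/d] lost by truncation to multiples of [1/n]; as [n r <= 1], [X r] is near [K]. *)
pose r : R := (td - k%:R * (n i)%:R^-1)%R.
have kn : (k%:R * d%:R <= (n i)%:R :> R)%R by rewrite -natrM ler_nat leq_divM.
have kn2 : ((n i)%:R < k.+1%:R * d%:R :> R)%R by rewrite -natrM ltr_nat ltn_ceil.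
have rE : ((n i)%:R * r = (n i)%:R / d%:R - k%:R)%R.
  by rewrite /r /td; field; rewrite !gt_eqF.
have r0 : (0 <= r)%R.
  by rewrite -(pmulr_rge0 _ ni0) rE subr_ge0 ler_pdivlMr.
have r1 : ((n i)%:R * r <= 1)%R.
  by rewrite rE lerBlDr addrC natr1 ler_pdivrMr // ltW.
have XE : X td = p ^^ k ∙ X r.
  have kp : (0 <= k%:R * (n i)%:R^-1 :> R)%R by rewrite mulr_ge0.
  rewrite -(flow_mul k fX ni1) -(fX.1 _ _ kp r0); congr X.
  by rewrite /r addrC subrK.
have [w [l [W1w Kl XrE]]] : [set b : L | exists w k, [/\ W1 w, K k & b = w ∙ k]] (X r)⁻¹.
  apply: N2P; apply: slow_sym; apply: flow_slow => //.
  by apply: le_trans r1; rewrite ler_wpM2r // ler_nat ltnW.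
have -> : (v i ^^ k)⁻¹ ∙ p ^^ k = ((v i ^^ k)⁻¹ ∙ X td ∙ w) ∙ l.
  by rewrite -gmulA -XrE XE; gsimp.
by apply: W0P => //; exact: W1P.
Qed.

End EscapeTimes.

(** * A neighbourhood covered by products of flows *)

Section FlowProducts.
Variables (R : realType) (L : lcGroup) (U K : set L).
Hypotheses (cU : compact U) (sU : sym U)
  (KUK : forall k u k', K k -> U u -> K k' -> U (k ∙ u ∙ k'))
  (cK : compact K) (sK : subgrp K) (KU : forall k, K k -> nbhs k U)
  (UK : forall u k, U u -> K k -> K (u⁻¹ ∙ k ∙ u))
  (iso : forall D, subgrp D -> D `<=` spow U 4 -> D `<=` K).
Local Notation slow := (slow U).
Local Notation flow := (@flow R L U).

Fixpoint pflow (l : seq (R -> L)) (t : nat -> R) : L :=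
  if l is X :: l' then X (t 0%N) ∙ pflow l' (fun i => t i.+1) else gid.

Lemma pflow0 l : (forall X, inl X l -> flow X) -> pflow l (fun=> 0%R) = gid.
Proof.
elim: l => //= X l IH lP; rewrite IH; last by move=> Y Yl; apply: lP; right.
have fX : flow X by apply: lP; left.
by have := flow_mul 0 fX (lexx 0%R); rewrite mul0r gmulg1.
Qed.

Lemma pflow_spow l t M (tau : R) : (forall X, inl X l -> flow X) ->
  (forall i, 0 <= t i <= tau)%R -> (M%:R * tau <= 1)%R -> spow (slow M) (size l) (pflow l t).
Proof.
elim: l t => //= X l IH t lP tP Mt; exists (X (t 0%N)), (pflow l (fun i => t i.+1)); split=> //.
  have /andP[t0 t1] := tP 0%N; apply: flow_slow => //.
    by apply: lP; left.
  by apply: le_trans Mt; rewrite ler_wpM2l.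
by apply: IH => // Y Yl; apply: lP; right.
Qed.

(** A correction by [X s] is absorbed into the time of [X], so the list of flows never grows. The
    price is that [X s] lands before the tail [B]; [B] is a product of slow elements, to keep the
    resulting commutator under control. *)
Lemma pflow_update l t (tau s : R) X M : (forall Y, inl Y l -> flow Y) -> inl X l ->
  (forall i, 0 <= t i <= tau)%R -> (0 <= s)%R -> (M%:R * tau <= 1)%R ->
  exists (t' : nat -> R) (A B : L), [/\ (forall i, 0 <= t' i <= tau + s)%R,
    pflow l t = A ∙ B, pflow l t' = A ∙ X s ∙ B & spow (slow M) (size l) B].
Proof.
elim: l t => //= Y l IH t lP Xl tP s0 Mt.
have lP' : forall Z, inl Z l -> flow Z by move=> Z Zl; apply: lP; right.
have fY : flow Y by apply: lP; left.
have s1 : slow M gid.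
  by move=> i _; rewrite pw_gid; apply: nbhs_singleton; apply: KU; exact: subgrp1.
case: Xl => [->|Xl].
  exists (fun i => if i is 0 then t 0%N + s else t i)%R, (Y (t 0%N)), (pflow l (fun i => t i.+1)).
  have /andP[t0 t1] := tP 0%N; split=> //=.
  - move=> [|i]; first by apply/andP; split; lra.
    by have /andP[a b] := tP i.+1; apply/andP; split; lra.
  - by rewrite fY.1.
  - exists gid, (pflow l (fun i => t i.+1)); split=> //; last by rewrite gmul1g.
    by apply: (@pflow_spow _ _ _ tau).
have [t' [A [B [t'P e1 e2 sB]]]] := IH (fun i => t i.+1) lP' Xl (fun i => tP i.+1) s0 Mt.
exists (fun i => if i is j.+1 then t' j else t 0%N), (Y (t 0%N) ∙ A), B; split=> /=.
- move=> [|i]; last exact: t'P.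
  by have /andP[a b] := tP 0%N; apply/andP; split; lra.
- by rewrite e1 gmulA.
- by rewrite e2 !gmulA.
- by exists gid, B; split=> //; rewrite gmul1g.
Qed.

Section Near.
Variables (F : set_system nat) (UF : UltraFilter F).

(** Convergence to the identity modulo [K]. *)
Let nearK (x : nat -> L) := forall W, (forall k, K k -> nbhs k W) -> F [set r | W (x r)].

Lemma nearK_mul x y : nearK x -> nearK y -> nearK (fun r => x r ∙ y r).
Proof.
move=> nx ny W nW; have [V [_ _ nV _ VW]] := thicken 2 cK sK nW.
apply: filterS2 (nx V nV) (ny V nV) => r hx hy; apply: VW.
by apply: spowS => //; exact: spow1.
Qed.

Lemma nearK_conj x g : (forall k, K k -> K (g⁻¹ ∙ k ∙ g)) -> nearK x ->
  nearK (fun r => g⁻¹ ∙ x r ∙ g).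
Proof.
move=> gK nx W nW; apply: (nx [set z | W (g⁻¹ ∙ z ∙ g)]) => k Kk.
apply: (@nbhs_preimage _ _ (fun z => g⁻¹ ∙ z ∙ g)); first gcont.
by apply: nW; exact: gK.
Qed.

Lemma nearK_slow x : (forall m, F [set r | slow m (x r)]) -> nearK x.
Proof.
move=> nx W nW.
have [m _ mW] := slow_small cU sU sK KU iso nW.
by apply: filterS (nx m) => r /mW.
Qed.

Lemma nearK_pflow l (t : nat -> nat -> R) (t' : nat -> R) : (forall X, inl X l -> flow X) ->
  (forall r i, 0 <= t r i <= 1)%R -> (forall i, (t^~ i) @ F --> t' i) ->
  (forall i, 0 <= t' i <= 1)%R -> nearK (fun r => (pflow l t')⁻¹ ∙ pflow l (t r)).
Proof.
elim: l t t' => [|X l IH] t t' lP tP tt' t'P /=.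
  by move=> W nW; apply: filterE => r; rewrite /mkset ginv1 gmul1g; exact: (nbhs_singleton (nW gid (subgrp1 sK))).
have lP' : forall Z, inl Z l -> flow Z by move=> Z Zl; apply: lP; right.
have fX : flow X by apply: lP; left.
have := IH (fun r i => t r i.+1) (fun i => t' i.+1) lP' (fun r i => tP r i.+1)
  (fun i => tt' i.+1) (fun i => t'P i.+1).
set P' := pflow l (fun i => t' i.+1); pose q r := (X (t' 0%N))⁻¹ ∙ X (t r 0%N) => nP.
have nq : nearK q.
  apply: nearK_slow => m.
  have e0 : (0 < m.+1%:R^-1 :> R)%R by rewrite invr_gt0 ltr0n.
  have /(@cvgrPdist_le R R^o) /(_ _ e0) := tt' 0%N; apply: filterS => r /= le.
  have /andP[a0 a1] := tP r 0%N; have /andP[b0 b1] := t'P 0%N.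
  have small (d : R) : (0 <= d)%R -> (d <= m.+1%:R^-1)%R -> slow m (X d).
    move=> d0 dm; apply: flow_slow => //.
    apply: (@le_trans _ _ (m.+1%:R * d)%R); first by rewrite ler_wpM2r // ler_nat.
    by rewrite -ler_pdivlMl ?ltr0n // mulr1.
  have [tr|/ltW tr] := leP (t r 0%N) (t' 0%N).
    have d0 : (0 <= t' 0%N - t r 0%N)%R by rewrite subr_ge0.
    have -> : q r = (X (t' 0%N - t r 0%N)%R)⁻¹.
      rewrite /q; have {1}-> : (t' 0%N = t r 0%N + (t' 0%N - t r 0%N))%R by lra.
      by rewrite fX.1 //; gsimp.
    by apply: (slow_sym sU); apply: small => //; move: le; rewrite ger0_norm.
  have d0 : (0 <= t r 0%N - t' 0%N)%R by rewrite subr_ge0.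
  have -> : q r = X (t r 0%N - t' 0%N)%R.
    rewrite /q; have {1}-> : (t r 0%N = t' 0%N + (t r 0%N - t' 0%N))%R by lra.
    by rewrite fX.1 //; gsimp.
  by apply: small => //; move: le; rewrite distrC ger0_norm.
have P'K k : K k -> K (P'⁻¹ ∙ k ∙ P').
  apply: (@normalizes_spow _ U _ (size l)) => //.
  have h : (1%:R * 1 <= 1 :> R)%R by rewrite mul1r.
  have := @pflow_spow l (fun i => t' i.+1) 1 1%R lP' (fun i => t'P i.+1) h.
  by apply: spowS_sub; exact: slow_sub.
have := nearK_mul (nearK_conj P'K nq) nP; congr nearK.
by apply/funext => r; rewrite /q; gsimp.
Qed.

End Near.

(** Each round doubles the escape time of the error. For the limiting times the error is slow at
    every scale, hence in [K], and [a] is reached exactly. *)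
Lemma flows_cover : exists (N : nat) (l : seq (R -> L)), (forall X, inl X l -> flow X) /\
  forall a, slow N a -> exists (t : nat -> R) (k : L),
    [/\ (forall i, 0 <= t i)%R, K k & a = pflow l t ∙ k].
Proof.
have [D D0 Dmul] := slow_mul R cU sU cK sK KU UK iso.
(* Both factors of the new error are slow at scale [2 D n], so [slow_mul] makes their product slow
   at [2 n]. *)
pose J := (D * 2)%N; have J0 : (0 < J)%N by rewrite muln_gt0 D0.
have [N1 [V [nV comm]]] := slow_commutator R cU sU cK sK KU UK iso J0.
have [N2 [l [lP approx]]] := slow_flow R cU sU KUK cK sK KU UK iso J0.
have [U' [_ _ nU' _ U'V]] := thicken (size l) cK sK nV.
have [M0 _ M0U] := slow_small cU sU sK KU iso nU'.
pose M := (M0 + N1 + N2).+1; pose N := (2 * M)%N.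
have N0 : (0 < N%:R :> R)%R by rewrite ltr0n.
have BV b : spow (slow M) (size l) b -> V b.
  move=> sb; apply: U'V; apply: spowS_sub sb => x sx; apply: M0U.
  by apply: (slow_le _ sx); rewrite /M; lia.
exists N, l; split=> // a sa.
(* The sum of [1/(2^i N)] over [i < r], a bound for each time after [r] rounds; [N = 2 M] gives
   [M * tau r <= 1]. *)
pose tau r : R := (2 / N%:R - 2 / (2 ^ r * N)%:R)%R.
have p0 r : (0 < (2 ^ r * N)%:R :> R)%R by rewrite ltr0n muln_gt0 expn_gt0.
have tauN r : (tau r <= 2 / N%:R)%R by rewrite /tau lerBlDr lerDl divr_ge0.
have step r : exists t : nat -> R, (forall i, 0 <= t i <= tau r)%R /\
    slow (2 ^ r * N) ((pflow l t)⁻¹ ∙ a).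
  elim: r => [|r [t [tP st]]].
    exists (fun=> 0%R); rewrite pflow0 // ginv1 gmul1g expn0 mul1n; split=> // i.
    by rewrite lexx /tau expn0 mul1n subrr lexx.
  set n := (2 ^ r * N)%N in st *; set c := _ ∙ a in st.
  have Nn : (N <= n)%N by rewrite /n leq_pmull // expn_gt0.
  have [|X [s [Xl s0 sn se]]] := approx n c _ st; first by apply: leq_trans Nn; rewrite /N /M; lia.
  have Mtau : (M%:R * tau r <= 1)%R.
    apply: (@le_trans _ _ (M%:R * (2 / N%:R))%R); first by rewrite ler_wpM2l.
    by rewrite [leLHS](_ : _ = 1%R) // /N natrM; field; rewrite pnatr_eq0.
  have [t' [A [B [t'P eA eB sB]]]] := pflow_update lP Xl tP s0 Mtau.
  exists t'; split.
    move=> i; have /andP[h1 h2] := t'P i; rewrite h1 /=; apply: le_trans h2 _.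
    have e2 : ((2 ^ r.+1 * N)%:R = 2 * n%:R :> R)%R by rewrite expnS -mulnA natrM.
    have n0 : (0 < n%:R :> R)%R by exact: p0.
    have -> : tau r.+1 = (tau r + n%:R^-1)%R.
      by rewrite /tau e2 -/n; field; rewrite !gt_eqF.
    by rewrite lerD2l.
  have sX : slow n (X s).
    apply: flow_slow => //; first exact: lP.
    by rewrite -ler_pdivlMl ?mulr1 //; exact: p0.
  (* The new error is the commutator of [X s] with the tail [B], times the error of the
     approximation of [c] by [X s]. *)
  have cE : (pflow l t')⁻¹ ∙ a = ((B⁻¹ ∙ X s ∙ B)⁻¹ ∙ X s) ∙ ((X s)⁻¹ ∙ c).
    by rewrite /c eA eB; gsimp.
  rewrite cE expnS -mulnA -/n; apply: Dmul; first by rewrite muln_gt0 (leq_trans _ Nn).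
    rewrite mulnA; apply: comm => //; last exact: BV.
    by apply: leq_trans Nn; rewrite /N /M; lia.
  by rewrite mulnA.
have [t tP] := choice step.
have [F [UF Fn]] := nat_ultra.
have t01 r i : (0 <= t r i <= 1)%R.
  have /andP[h1 h2] := (tP r).1 i; rewrite h1 /=; apply: le_trans h2 _.
  apply: le_trans (tauN r) _; rewrite ler_pdivrMr // mul1r ler_nat.
  by rewrite /N /M; lia.
have /choice [t' t'P] : forall i, exists p : R, (t^~ i) @ F --> p /\ (0 <= p <= 1)%R.
  move=> i; have [|p Pp tp] := @ultra_lim _ _ F `[(0 : R)%R, 1%R] (t^~ i) UF (@segment_compact _ _ _).
    by apply: filterE => r; rewrite /= in_itv /=; exact: t01.
  by exists p; split=> //; move: Pp; rewrite /= in_itv.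
exists t', ((pflow l t')⁻¹ ∙ a); split; last by gsimp.
  by move=> i; have [_ /andP[]] := t'P i.
have nn : forall W, (forall k, K k -> nbhs k W) ->
    F [set r | W (((pflow l t')⁻¹ ∙ pflow l (t r)) ∙ ((pflow l (t r))⁻¹ ∙ a))].
  apply: nearK_mul.
    by apply: nearK_pflow => // i; [exact: (t'P i).1|exact: (t'P i).2].
  apply: nearK_slow => // m; apply: filterS (Fn m) => r /= mr.
  apply: (slow_le _ (tP r).2); apply: leq_trans mr _.
  rewrite -[r in leqLHS]muln1; apply: leq_mul; last by rewrite /N /M; lia.
  by rewrite ltnW // ltn_expl.
apply: (all_slow sU sK KU iso) => m.
(* [slow_mulK] needs a positive index, hence [m.+1]. *)
have nm k : K k -> nbhs k (slow m.+1).
  move=> Kk; apply: filterS (nbhs_translate k (slow_nbhs sK KU m.+1)) => y /= sy.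
  rewrite -(gmulgVK y k); exact: (slow_mulK KUK sK UK).
have [r] := filter_ex (nn _ nm); rewrite /= !gmulA gmulgK => h.
by apply: (slow_le (leqnSn m)).
Qed.

End FlowProducts.

(** * Direct sums of cyclic groups *)

Section DirectSum.
Variable G : lcGroup.
Implicit Types (x y g : G) (B : set G).
Local Notation zpow := (@gzpow G gmul gid ginv).
Local Notation gprod := (@gprod G gmul gid).
Local Notation finord := (@has_finite_order G gmul gid).

Lemma zpow_sub x m n : zpow x (m%:Z - n%:Z)%R = x ^^ m ∙ (x ^^ n)⁻¹.
Proof.
have [le|/ltnW le] := leqP n m.
  rewrite subzn //; change (x ^^ (m - n) = x ^^ m ∙ (x ^^ n)⁻¹).
  by rewrite -{2}(subnK le) pwD gmulgK.
have -> : (m%:Z - n%:Z = - (n - m)%:Z)%R by rewrite -subzn // opprB.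
rewrite -{2}(subnKC le) pwD ginvM gmulA.
have -> : x ^^ m ∙ (x ^^ (n - m))⁻¹ ∙ (x ^^ m)⁻¹ = (x ^^ (n - m))⁻¹.
  rewrite -{2}[x ^^ (n - m)](gmulgK _ (x ^^ m)) -pwD addnC pwD; gsimp => //.
by case: (n - m)%N => [|k]; [rewrite /= ginv1|rewrite -NegzE].
Qed.

Lemma int_sub (a : int) : exists m n : nat, a = (m%:Z - n%:Z)%R.
Proof.
case: a => n; first by exists n, 0%N; rewrite subr0.
by exists 0%N, n.+1; rewrite NegzE sub0r.
Qed.

Lemma pw_comm x m n : x ^^ m ∙ x ^^ n = x ^^ n ∙ x ^^ m.
Proof. by rewrite -!pwD addnC. Qed.

Lemma pw_commV x m n : x ^^ m ∙ (x ^^ n)⁻¹ = (x ^^ n)⁻¹ ∙ x ^^ m.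
Proof. by apply: (@gmulIg _ _ _ (x ^^ n)); rewrite gmulgVK -gmulA pw_comm; gsimp. Qed.

Lemma zpowD x (a b : int) : zpow x (a + b)%R = zpow x a ∙ zpow x b.
Proof.
have [m [n ->]] := int_sub a; have [p [q ->]] := int_sub b.
have -> : (m%:Z - n%:Z + (p%:Z - q%:Z) = (m + p)%N%:Z - (n + q)%N%:Z)%R by rewrite !PoszD; lia.
have e : x ^^ (n + q) = x ^^ q ∙ x ^^ n by rewrite addnC pwD.
rewrite !zpow_sub pwD e gmulA -(gmulA (x ^^ m) (x ^^ n)⁻¹) -pw_commV.
by gsimp.
Qed.

Lemma zpowN x (a : int) : zpow x (- a)%R = (zpow x a)⁻¹.
Proof.
apply: (@gmulIg _ _ _ (zpow x a)); rewrite -zpowD addNr gmulVg.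
by have := zpow_sub x 0 0; rewrite subrr => ->; rewrite /= gmulgV.
Qed.

Lemma zpow_eq1 x (a : int) : zpow x a = gid -> a != 0%R -> finord x.
Proof.
case: a => n; first by case: n => // n e _; exists n.+1.
by move=> e _; exists n.+1 => //; rewrite -[LHS]ginvK -[RHS]ginv1; congr ginv; exact: e.
Qed.

Lemma zpow_finord x (a : int) : finord x -> finord (zpow x a).
Proof.
move=> [n n0 xn]; exists n => //.
have [p [q ->]] := int_sub a; rewrite zpow_sub.
have c : forall k, (x ^^ p ∙ (x ^^ q)⁻¹) ^^ k = x ^^ (p * k) ∙ (x ^^ (q * k))⁻¹.
  elim=> [|k IH]; first by rewrite !muln0 /= gmulgV.
  rewrite pwSr IH !mulnS [X in _ = x ^^ X ∙ _]addnC !pwD ginvM.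
  by rewrite -!gmulA; congr gmul; rewrite gmulA -pw_commV -!gmulA; congr gmul; rewrite -!ginvM -!pwD addnC.
have e : forall k, x ^^ (k * n) = gid by move=> k; rewrite mulnC pwM (_ : x ^^ n = gid) // pw_gid.
by change ((x ^^ p ∙ (x ^^ q)⁻¹) ^^ n = gid); rewrite c !e gmulgV.
Qed.

Section Abelian.
Variable B : set G.
Hypotheses (sB : subgrp B) (cB : forall x y, B x -> B y -> x ∙ y = y ∙ x).

Lemma pwMn x y n : B x -> B y -> (x ∙ y) ^^ n = x ^^ n ∙ y ^^ n.
Proof.
move=> Bx By; elim: n => [|n IH]; first by rewrite /= gmulg1.
rewrite !pwSr IH -!gmulA; congr gmul.
rewrite !gmulA; congr gmul; apply: cB => //; exact: subgrpX.
Qed.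

Lemma finord_mul x y : B x -> B y -> finord x -> finord y -> finord (x ∙ y).
Proof.
move=> Bx By [m m0 xm] [n n0 yn]; exists (m * n)%N; first by rewrite muln_gt0 m0.
change ((x ∙ y) ^^ (m * n) = gid); rewrite pwMn // pwM (_ : x ^^ m = gid) // pw_gid gmul1g.
by rewrite mulnC pwM (_ : y ^^ n = gid) // pw_gid.
Qed.

Lemma finord_inv x : finord x -> finord x⁻¹.
Proof.
by move=> [m m0 xm]; exists m => //; change (x⁻¹ ^^ m = gid); rewrite pwV (_ : x ^^ m = gid) ?ginv1.
Qed.

Variables (I : eqType) (b : I -> G).
Hypotheses (Bb : forall i, B (b i)).
Local Notation cy := (@cyc G gmul gid ginv).

Let cyB i y : cy (b i) y -> B y.
Proof.
move=> [k _ <-]; have [m [n ->]] := int_sub k; rewrite zpow_sub.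
by apply: subgrpM => //; [exact: subgrpX|apply: subgrpV => //; exact: subgrpX].
Qed.

Lemma gprod_in s (y : I -> G) : (forall i, i \in s -> B (y i)) -> B (gprod s y).
Proof.
elim: s => [|i s IH] sP /=; first exact: subgrp1.
apply: subgrpM => //; first by apply: sP; rewrite mem_head.
by apply: IH => j js; apply: sP; rewrite inE js orbT.
Qed.

Lemma gprod_rem s (y : I -> G) i : (forall i, i \in s -> B (y i)) -> i \in s ->
  gprod s y = y i ∙ gprod (rem i s) y.
Proof.
elim: s => //= j s IH sP; rewrite inE; case: eqVneq => [->//|ne] /=.
move=> is_; have sP' : forall i, i \in s -> B (y i) by move=> k ks; apply: sP; rewrite inE ks orbT.
rewrite (IH sP' is_) !gmulA; congr gmul; apply: cB.
  by apply: sP; rewrite mem_head.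
exact: sP'.
Qed.

Lemma gprod_extend s S (y : I -> G) : uniq s -> uniq S -> {subset s <= S} ->
  (forall i, i \in S -> B (y i)) -> (forall i, i \in S -> i \notin s -> y i = gid) ->
  gprod S y = gprod s y.
Proof.
elim: s S => [|i s IH] S us uS sS SB S1 /=.
  elim: S {sS uS SB} S1 => //= j S IH' S1; rewrite S1 ?mem_head // gmul1g.
  by apply: IH' => k kS; apply: S1; rewrite inE kS orbT.
case/andP: us => ni us; rewrite (gprod_rem SB (sS i (mem_head _ _))).
congr gmul; apply: IH => //.
- exact: rem_uniq.
- move=> j js; rewrite mem_rem_uniq // inE sS ?andbT; last by rewrite inE js orbT.
  by apply: contraNneq ni => <-.
- by move=> j /mem_rem; exact: SB.
- move=> j; rewrite mem_rem_uniq // inE => /andP[ne jS] njs; apply: S1 => //.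
  by rewrite inE negb_or ne.
Qed.

Lemma gprod_mul s (y z : I -> G) : (forall i, i \in s -> B (y i)) ->
  (forall i, i \in s -> B (z i)) -> gprod s (fun i => y i ∙ z i) = gprod s y ∙ gprod s z.
Proof.
elim: s => [|i s IH] yB zB /=; first by rewrite gmul1g.
have yB' : forall i, i \in s -> B (y i) by move=> k ks; apply: yB; rewrite inE ks orbT.
have zB' : forall i, i \in s -> B (z i) by move=> k ks; apply: zB; rewrite inE ks orbT.
rewrite IH // !gmulA; congr gmul; rewrite -!gmulA; congr gmul; apply: cB.
  by apply: zB; rewrite mem_head.
exact: gprod_in.
Qed.

Lemma gprod_inv s (y : I -> G) : (forall i, i \in s -> B (y i)) ->
  gprod s (fun i => (y i)⁻¹) = (gprod s y)⁻¹.
Proof.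
elim: s => [|i s IH] yB /=; first by rewrite ginv1.
have yB' : forall i, i \in s -> B (y i) by move=> k ks; apply: yB; rewrite inE ks orbT.
rewrite IH // ginvM; apply: cB; apply: subgrpV => //; last exact: gprod_in.
by apply: yB; rewrite mem_head.
Qed.

Lemma eq_gprod s (y z : I -> G) : (forall i, i \in s -> y i = z i) -> gprod s y = gprod s z.
Proof.
elim: s => //= i s IH e; rewrite e ?mem_head // IH // => j js.
by apply: e; rewrite inE js orbT.
Qed.

(** An exponent of [h] at the summand [i], as a relation. The list must contain [i], possibly with a
    trivial entry, so that a zero coordinate is covered as well. *)
Let crd i h (k : int) := exists (s : seq I) (y : I -> G),
  [/\ uniq s, (forall j, j \in s -> cy (b j) (y j)), h = gprod s y, i \in s & y i = zpow (b i) k].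

Hypothesis indep : forall (s : seq I) (y : I -> G), uniq s ->
  (forall i, i \in s -> cy (b i) (y i)) -> gprod s y = gid -> forall i, i \in s -> y i = gid.

(** The three decompositions are extended by identities to a common list, where independence kills
    the entry of [h h' h''^-1] at [i]; infinite order of [b i] then compares exponents. With [h']
    the identity this is uniqueness of the coordinate. *)
Let crd_add i h h' h'' k k' k'' : ~ finord (b i) -> h ∙ h' = h'' ->
  crd i h k -> crd i h' k' -> crd i h'' k'' -> k'' = (k + k')%R.
Proof.
move=> nf hh [s [y [us yc he is_ yi]]] [s' [y' [us' yc' he' is' yi']]] [s2 [y2 [us2 yc2 he2 is2 yi2]]].
pose S := undup (s ++ s' ++ s2).
have uS : uniq S by exact: undup_uniq.
pose ext (s : seq I) (y : I -> G) j := if j \in s then y j else gid.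
have extc t (z : I -> G) : (forall j, j \in t -> cy (b j) (z j)) -> forall j, cy (b j) (ext t z j).
  by move=> zc j; rewrite /ext; case: ifP => [/zc//|_]; exists 0%R.
have extP t (z : I -> G) : uniq t -> {subset t <= S} -> (forall j, j \in t -> cy (b j) (z j)) ->
    gprod S (ext t z) = gprod t z.
  move=> ut tS zc; rewrite (@gprod_extend t S) //.
  - by apply: eq_gprod => j jt; rewrite /ext jt.
  - by move=> j _; apply: (@cyB j); exact: extc.
  - by move=> j _ njt; rewrite /ext (negbTE njt).
have sub1 : {subset s <= S} by move=> j js; rewrite mem_undup !mem_cat js.
have sub2 : {subset s' <= S} by move=> j js; rewrite mem_undup !mem_cat js orbT.
have sub3 : {subset s2 <= S} by move=> j js; rewrite mem_undup !mem_cat js !orbT.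
pose Y j := ext s y j ∙ ext s' y' j ∙ (ext s2 y2 j)⁻¹.
have b1 j : B (ext s y j) by apply: (@cyB j); exact: extc.
have b2 j : B (ext s' y' j) by apply: (@cyB j); exact: extc.
have b3 j : B (ext s2 y2 j) by apply: (@cyB j); exact: extc.
have Yi : Y i = gid.
  apply: (indep uS); last exact: sub1.
    move=> j _; have [a _ ea] := extc _ _ yc j; have [c _ ec] := extc _ _ yc' j.
    have [d _ ed] := extc _ _ yc2 j; rewrite /Y -ea -ec -ed -zpowN -!zpowD.
    by exists (a + c + - d)%R.
  rewrite (@gprod_mul S (fun j => ext s y j ∙ ext s' y' j) (fun j => (ext s2 y2 j)⁻¹)).
  - rewrite gprod_mul // gprod_inv // !extP // -he -he' -he2 hh gmulgV //.
  - by move=> j _; exact: subgrpM.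
  - by move=> j _; exact: subgrpV.
move: Yi; rewrite /Y /ext is_ is' is2 yi yi' yi2 -zpowN -!zpowD => /zpow_eq1 e.
by apply/eqP; rewrite eq_sym -subr_eq0; apply: contra_notT nf => /e.
Qed.

Let crd_ex i h : (exists (s : seq I) (y : I -> G),
    uniq s /\ (forall i, i \in s -> cy (b i) (y i)) /\ h = gprod s y) -> exists k, crd i h k.
Proof.
move=> [s [y [us [yc he]]]]; have [is_|nis] := boolP (i \in s).
  by have [k _ e] := yc i is_; exists k, s, y.
exists 0%R, (i :: s), (fun j => if j == i then gid else y j); split=> //=.
- by rewrite nis.
- by move=> j; rewrite inE; case: eqVneq => [->|_ /= /yc//]; exists 0%R.
- rewrite eqxx gmul1g he; apply: eq_gprod => j js; case: eqVneq => // e.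
  by rewrite e (negbTE nis) in js.
- by rewrite mem_head.
- by rewrite eqxx.
Qed.

(** A product of commuting elements of finite order has finite order, so some component of [g] has
    infinite order; [chi] is the exponent at that summand. *)
Lemma coordinate g : (forall h, B h -> exists (s : seq I) (y : I -> G),
    uniq s /\ (forall i, i \in s -> cy (b i) (y i)) /\ h = gprod s y) -> B g -> ~ finord g ->
  exists chi : G -> int, (forall x y, B x -> B y -> chi (x ∙ y) = chi x + chi y)%R /\ chi g != 0%R.
Proof.
move=> dec Bg nf; have [s [y [us [yc he]]]] := dec g Bg.
have [i is_ nfi] : exists2 i, i \in s & ~ finord (y i).
  apply: contrapT => no; apply: nf; rewrite he.
  have {}no i : i \in s -> finord (y i).
    by move=> is_; apply: contrapT => h; apply: no; exists i.
  have yB i : i \in s -> B (y i) by move=> /yc /cyB.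
  elim: s {us yc he} no yB => [|i s IH] no yB; first by exists 1%N => //; rewrite /gpow /= gmulg1.
  apply: finord_mul; [by apply: yB; rewrite mem_head| | by apply: no; rewrite mem_head|].
    by apply: gprod_in => j js; apply: yB; rewrite inE js orbT.
  by apply: IH => j js; [apply: no|apply: yB]; rewrite inE js orbT.
have [k _ ek] := yc i is_.
have nfb : ~ finord (b i) by move=> fb; apply: nfi; rewrite -ek; exact: zpow_finord.
have k0 : k != 0%R by apply: contra_notN nfi => /eqP e; rewrite -ek e; exists 1%N => //; rewrite /gpow /= gmulg1.
have /choice [chi chiP] : forall h, exists k, B h -> crd i h k.
  move=> h; have [Bh|nB] := pselect (B h); last by exists 0%R.
  by have [k' c] := crd_ex i (dec h Bh); exists k'.
have c1 : crd i gid 0%R.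
  exists [:: i], (fun=> gid); split=> //; rewrite ?inE //=; last by rewrite gmul1g.
  by move=> j _; exists 0%R.
exists chi; split.
  move=> x z Bx Bz; apply: (crd_add nfb (erefl (x ∙ z))); apply: chiP => //; exact: subgrpM.
have cg : crd i g k by exists s, y.
by rewrite (crd_add nfb (gmulg1 g) cg c1 (chiP g Bg)) addr0.
Qed.

End Abelian.
End DirectSum.

(** * Homomorphisms into groups of the class *)

Section Homomorphism.
Variables (L G : lcGroup) (f : L -> G).
Hypotheses (fM : forall x y, f (x ∙ y) = f x ∙ f y)
  (Gclass : @in_class_G G gmul gid ginv).
Local Notation finord := (@has_finite_order G gmul gid).

Let f1 : f gid = gid.
Proof. by apply: (@gmulIg _ _ _ (f gid)); rewrite -fM !gmul1g. Qed.

Let fV x : f x⁻¹ = (f x)⁻¹.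
Proof. by apply: (@gmulIg _ _ _ (f x)); rewrite -fM !gmulVg. Qed.

Let fX x n : f (x ^^ n) = f x ^^ n.
Proof. by elim: n => //= n IH; rewrite fM IH. Qed.

Lemma character (B : set G) g : subgrp B -> (forall x y, B x -> B y -> x ∙ y = y ∙ x) ->
  B g -> ~ finord g ->
  exists chi : G -> int, (forall x y, B x -> B y -> chi (x ∙ y) = chi x + chi y)%R /\ chi g != 0%R.
Proof.
move=> sB cB Bg nf.
have [I [b [Bb [dec indep]]]] := Gclass.2 B (conj sB cB).
exact: (coordinate sB cB Bb indep dec Bg nf).
Qed.

Lemma closure_powers_comm (x a b : L) :
  closure (powers x) a -> closure (powers x) b -> a ∙ b = b ∙ a.
Proof.
have cl c : closed [set a : L | a ∙ c = c ∙ a].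
  have -> : [set a : L | a ∙ c = c ∙ a] = [set a | [set gid] (a ∙ c ∙ (c ∙ a)⁻¹)].
    apply/predeqP => z; split=> /= e; first by rewrite e gmulgV.
    by apply: (@gmulIg _ _ _ (c ∙ z)⁻¹); rewrite e gmulgV.
  apply: (@closed_comp _ _ (fun z : L => z ∙ c ∙ (c ∙ z)⁻¹)); last by apply: compact_closedL; exact: compact_set1.
  by move=> z _; move: z; gcont.
have pp u v : powers x u -> powers x v -> u ∙ v = v ∙ u.
  move=> [m [->|->]] [n [->|->]]; [exact: pw_comm|exact: pw_commV|by rewrite pw_commV|].
  by rewrite -!ginvM; congr ginv; exact: pw_comm.
have step u v : closure (powers x) u -> powers x v -> u ∙ v = v ∙ u.
  by move=> cu pv; apply: (closure_min (cl v)) cu => w pw; exact: pp.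
by move=> ca cb; symmetry; apply: (closure_min (cl a)) cb => w pw; symmetry; exact: step.
Qed.

(* If [f x] had infinite order, a coordinate [chi] with [chi (f x) = d != 0] would send the
   limit of [x ^ (1 + b + ... + b^(M-1))], [b = |d| + 2], to an integer congruent to
   [d (b^m - 1) / (b - 1)] modulo every [b^m]. *)
Lemma compact_finord (K : set L) x : compact K -> subgrp K -> K x -> finord (f x).
Proof.
move=> cK sK Kx; apply: contrapT => nf.
pose A := closure (powers x).
have sA : subgrp A by apply: closure_subgrp; exact: powers_subgrp.
have AK : A `<=` K.
  apply: closure_min; first exact: compact_closedL.
  by move=> y [n [->|->]]; [exact: subgrpX|apply: subgrpV => //; exact: subgrpX].
have cA : compact A by apply: (subclosed_compact _ cK) => //; exact: closed_closure.
have Apw n : A (x ^^ n) by apply: subset_closure; exists n; left.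
have sB : subgrp (f @` A).
  split; first by exists gid => //; exact: (subgrp1 sA).
  split=> [_ _ [a Aa <-] [b Ab <-]|_ [a Aa <-]].
    by exists (a ∙ b); [exact: (subgrpM sA Aa Ab)|rewrite fM].
  by exists a⁻¹; [exact: (subgrpV sA Aa)|rewrite fV].
have cB u v : (f @` A) u -> (f @` A) v -> u ∙ v = v ∙ u.
  by move=> [a Aa <-] [b Ab <-]; rewrite -!fM (closure_powers_comm Aa Ab).
have Ax : A x by have := Apw 1%N; rewrite pw1.
have Bx : (f @` A) (f x) by exists x.
have [chi [chiD chi0]] := character sB cB Bx nf.
pose h a := chi (f a).
have hD a b : A a -> A b -> h (a ∙ b) = (h a + h b)%R.
  by move=> Aa Ab; rewrite /h fM; apply: chiD; [exists a|exists b].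
have h1 : h gid = 0%R.
  by have := hD gid gid (subgrp1 sA) (subgrp1 sA); rewrite gmul1g; lia.
have hX a n : A a -> h (a ^^ n) = (h a * n%:Z)%R.
  move=> Aa; elim: n => [|n IH]; first by rewrite mulr0.
  by rewrite pwSr hD //; [rewrite IH -addn1 PoszD mulrDr mulr1|exact: (subgrpX n sA Aa)].
(* With this [b] the number [b - 1] is [|d| + 1], which cannot divide the nonzero [d]; but [w = 0]
   would give [(b - 1) h y = - d]. *)
pose d := h x; pose b := `|d|%N.+2.
pose S M := (\sum_(j < M) b ^ j)%N.
have SD m M : (m <= M)%N -> S M = (S m + S (M - m) * b ^ m)%N.
  move=> mM; have -> : S M = S (m + (M - m))%N by rewrite subnKC.
  rewrite /S big_split_ord /=; congr addn.
  by rewrite big_distrl /=; apply: eq_bigr => j _; rewrite -expnD addnC.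
have Sgeo m : (S m * b = S m + b ^ m - 1)%N.
  elim: m => [|m IH]; first by rewrite /S big_ord0.
  have e : S m.+1 = (S m + b ^ m)%N by rewrite /S big_ord_recr.
  rewrite e mulnDl IH expnSr; have : (0 < b ^ m)%N by rewrite expn_gt0.
  by lia.
have [F [UF Fn]] := nat_ultra.
have FF : Filter F by exact: filter_filter.
have lim (u : nat -> nat) : exists2 y, A y & (fun M => x ^^ u M) @ F --> y.
  by apply: ultra_lim => //; apply: filterE => M; exact: Apw.
have [y Ay yP] := lim S.
pose w := ((b%:Z - 1) * h y + d)%R.
have dvd m : (b ^ m %| `|w|)%N.
  have [z Az zP] := lim (fun M => S (M - m)%N).
  have yE : y = x ^^ S m ∙ z ^^ (b ^ m).
    apply: (lim_unique _ yP).
    have zz := cvg_gmul (cvg_cst (x ^^ S m)) (cvg_pw (n := b ^ m) zP).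
    move=> O nO; have FO : F [set M | O (x ^^ S m ∙ (x ^^ S (M - m)%N) ^^ (b ^ m))] := zz FF FF FF O nO.
    change (F [set M | O (x ^^ S M)]).
    apply: filterS2 (Fn m) FO => M /= mM; by rewrite -pwM -pwD -SD.
  have hy : h y = (d * (S m)%:Z + h z * (b ^ m)%N%:Z)%R.
    by rewrite yE hD ?hX //; exact: (subgrpX _ sA).
  have wE : w = ((b ^ m)%N%:Z * (d + (b%:Z - 1) * h z))%R.
    have := Sgeo m; have : (0 < b ^ m)%N by rewrite expn_gt0.
    rewrite /w hy; move: (b ^ m)%N (S m) => p s p0 sg.
    have sg' : (s%:Z * b%:Z = s%:Z + p%:Z - 1)%R by lia.
    have -> : ((b%:Z - 1) * (d * s%:Z + h z * p%:Z) + d =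
      d * (s%:Z * b%:Z) - d * s%:Z + (b%:Z - 1) * h z * p%:Z + d)%R by ring.
    by rewrite sg'; ring.
  by rewrite wE abszM dvdn_mulr.
have w0 : w = 0%R.
  apply/eqP; rewrite -absz_eq0; apply/eqP; case: (posnP `|w|%N) => // w0.
  have := dvdn_leq w0 (dvd `|w|%N); rewrite leqNgt ltn_expl //.
have : `|((b%:Z - 1) * h y)%R|%N = `|d|%N.
  by have -> : ((b%:Z - 1) * h y = - d)%R; [move: w0; rewrite /w; lia|exact: abszN].
rewrite abszM; have -> : `|(b%:Z - 1)%R|%N = `|d|%N.+1 by rewrite /b; lia.
have d0 : (0 < `|d|)%N by rewrite absz_gt0.
by case: (`|h y|)%N => [|k]; nia.
Qed.

Lemma compact_image_finite (K : set L) : compact K -> subgrp K -> finite_set (f @` K).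
Proof.
move=> cK sK; apply: Gclass.1; split; last by move=> _ [x Kx <-]; exact: compact_finord Kx.
split; first by exists gid => //; exact: (subgrp1 sK).
split=> [_ _ [a Ka <-] [b Kb <-]|_ [a Ka <-]].
  by exists (a ∙ b); [exact: (subgrpM sK Ka Kb)|rewrite fM].
by exists a⁻¹; [exact: (subgrpV sK Ka)|rewrite fV].
Qed.

Lemma finite_exponent (B : set G) : finite_set B -> (forall g, B g -> finord g) ->
  exists2 e, (0 < e)%N & forall g, B g -> g ^^ e = gid.
Proof.
move=> /finite_seqP [s ->]; elim: s => [|g s IH] fo; first by exists 1%N.
have [|e e0 eP] := IH; first by move=> h hs; apply: fo; rewrite /= inE; apply/orP; right.
have [n n0 gn] : finord g by apply: fo; rewrite /= mem_head.
exists (e * n)%N; first by rewrite muln_gt0 e0.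
move=> h; rewrite /= inE => /predU1P[->|hs].
  by rewrite mulnC pwM (_ : g ^^ n = gid) // pw_gid.
by rewrite pwM eP // pw_gid.
Qed.

(** The image generates an abelian group. An integral character on it vanishes at [f (X t)], which
    has roots of every order; so the group is torsion, hence finite of some exponent [e], and
    [f (X t)] is itself an [e]-th power. *)
Lemma flow_trivial (R : realType) (X : R -> L) :
  (forall t s : R, 0 <= t -> 0 <= s -> X (t + s) = X t ∙ X s)%R ->
  forall t, (0 <= t)%R -> f (X t) = gid.
Proof.
move=> XD.
pose P (t : R) := (0 <= t)%R.
have div t n : P t -> f (X t) = f (X (t / n.+1%:R)%R) ^^ n.+1.
  move=> t0; have q0 : P (t / n.+1%:R)%R by rewrite /P divr_ge0.
  have aux m : X (m.+1%:R * (t / n.+1%:R))%R = X (t / n.+1%:R)%R ^^ m.+1.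
    elim: m => [|m IH]; first by rewrite mul1r pw1.
    by rewrite pwSr -IH -natr1 mulrDl mul1r XD // mulr_ge0.
  by rewrite -fX -aux mulrCA mulfV ?mulr1 // pnatr_eq0.
have comm t s : P t -> P s -> X t ∙ X s = X s ∙ X t.
  by move=> t0 s0; rewrite -!XD // addrC.
pose B := [set g | exists t s, [/\ P t, P s & g = f (X t) ∙ (f (X s))⁻¹]].
have fc t s : P t -> P s -> f (X t) ∙ f (X s) = f (X s) ∙ f (X t).
  by move=> t0 s0; rewrite -!fM comm.
have fcV t s : P t -> P s -> f (X t) ∙ (f (X s))⁻¹ = (f (X s))⁻¹ ∙ f (X t).
  move=> t0 s0; apply: (@gmulIg _ _ _ (f (X s))); rewrite gmulgVK -gmulA fc //.
  by gsimp.
have BM t s t' s' : P t -> P s -> P t' -> P s' ->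
    f (X t) ∙ (f (X s))⁻¹ ∙ (f (X t') ∙ (f (X s'))⁻¹) = f (X (t + t')%R) ∙ (f (X (s + s')%R))⁻¹.
  move=> t0 s0 t0' s0'; rewrite (addrC s) !XD // !fM ginvM !gmulA; congr (_ ∙ _).
  by rewrite -!gmulA fcV.
have PD t s : P t -> P s -> P (t + s)%R by exact: addr_ge0.
have P0 : P 0%R by exact: lexx.
have sB : subgrp B.
  split; first by exists 0%R, 0%R; split=> //; rewrite gmulgV.
  split=> [_ _ [t [s [t0 s0 ->]]] [t' [s' [t0' s0' ->]]]|_ [t [s [t0 s0 ->]]]].
    by exists (t + t')%R, (s + s')%R; split; [exact: PD|exact: PD|exact: BM].
  by exists s, t; split=> //; gsimp.
have cB u v : B u -> B v -> u ∙ v = v ∙ u.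
  move=> [t [s [t0 s0 ->]]] [t' [s' [t0' s0' ->]]].
  by rewrite !BM // (addrC t) (addrC s).
have BX t : P t -> B (f (X t)).
  move=> t0; exists (t + 0)%R, 0%R; split=> //; first by rewrite addr0.
  by rewrite XD // fM gmulgK.
have fo t : P t -> finord (f (X t)).
  move=> t0; apply: contrapT => nf.
  have [chi [chiD chi0]] := character sB cB (BX t t0) nf.
  have chiX g n : B g -> chi (g ^^ n) = (chi g * n%:Z)%R.
    move=> Bg; elim: n => [|n IH].
      by have := chiD gid gid (subgrp1 sB) (subgrp1 sB); rewrite /= gmul1g; lia.
    by rewrite pwSr chiD //; [rewrite IH -addn1 PoszD mulrDr mulr1|exact: (subgrpX n sB Bg)].
  (* Divisibility by [c + 1] alone suffices: [c] would be a multiple of [c + 1], against [c > 0]. *)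
  pose c := `|chi (f (X t))|%N.
  have q0 : P (t / c.+1%:R)%R by rewrite /P divr_ge0.
  have e : c = (`|chi (f (X (t / c.+1%:R)%R))| * c.+1)%N.
    by rewrite {1}/c (div t c t0) chiX ?abszM //; exact: BX.
  have c0 : (0 < c)%N by rewrite absz_gt0.
  by move: e; case: (`|chi _|)%N => [|k]; nia.
have foB g : B g -> finord g.
  move=> [t [s [t0 s0 ->]]].
  exact: (finord_mul sB cB (BX t t0) (subgrpV sB (BX s s0)) (fo t t0) (finord_inv (fo s s0))).
have finB : finite_set B by apply: Gclass.1; split.
have [[|e] // _ eP] := finite_exponent finB foB.
by move=> t t0; rewrite (div t e t0); apply: eP; apply: BX; rewrite /P divr_ge0.
Qed.

Lemma image_nbhs_finite : exists2 V, nbhs gid V & finite_set (f @` V).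
Proof.
pose R : realType := Rdefinitions.R.
have [U [K [[cU sU KUK] cK sK KU [UK iso]]]] := isolated_normal_subgroup R L.
have [N [l [lP cover]]] := flows_cover R cU sU KUK cK sK KU UK iso.
exists (slow U N); first exact: (slow_nbhs sK KU N).
apply: sub_finite_set (compact_image_finite cK sK) => _ [a sa <-].
have [t [k [t0 Kk ->]]] := cover a sa; exists k => //.
suff -> : f (pflow l t ∙ k) = f k by [].
rewrite fM (_ : f (pflow l t) = gid) ?gmul1g //.
elim: l t t0 lP {cover} => [|X l IH] t t0 lP //=.
rewrite fM IH //; last by move=> Y Yl; apply: lP; right.
by rewrite gmulg1; apply: (@flow_trivial R) => //; have [] := lP X (or_introl erefl).
Qed.

Definition local_image : set G := [set g | forall V, nbhs gid V -> (f @` V) g].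

(** The finitely many values taken near the identity but not in [local_image] are removed one at a
    time, each by shrinking the neighbourhood. *)
Lemma local_image_attained : exists2 V, nbhs gid V & f @` V `<=` local_image.
Proof.
have [V0 nV0 /finite_seqP [s sE]] := image_nbhs_finite.
suff H (s' : seq G) : (exists2 V, nbhs (gid : L) V & forall x, V x -> f x \in s' \/ local_image (f x)) ->
    exists2 V, nbhs gid V & f @` V `<=` local_image.
  apply: (H s); exists V0 => // x Vx; left.
  by have : (f @` V0) (f x) by [exists x]; rewrite sE.
elim: s' => [|g s' IH] [V nV VP].
  by exists V => // _ [x Vx <-]; have [//|] := VP x Vx.
apply: IH; have [Fg|nFg] := pselect (local_image g).
  exists V => // x Vx; have [|h] := VP x Vx; last by right.
  by rewrite inE => /predU1P[->|h]; [right|left].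
move/existsNP: nFg => [W /not_implyP[nW ng]].
exists (V `&` W); first exact: filterI.
move=> x [Vx Wx]; have [|h] := VP x Vx; last by right.
by rewrite inE => /predU1P[e|h]; [case: ng; exists x|left].
Qed.

Lemma continuous_or_normalizes : continuous f \/
  exists F : set G, [/\ @is_subgroup G gmul gid ginv F, finite_set F, F <> [set gid] &
    forall x : L, @normalizes G gmul ginv (f x) F].
Proof.
have [V nV VF] := local_image_attained.
have fin : finite_set local_image.
  have [V0 nV0 fV0] := image_nbhs_finite.
  by apply: sub_finite_set fV0 => g /(_ V0 nV0).
have [e|ne] := pselect (local_image = [set gid]).
  left=> x A nA; have Ax := nbhs_singleton nA.
  change (nbhs x [set y | A (f y)]).
  apply: filterS (nbhs_translate x nV) => y /= Vy.
  suff -> : f y = f x by [].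
  have : local_image (f (y ∙ x⁻¹)) by apply: VF; exists (y ∙ x⁻¹).
  by rewrite e /= fM fV => h; apply: (@gmulIg _ _ _ (f x)⁻¹); rewrite h gmulgV.
right; exists local_image; split=> //.
  have [W [nW sW WV]] := nbhs_split nV.
  split; first by move=> V' nV'; exists gid => //; exact: nbhs_singleton.
  split=> [g h Fg Fh|g Fg].
    have [x Wx <-] := Fg W nW; have [y Wy <-] := Fh W nW.
    by apply: VF; exists (x ∙ y); [exact: WV|rewrite fM].
  have [x Wx <-] := Fg W nW; rewrite -fV; apply: VF; exists x⁻¹ => //.
  have := WV _ _ (sW _ Wx) (nbhs_singleton nW); by rewrite gmulg1.
have conj x g : local_image g -> local_image (f x ∙ g ∙ (f x)⁻¹).
  move=> Fg; have nW : nbhs gid [set z | V (x ∙ z ∙ x⁻¹)].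
    by apply: (@nbhs_preimage _ _ (fun z => x ∙ z ∙ x⁻¹)); [gcont|rewrite gmulg1 gmulgV].
  have [z Vz <-] := Fg _ nW; apply: VF; exists (x ∙ z ∙ x⁻¹) => //.
  by rewrite !fM fV.
move=> x; apply/predeqP => g; split; first by move=> [h Fh <-]; exact: conj.
move=> Fg; exists ((f x)⁻¹ ∙ g ∙ f x); last by gsimp.
by have := conj x⁻¹ g Fg; rewrite fV ginvK.
Qed.

End Homomorphism.

(** * Discrete groups as locally compact groups *)

Lemma discrete_locally_compact (G : discreteTopologicalType) : locally_compact [set: G].
Proof.
move=> x _; exists [set x]; last by split; [exact: compact_set1|exact: discrete_closed].
by rewrite /within /=; apply: filterS (discrete_set1 x) => y /= -> _.
Qed.

Lemma discrete_continuous (G : discreteTopologicalType) (T : topologicalType) (h : G -> T) :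
  continuous h.
Proof.
move=> x A /nbhs_singleton Ax; change (nbhs x [set y | A (h y)]).
by apply: filterS (discrete_set1 x) => y /= ->.
Qed.

Lemma discrete2_continuous (G : discreteTopologicalType) (T : topologicalType) (h : G * G -> T) :
  continuous h.
Proof.
move=> [x y] A /nbhs_singleton Ax; exists ([set x], [set y]); first by split; exact: discrete_set1.
by move=> [u v] [/= -> ->].
Qed.

Theorem theoremD
  (L : topologicalType) (mulL : L -> L -> L) (oneL : L) (invL : L -> L)
  (HL : is_group mulL oneL invL)
  (Hmul_cont : continuous (fun p : L * L => mulL p.1 p.2))
  (Hinv_cont : continuous invL)
  (Hhaus : hausdorff_space L)
  (Hlc : locally_compact [set: L])
  (G : discreteTopologicalType) (mulG : G -> G -> G) (oneG : G) (invG : G -> G)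
  (HG : is_group mulG oneG invG)
  (HGclass : in_class_G mulG oneG invG)
  (phi : L -> G)
  (Hphi : forall x y, phi (mulL x y) = mulG (phi x) (phi y)) :
  continuous phi \/
  exists F : set G,
    [/\ is_subgroup mulG oneG invG F, finite_set F, F <> [set oneG] &
        forall x : L, normalizes mulG invG (phi x) F].
Proof.
pose LL := LcGroup HL Hmul_cont Hinv_cont Hhaus Hlc.
pose GG := LcGroup HG (@discrete2_continuous G G _) (@discrete_continuous G G invG)
  (@discrete_hausdorff G) (@discrete_locally_compact G).
exact: (@continuous_or_normalizes LL GG phi Hphi HGclass).
Qed.
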